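(* Let $\mathcal{C}$ be a fusion category, let $\Pi\in\mathcal{C}$, let $Q$ be the fusion quiver over $\mathcal{C}$ with two vertices $a,b$ and one edge $a\xrightarrow{\ \Pi\ }b$, and let $\mathcal{M}$ be a nonzero finite semisimple left module category over $\mathcal{C}$. Suppose that the following equivalent conditions hold: (1) $\operatorname{Rep}_{\mathcal{M}}(Q)$ has finitely many indecomposable objects up to isomorphism; (2) $\sigma_a\circ\sigma_b$ has finite order on $[\mathcal{M}]\oplus[\mathcal{M}]$; (3) $\sigma_a\circ\sigma_b$ has finite order on $[\mathcal{C}]\oplus[\mathcal{C}]$; (4) there is an integer $m\ge2$ with $\operatorname{FPdim}(\Pi)=2\cos(\pi/m)<2$. Then the unfolded (ordinary) quiver $\check{Q}_{\mathcal{M}}$ is a disjoint union of (bipartite) $ADE$ quivers whose connected components all have the same Coxeter number $m$, with $m$ satisfying $\operatorname{FPdim}(\Pi)=2\cos(\pi/m)$. Conversely, if none of these equivalent conditions hold, then $\check{Q}_{\mathcal{M}}$ is a disjoint union of quivers whose connected components are all of infinite type.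
   Context: $\Bbbk$ is an algebraically closed field; all categories and functors are $\Bbbk$-linear. A fusion category is a semisimple finite abelian rigid monoidal category with simple unit; $[\mathcal{C}]$ is its Grothendieck ring. A left module category over $\mathcal{C}$ is an abelian category $\mathcal{M}$ with an additive monoidal functor $\mathcal{C}\to\operatorname{End}(\mathcal{M})$, written $C\mapsto C\otimes-$; it is finite semisimple if it is a finite abelian category that is semisimple. $[\mathcal{M}]$ is a left $[\mathcal{C}]$-module; $\operatorname{Irr}(\mathcal{M})$ is a set of representatives of isomorphism classes of simples. An object of $\operatorname{Rep}_{\mathcal{M}}(Q)$ is a pair $X_a,X_b\in\mathcal{M}$ with a morphism $\phi:\Pi\otimes X_a\to X_b$; a morphism is a pair of morphisms at the vertices compatible with the structure maps. The operators $\sigma_a=\begin{bmatrix}-1&[{}^*\Pi]\\0&1\end{bmatrix}$, $\sigma_b=\begin{bmatrix}1&0\\ [\Pi]&-1\end{bmatrix}$ (with ${}^*\Pi$ the left dual) act by left multiplication on column vectors in $[\mathcal{C}]\oplus[\mathcal{C}]$ or $[\mathcal{M}]\oplus[\mathcal{M}]$. $\operatorname{FPdim}(\Pi)$ is the Frobenius--Perron eigenvalue of left multiplication by $[\Pi]$ on $[\mathcal{C}]$ in the basis of simples. The unfolded ordinary quiver $\check{Q}_{\mathcal{M}}$ has vertex set $\{a,b\}\times\operatorname{Irr}(\mathcal{M})$ and $\dim\operatorname{Hom}_{\mathcal{M}}(L',\Pi\otimes L)$ arrows from $(a,L)$ to $(b,L')$ for all $L,L'\in\operatorname{Irr}(\mathcal{M})$,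 and no other arrows. An $ADE$ quiver is one whose underlying unoriented graph is a Dynkin diagram of type $A_n$ ($n\geq1$), $D_n$ ($n\ge 4$), $E_6,E_7,E_8$; its Coxeter number is that of the corresponding Coxeter group. A connected quiver is of infinite type if it has infinitely many isomorphism classes of indecomposable finite-dimensional representations over $\Bbbk$. *)

(* Defs.v *)
From HB Require Import structures.
From mathcomp Require Import all_boot all_order all_algebra.
From mathcomp Require Import boolp classical_sets reals trigo.

Set Implicit Arguments.
Unset Strict Implicit.
Unset Printing Implicit Defensive.

Import Order.TTheory GRing.Theory Num.Theory.
Local Open Scope ring_scope.

Reserved Notation "g \co f" (at level 40, left associativity,
  format "g  \co  f").

Record linCat (k : fieldType) := LinCat {
  Ob :> Type;
  Hom : Ob -> Ob -> vectType k;
  idm : forall X, Hom X X;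
  comp : forall X Y Z, Hom Y Z -> Hom X Y -> Hom X Z;
  compA : forall W X Y Z (h : Hom Y Z) (g : Hom X Y) (f : Hom W X),
    comp h (comp g f) = comp (comp h g) f;
  comp1m : forall X Y (f : Hom X Y), comp (idm Y) f = f;
  compm1 : forall X Y (f : Hom X Y), comp f (idm X) = f;
  comp_linearl : forall X Y Z (c : k) (g g' : Hom Y Z) (f : Hom X Y),
    comp (c *: g + g') f = c *: comp g f + comp g' f;
  comp_linearr : forall X Y Z (c : k) (g : Hom Y Z) (f f' : Hom X Y),
    comp g (c *: f + f') = c *: comp g f + comp g f'
}.

Arguments idm {k C} X : rename.
Arguments Hom {k C} X Y : rename.
Notation "g \co f" := (comp g f) : ring_scope.

Section Categories.
Variables (k : fieldType) (C : linCat k).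
Implicit Types X Y Z S P K : C.

Definition inverse_pair X Y (f : Hom X Y) (g : Hom Y X) : Prop :=
  g \co f = idm X /\ f \co g = idm Y.

Definition is_iso X Y (f : Hom X Y) : Prop := exists g, inverse_pair f g.

Definition isomorphic X Y : Prop := exists f : Hom X Y, is_iso f.

Definition mono X Y (f : Hom X Y) : Prop :=
  forall Z (g h : Hom Z X), f \co g = f \co h -> g = h.

Definition epi X Y (f : Hom X Y) : Prop :=
  forall Z (g h : Hom Y Z), g \co f = h \co f -> g = h.

Definition is_zero X : Prop :=
  (forall Y (f : Hom X Y), f = 0) /\ (forall Y (f : Hom Y X), f = 0).

Definition direct_sum (I : finType) (S : I -> C) X : Prop :=
  exists (inj : forall j, Hom (S j) X) (prj : forall j, Hom X (S j)),
  [/\ forall j, prj j \co inj j = idm (S j),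
      forall j l, j != l -> prj j \co inj l = 0
    & \sum_j (inj j \co prj j) = idm X].

Definition is_kernel K X Y (f : Hom X Y) (i : Hom K X) : Prop :=
  f \co i = 0 /\
  forall Z (g : Hom Z X), f \co g = 0 -> exists! h : Hom Z K, i \co h = g.

Definition is_cokernel K X Y (f : Hom X Y) (p : Hom Y K) : Prop :=
  p \co f = 0 /\
  forall Z (g : Hom Y Z), g \co f = 0 -> exists! h : Hom K Z, h \co p = g.

(* The empty direct sum is a zero object. *)
Definition abelian : Prop :=
  [/\ forall (I : finType) (S : I -> C), exists X, direct_sum S X,
      forall X Y (f : Hom X Y),
        (exists K (i : Hom K X), is_kernel f i) /\
        (exists K (p : Hom Y K), is_cokernel f p),
      forall X Y (f : Hom X Y), mono f ->
        exists Z (g : Hom Y Z), is_kernel g f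
    & forall X Y (f : Hom X Y), epi f ->
        exists Z (g : Hom Z X), is_cokernel g f].

Definition simple S : Prop :=
  ~ is_zero S /\
  forall X (i : Hom X S), mono i -> is_zero X \/ is_iso i.

Definition short_exact X Y Z (i : Hom X Y) (p : Hom Y Z) : Prop :=
  is_kernel p i /\ is_cokernel i p.

Inductive finite_length : C -> Prop :=
| finite_length0 X : is_zero X -> finite_length X
| finite_lengthS X Y S (i : Hom X Y) (p : Hom Y S) :
    short_exact i p -> simple S -> finite_length X -> finite_length Y.

Definition projective P : Prop :=
  forall X Y (p : Hom X Y) (f : Hom P Y), epi p -> exists g, p \co g = f.

Definition enough_projectives : Prop :=
  forall X, exists P (p : Hom P X), projective P /\ epi p.

(* [L] lists representatives of the isomorphism classes of simple objects,
   each class exactly once. *)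
Definition irr_reps n (L : 'I_n -> C) : Prop :=
  [/\ forall i, simple (L i),
      forall i j, isomorphic (L i) (L j) -> i = j
    & forall S, simple S -> exists i, isomorphic S (L i)].

Definition finite_abelian : Prop :=
  [/\ abelian, forall X, finite_length X, enough_projectives
    & exists n (L : 'I_n -> C), irr_reps L].

Definition semisimple : Prop :=
  forall X, exists n (S : 'I_n -> C), (forall i, simple (S i)) /\
    direct_sum S X.

Definition finite_semisimple : Prop := finite_abelian /\ semisimple.

Definition indecomposable X : Prop :=
  ~ is_zero X /\
  forall S : bool -> C, direct_sum S X -> exists b, is_zero (S b).

Definition finitely_many_indecomposables : Prop :=
  exists n (F : 'I_n -> C),
    forall X, indecomposable X -> exists i, isomorphic X (F i).

(* The Grothendieck group of a finite semisimple category is the free abelian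
   group on its simple objects [L], here ['cV[int]_n]; the coordinates of the
   class of [X] are the multiplicities of the simples in [X]. *)
Definition decomposition n (L : 'I_n -> C) X (c : {ffun 'I_n -> nat}) : Prop :=
  direct_sum (fun t : {i : 'I_n & 'I_(c i)} => L (tag t)) X.

Definition gr_class n (L : 'I_n -> C) X : 'cV[int]_n :=
  \col_i (xget [ffun=> 0%N] [set c | decomposition L X c] i)%:Z.

(* The endomorphism [L j] |-> [T (L j)] of the Grothendieck group. *)
Definition gr_mx n (L : 'I_n -> C) (T : C -> C) : 'M[int]_n :=
  \matrix_(i, j) gr_class L (T (L j)) i 0.

End Categories.

Record monCat (k : fieldType) := MonCat {
  moncat_cat :> linCat k;
  tens : moncat_cat -> moncat_cat -> moncat_cat;
  tensm : forall X X' Y Y' : moncat_cat,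
    Hom X X' -> Hom Y Y' -> Hom (tens X Y) (tens X' Y');
  munit : moncat_cat;
  assoc : forall X Y Z : moncat_cat,
    Hom (tens (tens X Y) Z) (tens X (tens Y Z));
  assocV : forall X Y Z : moncat_cat,
    Hom (tens X (tens Y Z)) (tens (tens X Y) Z);
  lunit : forall X : moncat_cat, Hom (tens munit X) X;
  runit : forall X : moncat_cat, Hom (tens X munit) X;
  tensm1 : forall X Y : moncat_cat, tensm (idm X) (idm Y) = idm (tens X Y);
  tensm_comp : forall (X X' X'' Y Y' Y'' : moncat_cat)
      (f' : Hom X' X'') (f : Hom X X') (g' : Hom Y' Y'') (g : Hom Y Y'),
    tensm (f' \co f) (g' \co g) = tensm f' g' \co tensm f g;
  tensm_linearl : forall (X X' Y Y' : moncat_cat) (c : k)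
      (f f' : Hom X X') (g : Hom Y Y'),
    tensm (c *: f + f') g = c *: tensm f g + tensm f' g;
  tensm_linearr : forall (X X' Y Y' : moncat_cat) (c : k)
      (f : Hom X X') (g g' : Hom Y Y'),
    tensm f (c *: g + g') = c *: tensm f g + tensm f g';
  assoc_inv : forall X Y Z, inverse_pair (assoc X Y Z) (assocV X Y Z);
  assoc_nat : forall (X X' Y Y' Z Z' : moncat_cat)
      (f : Hom X X') (g : Hom Y Y') (h : Hom Z Z'),
    assoc X' Y' Z' \co tensm (tensm f g) h =
    tensm f (tensm g h) \co assoc X Y Z;
  lunit_iso : forall X, is_iso (lunit X);
  lunit_nat : forall (X X' : moncat_cat) (f : Hom X X'),
    lunit X' \co tensm (idm munit) f = f \co lunit X;
  runit_iso : forall X, is_iso (runit X);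
  runit_nat : forall (X X' : moncat_cat) (f : Hom X X'),
    runit X' \co tensm f (idm munit) = f \co runit X;
  pentagon : forall W X Y Z : moncat_cat,
    tensm (idm W) (assoc X Y Z) \co assoc W (tens X Y) Z
      \co tensm (assoc W X Y) (idm Z) =
    assoc W X (tens Y Z) \co assoc (tens W X) Y Z;
  triangle : forall X Y : moncat_cat,
    tensm (idm X) (lunit Y) \co assoc X munit Y = tensm (runit X) (idm Y)
}.

Arguments tens {k C} X Y : rename.
Arguments tensm {k C X X' Y Y'} f g : rename.
Arguments munit {k} C : rename.
Arguments assoc {k C} X Y Z : rename.
Arguments assocV {k C} X Y Z : rename.
Arguments lunit {k C} X : rename.
Arguments runit {k C} X : rename.

Section Fusion.
Variables (k : fieldType) (C : monCat k).

(* [D] is a left dual of [X]: the evaluation is D (x) X -> 1. *)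
Definition left_dual (D X : C) : Prop :=
  exists (ev : Hom (tens D X) (munit C)) (coev : Hom (munit C) (tens X D)),
    runit X \co tensm (idm X) ev \co assoc X D X \co tensm coev (idm X)
      = lunit X /\
    lunit D \co tensm ev (idm D) \co assocV D X D \co tensm (idm D) coev
      = runit D.

Definition right_dual (D X : C) : Prop := left_dual X D.

Definition rigid : Prop :=
  forall X : C, (exists D, left_dual D X) /\ (exists D, right_dual D X).

Definition fusion : Prop :=
  [/\ finite_semisimple C, rigid & simple (munit C)].

(* The largest nonnegative real eigenvalue of left multiplication by the class
   of [X] on the Grothendieck ring, in the basis of simples. *)
Definition FPdim (R : realType) n (L : 'I_n -> C) (X : C) : R :=
  sup [set x : R | 0 <= x /\ eigenvalue (map_mx intr (gr_mx L (tens X))) x].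

End Fusion.

(* A linear monoidal functor from [C] to the endofunctors of [M], unfolded. *)
Record modCat (k : fieldType) (C : monCat k) := ModCat {
  modcat_cat :> linCat k;
  act : C -> modcat_cat -> modcat_cat;
  actm : forall (X X' : C) (M M' : modcat_cat),
    Hom X X' -> Hom M M' -> Hom (act X M) (act X' M');
  act_assoc : forall (X Y : C) (M : modcat_cat),
    Hom (act (tens X Y) M) (act X (act Y M));
  act_unit : forall M : modcat_cat, Hom (act (munit C) M) M;
  actm1 : forall (X : C) (M : modcat_cat), actm (idm X) (idm M) = idm (act X M);
  actm_comp : forall (X X' X'' : C) (M M' M'' : modcat_cat)
      (f' : Hom X' X'') (f : Hom X X') (g' : Hom M' M'') (g : Hom M M'),
    actm (f' \co f) (g' \co g) = actm f' g' \co actm f g;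
  actm_linearl : forall (X X' : C) (M M' : modcat_cat) (c : k)
      (f f' : Hom X X') (g : Hom M M'),
    actm (c *: f + f') g = c *: actm f g + actm f' g;
  actm_linearr : forall (X X' : C) (M M' : modcat_cat) (c : k)
      (f : Hom X X') (g g' : Hom M M'),
    actm f (c *: g + g') = c *: actm f g + actm f g';
  act_assoc_iso : forall (X Y : C) (M : modcat_cat), is_iso (act_assoc X Y M);
  act_assoc_nat : forall (X X' Y Y' : C) (M M' : modcat_cat)
      (f : Hom X X') (g : Hom Y Y') (h : Hom M M'),
    act_assoc X' Y' M' \co actm (tensm f g) h =
    actm f (actm g h) \co act_assoc X Y M;
  act_unit_iso : forall M : modcat_cat, is_iso (act_unit M);
  act_unit_nat : forall (M M' : modcat_cat) (f : Hom M M'),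
    act_unit M' \co actm (idm (munit C)) f = f \co act_unit M;
  act_pentagon : forall (X Y Z : C) (M : modcat_cat),
    actm (idm X) (act_assoc Y Z M) \co act_assoc X (tens Y Z) M
      \co actm (assoc X Y Z) (idm M) =
    act_assoc X Y (act Z M) \co act_assoc (tens X Y) Z M;
  act_triangle : forall (X : C) (M : modcat_cat),
    actm (idm X) (act_unit M) \co act_assoc X (munit C) M =
    actm (runit X) (idm M)
}.

Arguments act {k C M} X N : rename.
Arguments actm {k C M X X' N N'} f g : rename.

(* The fusion quiver has vertices a, b and a single edge a --Pi--> b. *)
Section FusionQuiver.
Variables (k : fieldType) (C : monCat k) (M : modCat C) (Pi : C).

Record frep := FRep {
  frep_a : M;
  frep_b : M;
  frep_map : Hom (act Pi frep_a) frep_b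
}.

Definition frep_defect (X Y : frep)
    (f : Hom (frep_a X) (frep_a Y) * Hom (frep_b X) (frep_b Y)) :
    Hom (act Pi (frep_a X)) (frep_b Y) :=
  frep_map Y \co actm (idm Pi) f.1 - f.2 \co frep_map X.

Lemma frep_defect_linear X Y : linear (@frep_defect X Y).
Proof.
move=> c f g; rewrite /frep_defect /= actm_linearr comp_linearr comp_linearl.
by rewrite scalerBr opprD addrACA.
Qed.

HB.instance Definition _ X Y :=
  GRing.isLinear.Build k _ _ _ (@frep_defect X Y) (@frep_defect_linear X Y).

(* Morphisms are the pairs making the square with the structure maps commute. *)
Definition frep_hom (X Y : frep) : vectType k :=
  subvs_of (lker (linfun (@frep_defect X Y))).

Lemma frep_homP X Y (f : Hom (frep_a X) (frep_a Y) * Hom (frep_b X) (frep_b Y)) :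
  reflect (frep_map Y \co actm (idm Pi) f.1 = f.2 \co frep_map X)
          (f \in lker (linfun (@frep_defect X Y))).
Proof.
by rewrite memv_ker lfunE /= subr_eq0; apply: eqP.
Qed.

Lemma frep_id_subproof X :
  (idm (frep_a X), idm (frep_b X)) \in lker (linfun (@frep_defect X X)).
Proof. by apply/frep_homP; rewrite /= actm1 comp1m compm1. Qed.

Definition frep_id X : frep_hom X X := Subvs (frep_id_subproof X).

Lemma frep_comp_subproof X Y Z (g : frep_hom Y Z) (f : frep_hom X Y) :
  ((vsval g).1 \co (vsval f).1, (vsval g).2 \co (vsval f).2)
    \in lker (linfun (@frep_defect X Z)).
Proof.
apply/frep_homP => /=.
have /frep_homP ef := subvsP f; have /frep_homP eg := subvsP g.
by rewrite -{1}(comp1m (idm Pi)) actm_comp compA eg -compA ef compA.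
Qed.

Definition frep_comp X Y Z (g : frep_hom Y Z) (f : frep_hom X Y) :
  frep_hom X Z := Subvs (frep_comp_subproof g f).

Lemma frep_compA W X Y Z (h : frep_hom Y Z) (g : frep_hom X Y)
    (f : frep_hom W X) :
  frep_comp h (frep_comp g f) = frep_comp (frep_comp h g) f.
Proof. by apply: val_inj; rewrite /= !compA. Qed.

Lemma frep_comp1m X Y (f : frep_hom X Y) : frep_comp (frep_id Y) f = f.
Proof. by apply: val_inj; rewrite /= !comp1m -surjective_pairing. Qed.

Lemma frep_compm1 X Y (f : frep_hom X Y) : frep_comp f (frep_id X) = f.
Proof. by apply: val_inj; rewrite /= !compm1 -surjective_pairing. Qed.

Lemma frep_comp_linearl X Y Z (c : k) (g g' : frep_hom Y Z)
    (f : frep_hom X Y) :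
  frep_comp (c *: g + g') f = c *: frep_comp g f + frep_comp g' f.
Proof. by apply: val_inj; rewrite /= !comp_linearl. Qed.

Lemma frep_comp_linearr X Y Z (c : k) (g : frep_hom Y Z)
    (f f' : frep_hom X Y) :
  frep_comp g (c *: f + f') = c *: frep_comp g f + frep_comp g f'.
Proof. by apply: val_inj; rewrite /= !comp_linearr. Qed.

Definition Rep : linCat k :=
  LinCat frep_compA frep_comp1m frep_compm1 frep_comp_linearl frep_comp_linearr.

End FusionQuiver.

(* [T] and [T'] are the actions of [Pi] and of its left dual; column vectors
   are split as the a-part followed by the b-part. *)
Section Sigma.
Variables (k : fieldType) (C : linCat k) (n : nat) (L : 'I_n -> C).

Definition sigma_a (T' : C -> C) : 'M[int]_(n + n) :=
  block_mx (- 1%:M) (gr_mx L T') 0 1%:M.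

Definition sigma_b (T : C -> C) : 'M[int]_(n + n) :=
  block_mx 1%:M 0 (gr_mx L T) (- 1%:M).

End Sigma.

Definition has_order n (g : 'M[int]_n) (m : nat) : Prop :=
  [/\ (0 < m)%N, g ^+ m = 1 & forall r, (0 < r < m)%N -> g ^+ r <> 1].

Definition finite_order n (g : 'M[int]_n) : Prop := exists m, has_order g m.

(* The arrows from [x] to [y] are labelled by ['I_(narr x y)]. *)
Record quiver := Quiver {
  qvert :> finType;
  narr : qvert -> qvert -> nat
}.

Section Quivers.
Variables (k : fieldType) (Q : quiver).

Record qrep := QRep {
  qdim : Q -> nat;
  qmap : forall x y, 'I_(narr x y) -> 'M[k]_(qdim y, qdim x)
}.

Definition qrep_iso (V W : qrep) : Prop :=
  exists (f : forall x, 'M[k]_(qdim W x, qdim V x))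
         (g : forall x, 'M[k]_(qdim V x, qdim W x)),
  [/\ forall x, g x *m f x = 1%:M, forall x, f x *m g x = 1%:M
    & forall x y (e : 'I_(narr x y)), f y *m qmap V e = qmap W e *m f x].

Definition qrep_sum (V W : qrep) : qrep :=
  @QRep (fun x => (qdim V x + qdim W x)%N)
    (fun x y e => block_mx (qmap V e) 0 0 (qmap W e)).

Definition qrep_zero (V : qrep) : Prop := forall x, qdim V x = 0%N.

Definition qrep_indecomposable (V : qrep) : Prop :=
  ~ qrep_zero V /\
  forall W W', qrep_iso V (qrep_sum W W') -> qrep_zero W \/ qrep_zero W'.

Definition infinite_type : Prop :=
  ~ exists n (F : 'I_n -> qrep),
      forall V, qrep_indecomposable V -> exists i, qrep_iso V (F i).

Definition nedge (x y : Q) : nat := (narr x y + narr y x)%N.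

Definition component (v : Q) : quiver :=
  @Quiver {x : Q | connect (fun x y => (0 < nedge x y)%N) v x}
    (fun x y => narr (val x) (val y)).

(* Every vertex is a source or a sink. *)
Definition bipartite : Prop :=
  exists s : pred Q, forall x y : Q, (0 < narr x y)%N -> s x && ~~ s y.

End Quivers.

Inductive dynkin := TypeA of nat | TypeD of nat | TypeE6 | TypeE7 | TypeE8.

Definition dynkin_wf (t : dynkin) : bool :=
  match t with TypeA n => (1 <= n)%N | TypeD n => (4 <= n)%N | _ => true end.

Definition dynkin_rank (t : dynkin) : nat :=
  match t with
  | TypeA n => n | TypeD n => n
  | TypeE6 => 6%N | TypeE7 => 7%N | TypeE8 => 8%N
  end.

(* Types D and E consist of the chain 0 - 1 - ... - (n-2) together with one
   more node n-1, attached to node n-3 in type D and to node 2 in type E. *)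
Definition dynkin_edge (t : dynkin) (i j : nat) : bool :=
  let n := dynkin_rank t in
  match t with
  | TypeA _ => i.+1 == j
  | TypeD _ => (i.+1 == j) && (j < n.-1)%N || (i == n - 3)%N && (j == n.-1)
  | _ => (i.+1 == j) && (j < n.-1)%N || (i == 2)%N && (j == n.-1)
  end.

Definition dynkin_adj (t : dynkin) (i j : 'I_(dynkin_rank t)) : bool :=
  dynkin_edge t i j || dynkin_edge t j i.

Definition cartan (t : dynkin) (i j : 'I_(dynkin_rank t)) : int :=
  2 *+ (i == j) - (dynkin_adj i j)%:Z.

(* The Coxeter group is taken in its (faithful) geometric representation: in
   the basis of simple roots, s_i (alpha_j) = alpha_j - cartan i j * alpha_i. *)
Definition simple_reflection (t : dynkin) (i : 'I_(dynkin_rank t)) :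
    'M[int]_(dynkin_rank t) :=
  \matrix_(p, q) ((p == q)%:Z - cartan i q *+ (p == i)).

Definition coxeter_element (t : dynkin) : 'M[int]_(dynkin_rank t) :=
  \prod_(i < dynkin_rank t) simple_reflection i.

Definition coxeter_number (t : dynkin) (m : nat) : Prop :=
  has_order (coxeter_element t) m.

Definition has_dynkin_type (Q : quiver) (t : dynkin) : Prop :=
  dynkin_wf t /\
  exists h : Q -> 'I_(dynkin_rank t),
    bijective h /\ forall x y, nedge x y = dynkin_adj (h x) (h y).

Definition ADE_with_coxeter_number (Q : quiver) (m : nat) : Prop :=
  exists t, has_dynkin_type Q t /\ coxeter_number t m.

(* [false] stands for the vertex a and [true] for the vertex b. *)
Definition unfolded (k : fieldType) (C : monCat k) (M : modCat C) (Pi : C)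
    n (L : 'I_n -> M) : quiver :=
  @Quiver (bool * 'I_n)%type
    (fun x y => if ~~ x.1 && y.1
                then \dim {: Hom (L y.2) (act Pi (L x.2))} else 0%N).

(* Main.v *)
From HB Require Import structures.
From mathcomp Require Import all_boot all_order all_algebra.
From mathcomp Require Import boolp classical_sets reals trigo.
From mathcomp Require Import topology normedtype derive.
From mathcomp Require Import zify ring lra.
Require Import Defs.

Set Implicit Arguments.
Unset Strict Implicit.
Unset Printing Implicit Defensive.

Import Order.TTheory GRing.Theory Num.Theory.
Local Open Scope ring_scope.

(** Let lam be the Frobenius-Perron dimension of Pi. Everything is governed by
    whether lam < 2.

    The matrix N of Pi on [M], in the basis of simple objects, is transposed by
    passing to the dual of Pi ([mult_dual]). Right multiplication by the sum of all
    simple objects of [C] gives a positive matrix commuting with all left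
    multiplications, so its Perron vector is an eigenvector of Pi and of its dual
    ([fusion_eigenvector], [FPdimE]); acting with it on the sum of all simple
    objects of [M] gives a positive vector v with N v = lam v and N^T v = lam v
    ([module_eigenvector]). Hence (v, v) restricts to a positive eigenvector, of
    the same eigenvalue lam, of the adjacency matrix of each component of the
    unfolded quiver. This is why all the components behave alike.

    Representations are studied by reflection functors ([reflection]), which
    replace P (x) A -> B by the adjoint D (x) K -> A of its kernel and so pass
    from P to its left dual D. Pairing the dimension vectors with v turns
    reflections into the recurrence s_{j+1} = lam s_j - s_{j-1}. If lam < 2, it
    turns nonpositive after a bounded number of steps, so that every
    indecomposable is obtained from a simple object by boundedly many inverse
    reflections, and there are finitely many ([Rep_finite]). If lam >= 2, it
    grows, and reflecting a simple object yields infinitely many indecomposables,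
    in [M] ([Rep_infinite]) and, by evaluating Hom(L, -) on simple objects L, on
    every component of the unfolded quiver ([component_infinite_type]).

    The Coxeter transformation preserves the integral quadratic form with matrix
    2 - A, where A is the adjacency matrix. If lam < 2, this form is positive
    definite, so the powers are bounded integer matrices and the order is finite;
    if lam >= 2, the orbit of (v, 0) grows by the same recurrence
    ([sigma_finite_order], [sigma_infinite_order]). The same argument applies to
    [C] as a module category over itself.

    Finally, a graph having a positive eigenvector with eigenvalue lam < 2
    contains no affine diagram, and a maximal Dynkin subdiagram exhausts its
    component ([dynkin_component]). Pairing with the explicit Perron vector of
    that Dynkin diagram gives lam = 2 cos (pi / h) ([dynkin_eigenvalue]), where h
    is its Coxeter number, found by letting the Coxeter element act on explicit
    coordinates ([coxeter_number_dynkin]). As lam is common to all components and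
    determines h, they all have the same Coxeter number. *)

(** * Linear algebra and linear categories *)

Section Coordinates.
Variable k : fieldType.
Implicit Types U V W : vectType k.

Definition vcol V (x : V) : 'cV[k]_(\dim {:V}) :=
  \col_i coord (vbasis {:V}) i x.

Definition colv V (c : 'cV[k]_(\dim {:V})) : V :=
  \sum_i c i 0 *: (vbasis {:V})`_i.

Definition lin_col_mx U V (f : U -> V) : 'M[k]_(\dim {:V}, \dim {:U}) :=
  \matrix_(i, j) coord (vbasis {:V}) i (f (vbasis {:U})`_j).

Lemma vcolK V : cancel (@vcol V) (@colv V).
Proof.
move=> x; rewrite [RHS](coord_vbasis (memvf x)).
by apply: eq_bigr => i _; rewrite mxE.
Qed.

Lemma colvK V : cancel (@colv V) (@vcol V).
Proof.
move=> c; apply/colP => i; rewrite mxE coord_sum_free //.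
exact: basis_free (vbasisP _).
Qed.

Lemma colv_is_linear V : linear (@colv V).
Proof.
move=> a c d; rewrite /colv scaler_sumr -big_split; apply: eq_bigr => i _.
by rewrite !mxE scalerDl scalerA.
Qed.

Lemma vcol_is_linear V : linear (@vcol V).
Proof. by move=> a x y; apply/colP => i; rewrite !mxE linearP. Qed.

Lemma mul_lin_col_mx U V (f : {linear U -> V}) x :
  lin_col_mx f *m vcol x = vcol (f x).
Proof.
apply/colP => i; rewrite !mxE {2}(coord_vbasis (memvf x)) !linear_sum.
by apply: eq_bigr => j _; rewrite !mxE !linearZ /= mulrC.
Qed.

Lemma vcol_inj V : injective (@vcol V). Proof. exact: can_inj (@vcolK V). Qed.

Lemma mx_ext_vcol U m (A B : 'M[k]_(m, \dim {:U})) :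
  (forall x : U, A *m vcol x = B *m vcol x) -> A = B.
Proof.
move=> eqAB; apply/matrixP => i j.
have := eqAB (colv (delta_mx j 0)); rewrite colvK -!colE.
by move/colP/(_ i); rewrite !mxE.
Qed.

Lemma linear_inj_dim U V (f : U -> V) :
  linear f -> injective f -> (\dim {:U} <= \dim {:V})%N.
Proof.
move=> lf injf.
pose lfM := GRing.isLinear.Build _ _ _ _ f lf.
pose F : {linear U -> V} := HB.pack f lfM.
have injF : lker (linfun F) == 0%VS.
  by apply/lker0P => x y; rewrite !lfunE; apply: injf.
rewrite -(@limg_dim_eq _ _ _ (linfun F)) ?dimvS ?subvf //.
by rewrite (eqP injF) capv0.
Qed.

(** The images of the [f t] span, and they are independent because the [g t]
    tell them apart. *)
Lemma dim_biproduct (I : finType) (W : I -> vectType k) V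
    (f : forall t, W t -> V) (g : forall t, V -> W t) :
  (forall t, linear (f t)) -> (forall t, linear (g t)) ->
  (forall t x, g t (f t x) = x) ->
  (forall t s x, t != s -> g t (f s x) = 0) ->
  (forall x, \sum_t f t (g t x) = x) ->
  \dim {:V} = (\sum_t \dim {:W t})%N.
Proof.
move=> lf lg gf gf0 fg.
pose F t : {linear W t -> V} :=
  HB.pack (f t) (GRing.isLinear.Build _ _ _ _ (f t) (lf t)).
pose G t : {linear V -> W t} :=
  HB.pack (g t) (GRing.isLinear.Build _ _ _ _ (g t) (lg t)).
have g0 t : g t 0 = 0 := linear0 (G t).
have f0 t : f t 0 = 0 := linear0 (F t).
pose Vs t := limg (linfun (F t)).
have dVs t : \dim (Vs t) = \dim {:W t}.
  rewrite limg_dim_eq //; apply/eqP; rewrite -subv0; apply/subvP => x.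
  rewrite memv_cap memv_ker lfunE /= => /andP[_ /eqP fx0].
  by rewrite memv0 -(gf t x) fx0 g0.
have dxV : directv (\sum_t Vs t)%VS.
  apply/directv_sum_independent => us Vus us0 t _.
  have [x _ def_x] := memv_imgP (Vus t isT).
  have: G t (\sum_i us i) = 0 by rewrite us0 linear0.
  rewrite linear_sum (bigD1 t) //= big1 ?addr0 => [|s st].
    by rewrite def_x lfunE /= gf => ->; rewrite f0.
  have [y _ ->] := memv_imgP (Vus s isT).
  by rewrite lfunE /= gf0 // eq_sym.
have -> : {:V}%VS = (\sum_t Vs t)%VS.
  apply/eqP; rewrite eqEsubv subvf andbT; apply/subvP => x _.
  rewrite -(fg x); apply: memv_sumr => t _.
  by apply/memv_imgP; exists (g t x); rewrite ?memvf ?lfunE.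
by rewrite (directvP dxV) /=; apply: eq_bigr.
Qed.

End Coordinates.

Section LinCat.
Variables (k : fieldType) (C : linCat k).
Implicit Types X Y Z : C.

(** Composition as a function of its second factor, so that it can carry a
    linear structure. *)
Definition precomp X Y Z (f : Hom X Y) (g : Hom Y Z) := g \co f.

Lemma precomp_linear X Y Z (f : Hom X Y) : linear (@precomp X Y Z f).
Proof. by move=> c g h; rewrite /precomp comp_linearl. Qed.

HB.instance Definition _ X Y Z (g : Hom Y Z) :=
  GRing.isLinear.Build k (Hom X Y) (Hom X Z) _ (@comp k C X Y Z g)
    (fun c f f' => comp_linearr c g f f').

HB.instance Definition _ X Y Z (f : Hom X Y) :=
  GRing.isLinear.Build k (Hom Y Z) (Hom X Z) _ (@precomp X Y Z f)
    (precomp_linear f).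

Lemma comp0m X Y Z (f : Hom X Y) : (0 : Hom Y Z) \co f = 0.
Proof. exact: (linear0 (@precomp X Y Z f)). Qed.

Lemma compm0 X Y Z (g : Hom Y Z) : g \co (0 : Hom X Y) = 0.
Proof. exact: (linear0 (@comp k C X Y Z g)). Qed.

Lemma compBl X Y Z (g g' : Hom Y Z) (f : Hom X Y) :
  (g - g') \co f = g \co f - g' \co f.
Proof. exact: (linearB (@precomp X Y Z f)). Qed.

Lemma compBr X Y Z (g : Hom Y Z) (f f' : Hom X Y) :
  g \co (f - f') = g \co f - g \co f'.
Proof. exact: (linearB (@comp k C X Y Z g)). Qed.

Lemma compZl X Y Z c (g : Hom Y Z) (f : Hom X Y) :
  (c *: g) \co f = c *: (g \co f).
Proof. exact: (linearZ_LR (@precomp X Y Z f)). Qed.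

Lemma compZr X Y Z c (g : Hom Y Z) (f : Hom X Y) :
  g \co (c *: f) = c *: (g \co f).
Proof. exact: (linearZ_LR (@comp k C X Y Z g)). Qed.

Lemma comp_suml X Y Z (I : finType) (g : I -> Hom Y Z) (f : Hom X Y) :
  (\sum_t g t) \co f = \sum_t (g t \co f).
Proof. exact: (linear_sum (@precomp X Y Z f)). Qed.

Lemma comp_sumr X Y Z (I : finType) (g : Hom Y Z) (f : I -> Hom X Y) :
  g \co (\sum_t f t) = \sum_t (g \co f t).
Proof. exact: (linear_sum (@comp k C X Y Z g)). Qed.

Lemma is_zeroP X : is_zero X <-> idm X = 0.
Proof.
split=> [[X0 _] | X0]; first exact: X0.
by split=> Y f; rewrite -1?[f]comp1m -1?[f]compm1 X0 ?comp0m ?compm0.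
Qed.

Lemma zero_source X Y (f : Hom X Y) : is_zero X -> f = 0.
Proof. by case. Qed.

Lemma zero_target X Y (f : Hom Y X) : is_zero X -> f = 0.
Proof. by case. Qed.

Lemma iso_epi X Y (f : Hom X Y) : is_iso f -> epi f.
Proof.
move=> [g [_ fg]] Z u v /(congr1 (precomp g)).
by rewrite /precomp -!compA fg !compm1.
Qed.

Lemma isomorphic_refl X : isomorphic X X.
Proof. by exists (idm X), (idm X); split; rewrite comp1m. Qed.

Lemma isomorphic_sym X Y : isomorphic X Y -> isomorphic Y X.
Proof. by move=> [f [g [gf fg]]]; exists g, f; split. Qed.

Lemma isomorphic_trans X Y Z :
  isomorphic X Y -> isomorphic Y Z -> isomorphic X Z.
Proof.
move=> [f [g [gf fg]]] [f' [g' [gf' fg']]]; exists (f' \co f), (g \co g').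
by split; rewrite compA -1?(compA g) -1?(compA f') ?gf' ?fg ?compm1.
Qed.

Lemma isomorphic_zero X Y : isomorphic X Y -> is_zero X -> is_zero Y.
Proof.
move=> [f [g [_ fg]]] X0; apply/is_zeroP.
by rewrite -fg (zero_target g X0) compm0.
Qed.

Lemma kernel_mono K X Y (f : Hom X Y) (i : Hom K X) : is_kernel f i -> mono i.
Proof.
move=> [fi ker] Z g h eq_gh.
have [|u [_ uniq_u]] := ker _ (i \co h); first by rewrite compA fi comp0m.
by rewrite -(uniq_u _ eq_gh) (uniq_u h).
Qed.

Lemma direct_sum_iso X Y : isomorphic X Y -> direct_sum (fun _ : unit => Y) X.
Proof.
move=> [f [g [gf fg]]]; exists (fun=> g), (fun=> f); split=> [//|[] []//|].
by rewrite (bigD1 tt) //= big1 ?addr0 // => -[].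
Qed.

Lemma direct_sum_replace (I : finType) (S T : I -> C) X :
  (forall t, isomorphic (S t) (T t)) -> direct_sum S X -> direct_sum T X.
Proof.
move=> /fin_all_exists[f /fin_all_exists[g isofg]] [inj [prj [pi pi0 ip]]].
exists (fun t => inj t \co g t), (fun t => f t \co prj t); split.
- by move=> t; rewrite compA -(compA _ _ (inj t)) pi compm1; case: (isofg t).
- move=> t s ts; rewrite compA -(compA _ _ (inj s)) pi0 //.
  by rewrite compm0 comp0m.
rewrite -ip; apply: eq_bigr => t _; rewrite compA -(compA _ _ (f t)).
by have [-> _] := isofg t; rewrite compm1.
Qed.

Lemma dim_Hom_direct_sum (I : finType) (S : I -> C) X Y :
  direct_sum S X -> \dim {: Hom Y X} = (\sum_t \dim {: Hom Y (S t)})%N.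
Proof.
move=> [inj [prj [pi pi0 ip]]].
apply: (@dim_biproduct _ _ _ _ (fun t => comp (inj t)) (fun t => comp (prj t))).
- by move=> t c f g; rewrite comp_linearr.
- by move=> t c f g; rewrite comp_linearr.
- by move=> t f; rewrite compA pi comp1m.
- by move=> t s f ts; rewrite compA pi0 // comp0m.
move=> f; rewrite -[RHS]comp1m -ip comp_suml.
by apply: eq_bigr => t _; rewrite compA.
Qed.

Lemma dim_Hom_from_direct_sum (I : finType) (S : I -> C) X Y :
  direct_sum S X -> \dim {: Hom X Y} = (\sum_t \dim {: Hom (S t) Y})%N.
Proof.
move=> [inj [prj [pi pi0 ip]]].
apply: (@dim_biproduct _ _ _ _
  (fun t => @precomp _ _ _ (prj t)) (fun t => @precomp _ _ _ (inj t))).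
- by move=> t; apply: precomp_linear.
- by move=> t; apply: precomp_linear.
- by move=> t f; rewrite /precomp -compA pi compm1.
- by move=> t s f ts; rewrite /precomp -compA pi0 1?eq_sym // compm0.
move=> f; rewrite -[RHS]compm1 -ip comp_sumr.
by apply: eq_bigr => t _; rewrite /precomp compA.
Qed.

End LinCat.

(** * Finite semisimple categories over an algebraically closed field *)

Section Semisimple.
Variables (k : closedFieldType) (C : linCat k).
Hypothesis hC : finite_semisimple C.
Implicit Types X Y Z S T A B : C.

Let abC : abelian C. Proof. by case: hC => -[]. Qed.

Lemma kernel_exists X Y (f : Hom X Y) : exists K (i : Hom K X), is_kernel f i.
Proof. by have [_ /(_ _ _ f)[kerf _] _ _] := abC. Qed.

Lemma cokernel_exists X Y (f : Hom X Y) :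
  exists K (p : Hom Y K), is_cokernel f p.
Proof. by have [_ /(_ _ _ f)[_ cokf] _ _] := abC. Qed.

Lemma biproduct_exists (I : finType) (S : I -> C) : exists X, direct_sum S X.
Proof. by case: abC. Qed.

Lemma zero_object : exists Z : C, is_zero Z.
Proof.
have [X [inj [prj [_ _ ip]]]] := biproduct_exists (fun v : void => match v with end).
by exists X; apply/is_zeroP; rewrite -ip big_pred0 //; case.
Qed.

Lemma simple_idm S : simple S -> idm S <> 0.
Proof. by move=> [S0 _] /is_zeroP. Qed.

Lemma simple_iso S T (f : Hom S T) : simple S -> simple T -> f <> 0 -> is_iso f.
Proof.
move=> [S0 simS] [T0 simT] f0.
have [K [i kerf]] := kernel_exists f.
have [fi univ] := kerf.
have [K0|isoi] := simS K i (kernel_mono kerf).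
- have [|//|//] := simT S f.
  move=> Z g h eqfgh; apply/eqP; rewrite -subr_eq0; apply/eqP.
  have [|u [<- _]] := univ _ (g - h); first by rewrite compBr eqfgh subrr.
  by rewrite (zero_target u K0) compm0.
by case: f0; apply: (iso_epi isoi); rewrite fi comp0m.
Qed.

(** Schur's lemma over an algebraically closed field: postcomposition by [f] on
    the nonzero space End(S) has an eigenvector, which is invertible. *)
Lemma simple_scalar S (f : Hom S S) : simple S -> exists c, f = c *: idm S.
Proof.
move=> simS; pose A := lin_col_mx (@comp k C S S S f).
have dimS : (0 < \dim {:Hom S S})%N.
  rewrite lt0n dimv_eq0; apply: contra_notN (simple_idm simS) => /eqP S0.
  by apply/eqP; rewrite -memv0 -S0 memvf.
have [a] : exists a, root (char_poly A^T) a.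
  apply/closed_rootP; rewrite size_char_poly; by case: (\dim _) dimS.
rewrite -eigenvalue_root_char => /eigenvalueP[v vA v0].
have eqA : A *m v^T = a *: v^T by rewrite -[A]trmxK -trmx_mul vA linearZ.
pose g := colv v^T; have defv : v^T = vcol g by rewrite colvK.
have fg : f \co g = a *: g.
  apply: vcol_inj; rewrite -(mul_lin_col_mx (@comp k C S S S f)) -defv eqA defv.
  by apply/colP => i; rewrite !mxE linearZ.
have g0 : g <> 0.
  move=> g0; case/eqP: v0; apply: trmx_inj; rewrite defv g0.
  by apply/colP => i; rewrite !mxE linear0.
exists a; apply: (iso_epi (simple_iso simS simS g0)).
by rewrite fg compZl comp1m.
Qed.

Lemma dim_simple_End S : simple S -> \dim {:Hom S S} = 1%N.
Proof.
move=> simS; have id0 := simple_idm simS.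
suff -> : {:Hom S S}%VS = <[idm S]>%VS by rewrite dim_vline; case: eqP.
apply/eqP; rewrite eqEsubv subvf andbT; apply/subvP => f _.
by have [c ->] := simple_scalar f simS; rewrite memvZ ?memv_line.
Qed.

Variables (n : nat) (L : 'I_n -> C).
Hypothesis hL : irr_reps L.

Lemma simpleL i : simple (L i). Proof. by case: hL. Qed.

Lemma HomL_neq i j (f : Hom (L i) (L j)) : i != j -> f = 0.
Proof.
move=> ij; apply/eqP; apply: contraNT ij => /eqP f0; apply/eqP.
have [_ injL _] := hL; apply: injL; exists f.
exact: simple_iso (simpleL i) (simpleL j) f0.
Qed.

Lemma dim_HomL i j : \dim {:Hom (L i) (L j)} = (i == j).
Proof.
case: eqVneq => [<-|ij]; first exact: dim_simple_End (simpleL i).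
apply/eqP; rewrite dimv_eq0 -subv0; apply/subvP => f _.
by rewrite memv0 (HomL_neq f ij).
Qed.

Lemma decomp X : exists m (j : 'I_m -> 'I_n), direct_sum (fun t => L (j t)) X.
Proof.
have [_ ss] := hC; have [m [S [simS dsX]]] := ss X.
have [_ _ repL] := hL.
have /fin_all_exists[j isoj] t := repL _ (simS t).
by exists m, j; apply: direct_sum_replace dsX.
Qed.

(** By Schur's lemma, the number of summands isomorphic to [L i]. *)
Definition mult i X : nat := \dim {:Hom (L i) X}.

Lemma mult_direct_sum i (I : finType) (S : I -> C) X :
  direct_sum S X -> mult i X = (\sum_t mult i (S t))%N.
Proof. exact: dim_Hom_direct_sum. Qed.

Lemma mult_iso i X Y : isomorphic X Y -> mult i X = mult i Y.
Proof.
by move=> /direct_sum_iso/(mult_direct_sum i) ->; rewrite (bigD1 tt) //= big1 ?addn0 // => -[].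
Qed.

Lemma mult_L i j : mult i (L j) = (i == j).
Proof. exact: dim_HomL. Qed.

Lemma mult_to i X : \dim {:Hom X (L i)} = mult i X.
Proof.
have [m [j dsX]] := decomp X.
rewrite (dim_Hom_from_direct_sum _ dsX) (mult_direct_sum i dsX).
by apply: eq_bigr => t _; rewrite dim_HomL mult_L eq_sym.
Qed.

(** Decompose [X] into simple objects and count them. Applied to either argument
    of an action, this replaces objects by their classes in the Grothendieck
    group. *)
Lemma additive_mult (T : C -> nat) :
  (forall (I : finType) (S : I -> C) X,
     direct_sum S X -> T X = (\sum_t T (S t))%N) ->
  forall X, T X = (\sum_j T (L j) * mult j X)%N.
Proof.
move=> addT X; have [m [j dsX]] := decomp X.
rewrite (addT _ _ _ dsX).
under [RHS]eq_bigr do rewrite (mult_direct_sum _ dsX) big_distrr.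
rewrite exchange_big; apply: eq_bigr => t _.
rewrite (bigD1 (j t)) //= mult_L eqxx muln1 big1 ?addn0 // => i ij.
by rewrite mult_L (negPf ij) muln0.
Qed.

Lemma mult0_zero X : (forall i, mult i X = 0%N) -> is_zero X.
Proof.
move=> mX; have [m [j [inj [prj [pi _ ip]]]]] := decomp X.
apply/is_zeroP; rewrite -ip big1 // => t _.
suff -> : inj t = 0 by rewrite comp0m.
apply/eqP; rewrite -memv0; have := mX (j t).
by move/eqP; rewrite dimv_eq0 => /eqP <-; rewrite memvf.
Qed.

Lemma is_zero_mult X i : is_zero X -> mult i X = 0%N.
Proof.
move=> X0; apply/eqP; rewrite dimv_eq0 -subv0; apply/subvP => f _.
by rewrite memv0 (zero_target f X0).
Qed.

Lemma nonzero_has_simple X : ~ is_zero X -> exists i, (0 < mult i X)%N.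
Proof.
move=> X0; apply: contrapT => H; apply: X0; apply: mult0_zero => i.
by apply/eqP; rewrite -leqn0 leqNgt; apply/negP => ?; apply: H; exists i.
Qed.

Lemma decomposition_mult X c : decomposition L X c -> forall i, c i = mult i X.
Proof.
move=> /mult_direct_sum dX i; rewrite dX /=.
have E (t : {i : 'I_n & 'I_(c i)}) : mult i (L (tag t)) = (i == tag t).
  exact: mult_L.
rewrite (eq_bigr _ (fun t _ => E t)).
have := @sig_big_dep _ 0%N addn 'I_n (fun i => 'I_(c i) : finType) xpredT
   (fun _ => xpredT) (fun l _ => nat_of_bool (i == l)).
move=> <- /=; rewrite (bigD1 i) //= eqxx sum_nat_const card_ord muln1.
rewrite big1 ?addn0 // => l li; rewrite big1 // => _ _.
by rewrite eq_sym (negPf li).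
Qed.

(** The index type demanded by [decomposition] groups the simple summands of [X]
    by isomorphism class; the bijection [ev] enumerates each group. *)
Lemma decomposition_exists X : decomposition L X [ffun i => mult i X].
Proof.
have [m [j dsX]] := decomp X.
pose c : {ffun 'I_n -> nat} := [ffun i => #|[pred t | j t == i]|].
suff dc : decomposition L X c.
  rewrite (_ : [ffun i => _] = c) //; apply/ffunP => i.
  by rewrite ffunE -(decomposition_mult dc).
have [inj [prj [pi pi0 ip]]] := dsX.
have cE i : c i = #|[pred t | j t == i]| by rewrite ffunE.
pose ev (u : {i : 'I_n & 'I_(c i)}) : 'I_m :=
  enum_val (cast_ord (cE (tag u)) (tagged u)).
have jev u : j (ev u) = tag u.
  by have := enum_valP (cast_ord (cE (tag u)) (tagged u)); rewrite inE => /eqP.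
have evinj : injective ev.
  move=> [i s] [i' s'] e; have ii' : i = i'.
    by have := jev (existT _ i s); rewrite e jev.
  subst i'; congr existT; move: e; rewrite /ev /=.
  by move/enum_val_inj/cast_ord_inj.
have evP t : exists u, ev u = t.
  have tA : t \in [pred t' | j t' == j t] by rewrite inE.
  exists (existT _ (j t) (cast_ord (esym (cE (j t))) (enum_rank_in tA t))).
  by rewrite /ev /= cast_ordKV enum_rankK_in.
have [ev' ev'K] := fin_all_exists evP.
have evK u : ev' (ev u) = u by apply: evinj; rewrite ev'K.
pose iso1 i i' (e : i = i') : Hom (L i) (L i') :=
  match e in _ = l return Hom (L i) (L l) with erefl => idm (L i) end.
have ds' : direct_sum (fun u => L (j (ev u))) X.
  exists (fun u => inj (ev u)), (fun u => prj (ev u)); split=> //.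
    by move=> u u' uu'; apply: pi0; apply: contra uu' => /eqP/evinj ->.
  rewrite -ip; symmetry.
  by apply: (reindex ev); exists ev' => t _; rewrite ?ev'K ?evK.
apply: direct_sum_replace ds' => u; rewrite jev; exact: isomorphic_refl.
Qed.

Lemma gr_classE X i : gr_class L X i 0 = (mult i X)%:Z.
Proof.
rewrite mxE; have dX := decomposition_exists X.
have := xgetPex [ffun=> 0%N] (P := [set c | decomposition L X c]%classic).
move=> /(_ (ex_intro _ _ dX)) /= dc.
by rewrite (decomposition_mult dc).
Qed.

Lemma gr_mxE (T : C -> C) i j : gr_mx L T i j = (mult i (T (L j)))%:Z.
Proof. by rewrite mxE gr_classE. Qed.

Lemma HomL_retract P i (p : Hom P (L i)) :
  p <> 0 -> exists s : Hom (L i) P, p \co s = idm (L i).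
Proof.
move=> p0; have [m [j [inj [prj [pi _ ip]]]]] := decomp P.
have [t pt] : exists t, p \co inj t <> 0.
  apply: contrapT => H; apply: p0; rewrite -[p]compm1 -ip comp_sumr big1 // => t _.
  rewrite compA; suff -> : p \co inj t = 0 by rewrite comp0m.
  by apply: contrapT => pt; apply: H; exists t.
have [q [_ pq]] := simple_iso (simpleL _) (simpleL i) pt.
by exists (inj t \co q); rewrite compA.
Qed.

(** A simple object is a retract of any projective covering it. *)
Lemma projective_L i : projective (L i).
Proof.
move=> X Y p f epip; have [[_ _ enough _] _] := hC.
have [P [q [projP epiq]]] := enough (L i).
have [|s qs] := @HomL_retract P i q.
  move=> q0; apply: (simple_idm (simpleL i)); apply: epiq.
  by rewrite q0 !compm0.
have [g pg] := projP _ _ p (f \co q) epip.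
by exists (g \co s); rewrite compA pg -compA qs compm1.
Qed.

Lemma epi_splits X Y (p : Hom X Y) : epi p -> exists s, p \co s = idm Y.
Proof.
move=> epip; have [m [j [inj [prj [pi _ ip]]]]] := decomp Y.
have /fin_all_exists[g gP] t := projective_L (inj t) epip.
exists (\sum_t (g t \co prj t)); rewrite comp_sumr -ip.
by apply: eq_bigr => t _; rewrite compA gP.
Qed.

(** The simple summands of [X] jointly cover it. *)
Lemma Hom_ext X Y (f g : Hom X Y) :
  (forall i (h : Hom (L i) X), f \co h = g \co h) -> f = g.
Proof.
move=> fg; have [m [j [inj [prj [_ _ ip]]]]] := decomp X.
rewrite -[f]compm1 -[g]compm1 -ip !comp_sumr; apply: eq_bigr => t _.
by rewrite !compA fg.
Qed.

(** Full faithfulness of X |-> (Hom(L_i, X))_i: by Schur's lemma a family of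
    linear maps is automatically natural in L_i. *)
Lemma Hom_of_family X Y (T : forall i, Hom (L i) X -> Hom (L i) Y) :
  (forall i, linear (T i)) ->
  exists e : Hom X Y, forall i (h : Hom (L i) X), e \co h = T i h.
Proof.
move=> linT; have [m [j [inj [prj [_ _ ip]]]]] := decomp X.
pose lT i : {linear Hom (L i) X -> Hom (L i) Y} :=
  HB.pack (T i) (GRing.isLinear.Build _ _ _ _ (T i) (linT i)).
have T0 i : T i 0 = 0 := linear0 (lT i).
have natT i l (h : Hom (L l) X) (g : Hom (L i) (L l)) :
    T i (h \co g) = T l h \co g.
  case: (eqVneq i l) => [eil|il]; last by rewrite (HomL_neq g il) !compm0.
  subst l; have [c ->] := simple_scalar g (simpleL i).
  by rewrite !compZr !compm1; apply: (linearZ_LR (lT i)).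
exists (\sum_t (T _ (inj t) \co prj t)) => i h.
have -> : T i h = \sum_t T i (inj t \co prj t \co h).
  by rewrite -{1}[h]comp1m -ip comp_suml; apply: (linear_sum (lT i)).
by rewrite comp_suml; apply: eq_bigr => t _; rewrite -!compA natT.
Qed.

Lemma kernel_retract X Y (f : Hom X Y) (s : Hom Y X) : f \co s = idm Y ->
  exists K (i : Hom K X) (r : Hom X K),
  [/\ f \co i = 0, r \co i = idm K, r \co s = 0 & i \co r + s \co f = idm X].
Proof.
move=> fs; have [K [i ker]] := kernel_exists f.
have [fi univ] := ker; have moni := kernel_mono ker.
have [|r [ir _]] := univ _ (idm X - s \co f).
  by rewrite compBr compm1 compA fs comp1m subrr.
exists K, i, r; split=> //.
- by apply: moni; rewrite compA ir compBl comp1m -compA fi compm0 subr0 compm1.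
- by apply: moni; rewrite compA ir compBl comp1m -compA fs compm1 subrr compm0.
- by rewrite ir subrK.
Qed.

Lemma mult_split i K X Y (f : Hom X Y) (s : Hom Y X) (u : Hom K X)
    (r : Hom X K) :
  f \co s = idm Y -> f \co u = 0 -> r \co u = idm K -> r \co s = 0 ->
  u \co r + s \co f = idm X -> mult i X = (mult i K + mult i Y)%N.
Proof.
move=> fs fu ru rs sum1.
have ds : direct_sum (fun b : bool => if b then K else Y) X.
  exists (fun b => if b return Hom (if b then K else Y) X then u else s),
    (fun b => if b return Hom X (if b then K else Y) then r else f).
  split=> [[]|[] []|] //.
  by rewrite big_bool.
by rewrite (mult_direct_sum i ds) big_bool.
Qed.

Lemma split_idempotent X (e : Hom X X) : e \co e = e ->
  exists K (i : Hom K X) (r : Hom X K), i \co r = e /\ r \co i = idm K.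
Proof.
move=> ee; have [K [i ker]] := kernel_exists (idm X - e).
have [ei univ] := ker; have moni := kernel_mono ker.
have ei' : e \co i = i by move/eqP: ei; rewrite compBl comp1m subr_eq0 => /eqP.
have [|r [ir _]] := univ _ e; first by rewrite compBl comp1m ee subrr.
by exists K, i, r; split=> //; apply: moni; rewrite compA ir ei' compm1.
Qed.

(** The idempotent projects onto a complement of the image: it is the cokernel
    followed by a section of it. *)
Lemma epi_or_idempotent X Y (f : Hom X Y) :
  epi f \/ exists e : Hom Y Y, [/\ e \co e = e, e <> 0 & e \co f = 0].
Proof.
have [Q [p [pf univ]]] := cokernel_exists f.
have epip : epi p.
  move=> Z g h eqgh; have [|u [_ uniq_u]] := univ _ (h \co p).
    by rewrite -compA pf compm0.
  by rewrite -(uniq_u _ eqgh) (uniq_u h).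
have [p0|p0] := pselect (p = 0).
  left=> Z g h eqgh; apply/eqP; rewrite -subr_eq0; apply/eqP.
  have [|u [<- _]] := univ _ (g - h); first by rewrite compBl eqgh subrr.
  by rewrite p0 compm0.
right; have [s ps] := epi_splits epip; exists (s \co p); split.
- by rewrite compA -(compA s) ps compm1.
- move=> sp; apply: p0; rewrite -[p]comp1m -ps -compA sp; exact: compm0.
- by rewrite -compA pf compm0.
Qed.

Lemma trivial_idempotents_simple X : ~ is_zero X ->
  (forall e : Hom X X, e \co e = e -> e = 0 \/ e = idm X) ->
  exists i, isomorphic X (L i).
Proof.
move=> X0 triv; have [m [j [inj [prj [pi _ ip]]]]] := decomp X.
have [t it] : exists t, inj t \co prj t <> 0.
  apply: contrapT => H; apply: X0; apply/is_zeroP; rewrite -ip big1 // => t _.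
  by apply: contrapT => it; apply: H; exists t.
exists (j t), (prj t), (inj t); split=> //.
have [|//|//] := triv (inj t \co prj t).
by rewrite compA -(compA (inj t)) pi compm1.
Qed.

End Semisimple.

(** * Duality and module categories *)

Section Module.
Variables (k : fieldType) (C : monCat k) (M : modCat C).
Implicit Types (X Y P D : C) (A B N : M).

Local Notation "f \act g" := (actm f g) (at level 38, left associativity).
Local Notation "1_ X" := (idm X) (at level 2, format "1_ X").

Lemma act0 P A B : idm P \act (0 : Hom A B) = 0.
Proof.
have := actm_linearr (-1) (idm P) (0 : Hom A B) 0.
by rewrite scaler0 addr0 scaleN1r addNr.
Qed.

Lemma actD P A B (f g : Hom A B) : 1_P \act (f + g) = 1_P \act f + 1_P \act g.
Proof. by have := actm_linearr 1 (idm P) f g; rewrite !scale1r. Qed.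

Lemma act_sum P A B (I : finType) (f : I -> Hom A B) :
  1_P \act (\sum_t f t) = \sum_t (1_P \act f t).
Proof.
by apply: (big_morph (fun f : Hom A B => 1_P \act f)) => [g h|];
  rewrite ?actD ?act0.
Qed.

Lemma act0l X Y A B (g : Hom A B) : (0 : Hom X Y) \act g = 0.
Proof.
have := actm_linearl (-1) (0 : Hom X Y) 0 g.
by rewrite scaler0 addr0 scaleN1r addNr.
Qed.

Lemma act_suml X Y A B (I : finType) (f : I -> Hom X Y) (g : Hom A B) :
  (\sum_t f t) \act g = \sum_t (f t \act g).
Proof.
apply: (big_morph (fun f : Hom X Y => f \act g)) => [h h'|]; last exact: act0l.
by have := actm_linearl 1 h h' g; rewrite !scale1r.
Qed.

Lemma act_comp P A B B' (g : Hom B B') (f : Hom A B) :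
  1_P \act (g \co f) = (1_P \act g) \co (1_P \act f).
Proof. by rewrite -actm_comp comp1m. Qed.

Lemma actm_split X Y A B (f : Hom X Y) (g : Hom A B) :
  f \act g = (1_Y \act g) \co (f \act 1_A).
Proof. by rewrite -actm_comp comp1m compm1. Qed.

Lemma act_direct_sum P (I : finType) (S : I -> M) A :
  direct_sum S A -> direct_sum (fun t => act P (S t)) (act P A).
Proof.
move=> [inj [prj [pi pi0 ip]]].
exists (fun t => 1_P \act inj t), (fun t => 1_P \act prj t); split.
- by move=> t; rewrite -act_comp pi actm1.
- by move=> t s ts; rewrite -act_comp pi0 // act0.
- by rewrite -actm1 -ip act_sum; apply: eq_bigr => t _; rewrite act_comp.
Qed.

Lemma act_direct_suml (I : finType) (S : I -> C) P A :
  direct_sum S P -> direct_sum (fun t => act (S t) A) (act P A).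
Proof.
move=> [inj [prj [pi pi0 ip]]].
exists (fun t => inj t \act 1_A), (fun t => prj t \act 1_A); split.
- by move=> t; rewrite -actm_comp pi comp1m actm1.
- by move=> t s ts; rewrite -actm_comp pi0 // comp1m act0l.
- rewrite -actm1 -ip act_suml; apply: eq_bigr => t _.
  by rewrite -actm_comp comp1m.
Qed.

Lemma act_zero P A : is_zero A -> is_zero (act P A).
Proof. by move=> /is_zeroP A0; apply/is_zeroP; rewrite -actm1 A0 act0. Qed.

Lemma act_unit_faithful A B (f g : Hom A B) :
  1_(munit C) \act f = 1_(munit C) \act g -> f = g.
Proof.
move=> efg; apply: (iso_epi (act_unit_iso A)).
by rewrite -!act_unit_nat efg.
Qed.

(** Kelly's lemma: the left unit constraint of the action is compatible with
    the associativity constraint. It follows from the pentagon and the triangle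
    after tensoring with the unit object, which is faithful. *)
Lemma act_unit_assoc X N :
  act_unit (act X N) \co act_assoc (munit C) X N = lunit X \act 1_N.
Proof.
apply: act_unit_faithful; set I := munit C.
have isoZ : epi (act_assoc I (tens I X) N \co (assoc I I X \act 1_N)).
  move=> Z g h; rewrite !compA => /iso_epi H; apply: (iso_epi (act_assoc_iso _ _ _)).
  apply: H; exists (assocV I I X \act 1_N).
  by have [VA AV] := assoc_inv I I X; split; rewrite -actm_comp ?VA ?AV comp1m actm1.
apply: isoZ; rewrite act_comp.
rewrite -!(compA (1_I \act act_unit _)) (compA (1_I \act act_assoc I X N)).
rewrite act_pentagon (compA (1_I \act act_unit _)) act_triangle.
rewrite -[1_(act X N)]actm1 -act_assoc_nat.
by rewrite -triangle -(comp1m 1_N) actm_comp !compA !comp1m act_assoc_nat.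
Qed.

Section Adjunction.
Variables (D P : C) (ev : Hom (tens D P) (munit C)) (coev : Hom (munit C) (tens P D)).
Hypothesis zigP :
  runit P \co tensm (idm P) ev \co assoc P D P \co tensm coev (idm P) = lunit P.
Hypothesis zigD :
  lunit D \co tensm ev (idm D) \co assocV D P D \co tensm (idm D) coev = runit D.

(** The endofunctors given by [D] and [P] are adjoint. The counit and the unit
    are [ev] and [coev] conjugated by the associativity and unit constraints;
    after cancelling those constraints by the pentagon, the triangle and Kelly's
    lemma, the two triangle identities are the zigzag identities of the
    duality. *)
Lemma duality_transformations :
  exists (eps : forall N, Hom (act D (act P N)) N)
         (eta : forall N, Hom N (act P (act D N))),
  [/\ forall A B (f : Hom A B), eps B \co (1_D \act (1_P \act f)) = f \co eps A,
      forall A B (f : Hom A B), eta B \co f = (1_P \act (1_D \act f)) \co eta A,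
      forall N, (1_P \act eps N) \co eta (act P N) = 1_(act P N)
    & forall N, eps (act D N) \co (1_D \act eta N) = 1_(act D N)].
Proof.
have [ua uaP] : exists ua : forall X Y N, Hom (act X (act Y N)) (act (tens X Y) N),
    forall X Y N, inverse_pair (act_assoc X Y N) (ua X Y N).
  exists (fun X Y N => sval (cid (act_assoc_iso X Y N))) => X Y N.
  exact: svalP (cid (act_assoc_iso X Y N)).
have [uu uuP] : exists uu : forall N, Hom N (act (munit C) N),
    forall N, inverse_pair (act_unit N) (uu N).
  exists (fun N => sval (cid (act_unit_iso N))) => N.
  exact: svalP (cid (act_unit_iso N)).
pose eps N := act_unit N \co (ev \act 1_N) \co ua D P N.
pose eta N := act_assoc P D N \co (coev \act 1_N) \co uu N.
have uaN X Y A B (f : Hom A B) :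
    ua X Y B \co (1_X \act (1_Y \act f)) = (1_(tens X Y) \act f) \co ua X Y A.
  have [VA _] := uaP X Y B; have [_ AV] := uaP X Y A.
  rewrite -[LHS]compm1 -AV -compA (compA _ _ (ua X Y A)) -act_assoc_nat tensm1.
  by rewrite !compA VA comp1m.
exists eps, eta; split.
- move=> A B f; rewrite /eps -!compA uaN (compA _ _ (ua D P A)) -actm_comp.
  by rewrite comp1m compm1 actm_split !compA act_unit_nat.
- move=> A B f; have uuN : uu B \co f = (1_(munit C) \act f) \co uu A.
    have [Vu _] := uuP B; have [_ uV] := uuP A.
    rewrite -[LHS]compm1 -uV -compA (compA _ _ (uu A)) -act_unit_nat.
    by rewrite !compA Vu comp1m.
  rewrite /eta -!compA uuN (compA _ _ (uu A)) -actm_comp comp1m compm1.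
  by rewrite actm_split !compA -act_assoc_nat tensm1.
- move=> N; apply: (iso_epi (act_unit_iso _)); rewrite comp1m.
  apply: (iso_epi (act_assoc_iso (munit C) P N)).
  rewrite act_unit_assoc -zigP /eta /eps.
  have [Vu _] := uuP (act P N).
  rewrite -!compA (compA (uu _)) Vu comp1m.
  rewrite -[1_(act P N)]actm1 -act_assoc_nat (compA (act_assoc P D _)).
  rewrite -act_pentagon !act_comp.
  have [VA _] := uaP D P N.
  have VA' : (1_P \act ua D P N) \co (1_P \act act_assoc D P N) = 1_(act P (act (tens D P) N)).
    by rewrite -act_comp VA actm1.
  rewrite -!compA (compA (1_P \act ua D P N)) VA' comp1m.
  rewrite (compA (1_P \act (ev \act 1_N))) -act_assoc_nat -!compA.
  rewrite (compA (1_P \act act_unit N)) act_triangle -!actm_comp.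
  by rewrite !comp1m !compA.
- move=> N; have isoU : is_iso (1_D \act act_unit N).
    have [Vu uV] := uuP N; exists (1_D \act uu N).
    by split; rewrite -act_comp ?Vu ?uV actm1.
  apply: (iso_epi isoU); rewrite comp1m.
  apply: (iso_epi (act_assoc_iso D (munit C) N)).
  rewrite act_triangle -zigD /eta /eps.
  have [Vu _] := uuP N.
  rewrite -!compA (compA (1_D \act _) (1_D \act act_unit N)) -act_comp -!compA.
  rewrite Vu compm1 act_comp -compA -act_assoc_nat.
  have pent : (1_D \act act_assoc P D N) \co act_assoc D (tens P D) N =
     act_assoc D P (act D N) \co act_assoc (tens D P) D N \co (assocV D P D \act 1_N).
    rewrite -act_pentagon -!compA -actm_comp.
    by have [_ ->] := assoc_inv D P D; rewrite comp1m actm1 compm1.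
  rewrite (compA (1_D \act act_assoc P D N)) pent.
  have [VA _] := uaP D P (act D N).
  rewrite -!compA (compA (ua D P _)) VA comp1m.
  rewrite -[in ev \act _]actm1 (compA (ev \act _)) -act_assoc_nat -!compA.
  rewrite (compA (act_unit _)) act_unit_assoc -!actm_comp.
  by rewrite !comp1m !compA.
Qed.

End Adjunction.
End Module.

(** * Multiplicities and the action on Grothendieck groups *)

Section Multiplicities.
Variables (k : closedFieldType) (C : monCat k) (M : modCat C).
Implicit Types (X Y P D : C) (A B N : M).

Lemma dual_adjunction D P : left_dual D P ->
  exists (adj : forall A N, Hom A (act P N) -> Hom (act D A) N)
         (adj' : forall A N, Hom (act D A) N -> Hom A (act P N)),
  [/\ forall A N, cancel (@adj A N) (@adj' A N),
      forall A N, cancel (@adj' A N) (@adj A N),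
      forall A B N (f : Hom B (act P N)) (h : Hom A B),
        adj _ _ (f \co h) = adj _ _ f \co actm (idm D) h,
      forall A N N' (f : Hom A (act P N)) (g : Hom N N'),
        adj _ _ (actm (idm P) g \co f) = g \co adj _ _ f
    & forall A N, linear (@adj A N)].
Proof.
move=> [ev [coev [zigP zigD]]].
have [eps [eta [epsN etaN zz1 zz2]]] := duality_transformations M zigP zigD.
exists (fun A N f => eps N \co actm (idm D) f).
exists (fun A N g => actm (idm P) g \co eta A).
split.
- by move=> A N f; rewrite act_comp -compA -etaN compA zz1 comp1m.
- by move=> A N f; rewrite act_comp compA epsN -compA zz2 compm1.
- by move=> A B N f h; rewrite act_comp compA.
- by move=> A N N' f g; rewrite act_comp compA epsN compA.
- by move=> A N c f g; rewrite actm_linearr comp_linearr.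
Qed.

Lemma dim_dual D P A N : left_dual D P ->
  \dim {: Hom A (act P N)} = \dim {: Hom (act D A) N}.
Proof.
move=> /dual_adjunction[adj [adj' [adjK adjK' _ _ linadj]]].
have linadj' : linear (@adj' A N).
  move=> c f g; apply: (can_inj (adjK A N)); rewrite adjK' linadj.
  by rewrite !adjK'.
apply/eqP; rewrite eqn_leq; apply/andP; split.
  exact: linear_inj_dim (linadj A N) (can_inj (adjK A N)).
exact: linear_inj_dim linadj' (can_inj (adjK' A N)).
Qed.

Lemma act_isol X Y A : isomorphic X Y -> isomorphic (act X A) (act Y A).
Proof.
move=> [f [g [gf fg]]]; exists (actm f (idm A)), (actm g (idm A)).
by split; rewrite -actm_comp ?gf ?fg comp1m actm1.
Qed.

Hypothesis hM : finite_semisimple M.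
Variables (n : nat) (L : 'I_n -> M).
Hypothesis hL : irr_reps L.

Lemma mult_act P A i :
  mult L i (act P A) = (\sum_j mult L i (act P (L j)) * mult L j A)%N.
Proof.
apply: (additive_mult hM hL (T := fun A => mult L i (act P A))) => I S X dsX.
exact: mult_direct_sum (act_direct_sum P dsX).
Qed.

(** On classes, the dual object acts by the transposed matrix: this is the
    adjunction, together with dim Hom(X, L) = dim Hom(L, X) for simple L. *)
Lemma mult_dual D P i j : left_dual D P ->
  mult L i (act P (L j)) = mult L j (act D (L i)).
Proof.
by move=> dDP; rewrite /mult (dim_dual _ _ dDP) (mult_to hM hL).
Qed.

Hypothesis hC : finite_semisimple C.
Variables (nC : nat) (LC : 'I_nC -> C).
Hypothesis hLC : irr_reps LC.

Lemma mult_actl P A i :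
  mult L i (act P A) = (\sum_j mult L i (act (LC j) A) * mult LC j P)%N.
Proof.
apply: (additive_mult hC hLC (T := fun P => mult L i (act P A))) => I S X dsX.
exact: mult_direct_sum (act_direct_suml A dsX).
Qed.

(** Both sides count [L l] in the product of [P], [LC i] and [A], bracketed in
    the two possible ways. *)
Lemma mult_act_assoc P A i l :
  (\sum_j mult L l (act P (L j)) * mult L j (act (LC i) A) =
   \sum_j mult L l (act (LC j) A) * mult LC j (tens P (LC i)))%N.
Proof.
rewrite -mult_act -mult_actl; apply: mult_iso.
by apply: isomorphic_sym; exists (act_assoc P (LC i) A); apply: act_assoc_iso.
Qed.

Lemma mult_act_unit A : simple (munit C) ->
  exists i0, forall l, mult L l (act (LC i0) A) = mult L l A.
Proof.
move=> simI; have [_ _ repL] := hLC; have [i0 isoI] := repL _ simI.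
exists i0 => l; apply: mult_iso.
apply: isomorphic_trans (act_isol A (isomorphic_sym isoI)) _.
by exists (act_unit A); apply: act_unit_iso.
Qed.

(** The simple unit is a direct summand of the product of [P] and [D], so [A] is
    a direct summand of [act P (act D A)]. *)
Lemma act_nonzero D P A : fusion C -> left_dual D P -> ~ is_zero P ->
  ~ is_zero A -> ~ is_zero (act D A).
Proof.
move=> [_ _ simI] [ev [coev [zigP zigD]]] P0 A0 DA0.
have coev0 : coev <> 0.
  move=> coev0; apply: P0; apply/is_zeroP; apply: (iso_epi (lunit_iso P)).
  rewrite comp0m comp1m -zigP coev0.
  have -> : tensm (0 : Hom (munit C) (tens P D)) (idm P) = 0.
    have := tensm_linearl (-1) (0 : Hom (munit C) (tens P D)) 0 (idm P).
    by rewrite scaler0 addr0 scaleN1r addNr.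
  by rewrite compm0.
have [r rcoev] : exists r : Hom (tens P D) (munit C), r \co coev = idm (munit C).
  have [m [j dsPD]] := decomp hC hLC (tens P D).
  have [inj [prj [pi pi0 ip]]] := dsPD.
  have [t it] : exists t, prj t \co coev <> 0.
    apply: contrapT => H; apply: coev0; rewrite -[coev]comp1m -ip comp_suml.
    rewrite big1 // => t _; rewrite -compA.
    suff -> : prj t \co coev = 0 by rewrite compm0.
    by apply: contrapT => pt; apply: H; exists t.
  have [q [qp _]] := simple_iso hC simI (simpleL hLC (j t)) it.
  by exists (q \co prj t); rewrite -compA.
have PDA0 : is_zero (act (tens P D) A).
  apply: isomorphic_zero (act_zero P DA0).
  by apply: isomorphic_sym; exists (act_assoc P D A); apply: act_assoc_iso.
apply: A0; have isoA : isomorphic (act (munit C) A) A.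
  by exists (act_unit A); apply: act_unit_iso.
apply: isomorphic_zero isoA _; apply/is_zeroP.
rewrite -actm1 -rcoev -[idm A]comp1m actm_comp.
by rewrite (zero_target (actm coev _) PDA0) compm0.
Qed.

End Multiplicities.

Section Regular.
Variables (k : closedFieldType) (C : monCat k).

Lemma assoc_iso X Y Z : is_iso (@assoc k C X Y Z).
Proof. by exists (assocV X Y Z); apply: assoc_inv. Qed.

(** Makes the results on module categories available for [C] itself. *)
Definition regular : modCat C :=
  ModCat (@tensm1 k C) (@tensm_comp k C) (@tensm_linearl k C)
    (@tensm_linearr k C) assoc_iso (@assoc_nat k C) (@lunit_iso k C)
    (@lunit_nat k C) (@pentagon k C) (@triangle k C).

Hypothesis hC : fusion C.
Variables (n : nat) (L : 'I_n -> C).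
Hypothesis hL : irr_reps L.

Let fsC : finite_semisimple C. Proof. by case: hC. Qed.

(** By adjunction this is the multiplicity of [L j] in the product of the dual of
    [L i] with [L l], which is nonzero. *)
Lemma mult_tens_transitive i l : exists j, (0 < mult L l (tens (L i) (L j)))%N.
Proof.
have [_ /(_ (L i))[[D dDL] _] _] := hC.
have simL := simpleL hL.
have nz : ~ is_zero (tens D (L l)).
  by apply: (@act_nonzero k C regular fsC _ L hL D (L i) (L l)) => //;
    case: (simL i) => //; case: (simL l).
have [j mj] := nonzero_has_simple fsC hL nz; exists j.
by rewrite (@mult_dual k C regular fsC n L hL D (L i) l j dDL).
Qed.

End Regular.

(** * Representations of the fusion quiver *)

Section Representations.
Variables (k : closedFieldType) (C : monCat k) (M : modCat C) (P : C).
Implicit Types (X Y : frep M P).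

Definition rep_hom X Y (fa : Hom (frep_a X) (frep_a Y))
    (fb : Hom (frep_b X) (frep_b Y))
    (h : frep_map Y \co actm (idm P) fa = fb \co frep_map X) :
  Hom (X : Rep M P) (Y : Rep M P) :=
  Subvs (introT (frep_homP (fa, fb)) h).

Lemma rep_homP X Y (f : Hom (X : Rep M P) (Y : Rep M P)) :
  frep_map Y \co actm (idm P) (vsval f).1 = (vsval f).2 \co frep_map X.
Proof. exact/frep_homP/(subvsP f). Qed.

Lemma rep_isoP X Y : isomorphic (X : Rep M P) (Y : Rep M P) <->
  exists fa ga fb gb,
    [/\ @inverse_pair k M (frep_a X) (frep_a Y) fa ga,
        @inverse_pair k M (frep_b X) (frep_b Y) fb gb
      & frep_map Y \co actm (idm P) fa = fb \co frep_map X].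
Proof.
split=> [[f [g [gf fg]]]|[fa [ga [fb [gb [[gfa fga] [gfb fgb] h]]]]]].
  exists (vsval f).1, (vsval g).1, (vsval f).2, (vsval g).2.
  have /(congr1 (@vsval _ _ _)) [gfa gfb] := gf.
  have /(congr1 (@vsval _ _ _)) [fga fgb] := fg.
  by split=> //; apply: rep_homP.
have h' : frep_map X \co actm (idm P) ga = gb \co frep_map Y.
  rewrite -[LHS]comp1m -gfb -compA (compA fb) -h -compA -act_comp fga actm1.
  by rewrite compm1.
exists (rep_hom h), (rep_hom h').
by split; apply: val_inj; rewrite /= ?gfa ?gfb ?fga ?fgb.
Qed.

Definition rep_nonzero X : Prop := ~ (idm (frep_a X) = 0 /\ idm (frep_b X) = 0).

(** Indecomposability, phrased through idempotent endomorphisms; this form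
    transfers along functors without mentioning direct sums. *)
Definition idempotents_trivial X : Prop :=
  rep_nonzero X /\
  forall ea eb, ea \co ea = ea -> eb \co eb = eb ->
    frep_map X \co actm (idm P) ea = eb \co frep_map X ->
    (ea = 0 /\ eb = 0) \/ (ea = idm (frep_a X) /\ eb = idm (frep_b X)).

Lemma rep_is_zeroP X : is_zero (X : Rep M P) <->
  idm (frep_a X) = 0 /\ idm (frep_b X) = 0.
Proof.
split=> [/is_zeroP/(congr1 (@vsval _ _ _))[] //|[a0 b0]].
by apply/is_zeroP; apply: val_inj; rewrite /= a0 b0.
Qed.

Lemma idempotents_trivial_indecomposable X :
  idempotents_trivial X -> indecomposable (X : Rep M P).
Proof.
move=> [X0 triv]; split=> [/rep_is_zeroP//|S [inj [prj [pi pi0 ip]]]].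
pose e := inj true \co prj true.
have ee : e \co e = e by rewrite /e compA -(compA (inj true)) pi compm1.
have [/(congr1 (@vsval _ _ _))/= [ea eb]] := conj ee (rep_homP e).
move=> /(triv _ _ ea eb) [[a0 b0]|[a1 b1]].
  have e0 : e = 0.
    by apply: val_inj => /=; rewrite [LHS]surjective_pairing a0 b0.
  exists true; apply/is_zeroP.
  rewrite -(pi true) -[prj true \co _]compm1 -(pi true) -compA (compA (inj true)).
  by rewrite -/e e0 comp0m compm0.
have e1 : e = idm (X : Rep M P).
  by apply: val_inj => /=; rewrite [LHS]surjective_pairing a1 b1.
exists false; apply/is_zeroP; rewrite -(pi false).
by rewrite -[inj false]comp1m -e1 /e -compA pi0 // !compm0.
Qed.

Hypothesis hM : finite_semisimple M.

(** Idempotent endomorphisms split, since their two components split in the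
    semisimple category [M]. *)
Lemma indecomposable_idempotents_trivial X :
  indecomposable (X : Rep M P) -> idempotents_trivial X.
Proof.
move=> [X0 indX]; split=> [/rep_is_zeroP //|ea eb eaa ebb comm].
pose Ea b := if b then ea else idm (frep_a X) - ea.
pose Eb b := if b then eb else idm (frep_b X) - eb.
have compE (Z : M) (e : Hom Z Z) : e \co e = e ->
    (idm Z - e) \co (idm Z - e) = idm Z - e.
  by move=> ee; rewrite compBl comp1m compBr compm1 ee subrr subr0.
have Eaa b : Ea b \co Ea b = Ea b by case: b => //; apply: compE.
have Ebb b : Eb b \co Eb b = Eb b by case: b => //; apply: compE.
have Ea0 b c : b != c -> Ea b \co Ea c = 0.
  by case: b c => [] [] // _; rewrite /Ea ?compBr ?compBl ?compm1 ?comp1m eaa subrr.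
have Eb0 b c : b != c -> Eb b \co Eb c = 0.
  by case: b c => [] [] // _; rewrite /Eb ?compBr ?compBl ?compm1 ?comp1m ebb subrr.
have actB (f g : Hom (frep_a X) (frep_a X)) :
    actm (idm P) (f - g) = actm (idm P) f - actm (idm P) g.
  have := actm_linearr (-1) (idm P) g f.
  by rewrite !scaleN1r addrC [- _ + _]addrC.
have Ecomm b : frep_map X \co actm (idm P) (Ea b) = Eb b \co frep_map X.
  case: b => //; rewrite /Ea /Eb actB compBr compBl comm actm1.
  by rewrite compm1 comp1m.
have /fin_all_exists[Ka /fin_all_exists[ia /fin_all_exists[ra Pa]]] b :=
  split_idempotent hM (Eaa b).
have /fin_all_exists[Kb /fin_all_exists[ib /fin_all_exists[rb Pb]]] b :=
  split_idempotent hM (Ebb b).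
pose S b : Rep M P := FRep (rb b \co frep_map X \co actm (idm P) (ia b)).
have injP b : frep_map X \co actm (idm P) (ia b) = ib b \co frep_map (S b).
  have [iar rai] := Pa b; have [ibr rbi] := Pb b.
  rewrite /= !compA ibr -Ecomm -compA -act_comp.
  by rewrite -iar -compA rai compm1.
have prjP b : frep_map (S b) \co actm (idm P) (ra b) = rb b \co frep_map X.
  have [iar rai] := Pa b; have [ibr rbi] := Pb b.
  rewrite /= -!compA -act_comp iar Ecomm compA -ibr compA rbi.
  by rewrite comp1m.
have orth (Z : M) (K : bool -> M) (E : bool -> Hom Z Z)
   (i : forall b, Hom (K b) Z) (r : forall b, Hom Z (K b)) :
   (forall b, i b \co r b = E b /\ r b \co i b = idm (K b)) ->
   (forall b c, b != c -> E b \co E c = 0) ->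
   forall b c, b != c -> r b \co i c = 0.
  move=> ir E0 b c bc; have [irb rib] := ir b; have [irc ric] := ir c.
  rewrite -[r b]comp1m -rib -[i c]compm1 -ric -!compA (compA (i c)).
  by rewrite (compA (i b)) irb irc (compA (E b)) E0 // comp0m compm0.
have dsX : direct_sum S (X : Rep M P).
  exists (fun b => @rep_hom (S b) X (ia b) (ib b) (injP b)),
    (fun b => @rep_hom X (S b) (ra b) (rb b) (prjP b)); split.
  - move=> b; have [iar rai] := Pa b; have [ibr rbi] := Pb b.
    by apply: val_inj; rewrite /= rai rbi.
  - move=> b c bc; apply: val_inj => /=.
    by rewrite (orth _ _ _ _ _ Pa Ea0) // (orth _ _ _ _ _ Pb Eb0).
  apply: val_inj; rewrite big_bool /=.
  have [-> _] := Pa true; have [-> _] := Pa false.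
  have [-> _] := Pb true; have [-> _] := Pb false.
  by congr (_, _); rewrite /= addrC subrK.
have [b /rep_is_zeroP /= [Ka0 Kb0]] := indX S dsX.
have Eab : Ea b = 0 by have [<- _] := Pa b; rewrite -[ia b]compm1 Ka0 compm0 comp0m.
have Ebb' : Eb b = 0 by have [<- _] := Pb b; rewrite -[ib b]compm1 Kb0 compm0 comp0m.
move: Eab Ebb'; rewrite /Ea /Eb; case: (b) => [-> ->|]; first by left.
by move=> /eqP + /eqP; rewrite !subr_eq0 => /eqP <- /eqP <-; right.
Qed.

(** Otherwise the projection of the target onto a complement of the image would
    be a nontrivial idempotent. *)
Lemma epi_or_target_only (n : nat) (L : 'I_n -> M) (hL : irr_reps L) X :
  idempotents_trivial X -> epi (frep_map X) \/ is_zero (frep_a X).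
Proof.
move=> [_ triv]; case: (epi_or_idempotent hM hL (frep_map X)); first by left.
move=> [e [ee e0 ef]]; right; apply/is_zeroP.
have [||[_ //]|[-> _] //] := triv 0 e _ ee; first by rewrite comp0m.
by rewrite act0 compm0.
Qed.

Lemma target_only_simple (n : nat) (L : 'I_n -> M) (hL : irr_reps L) X :
  idempotents_trivial X -> is_zero (frep_a X) ->
  exists i, isomorphic (frep_b X) (L i).
Proof.
move=> [X0 triv] a0.
have b0 : ~ is_zero (frep_b X) by move/is_zeroP => b0; apply: X0; split=> //; apply/is_zeroP.
apply: (trivial_idempotents_simple hM hL b0) => e ee.
have [||[_ e0]|[_ e1]] := triv (idm _) e _ ee; [exact: comp1m| |by left|by right].
by rewrite (zero_source (_ \co _) (act_zero P a0)) (zero_source (e \co _) (act_zero P a0)).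
Qed.

Lemma target_only_iso X Y : is_zero (frep_a X) -> is_zero (frep_a Y) ->
  isomorphic (frep_b X) (frep_b Y) -> isomorphic (X : Rep M P) (Y : Rep M P).
Proof.
move=> Xa0 Ya0 [fb [gb inv]]; apply/rep_isoP; exists 0, 0, fb, gb; split=> //.
  by split; rewrite comp0m; [have /is_zeroP := Xa0|have /is_zeroP := Ya0].
by rewrite (zero_source (_ \co _) (act_zero P Xa0)) (zero_source (fb \co _) (act_zero P Xa0)).
Qed.

End Representations.

(** * Reflection functors and the growth of weights *)

Section Reflection.
Variables (k : closedFieldType) (C : monCat k) (M : modCat C).
Hypothesis hM : finite_semisimple M.
Variables (n : nat) (L : 'I_n -> M).
Hypothesis hL : irr_reps L.

(** The reflection functor at the target vertex: the kernel of a surjective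
    structure map P (x) A -> B is turned by adjunction into a structure map
    D (x) K -> A. As everything splits in [M], an endomorphism of the reflected
    representation extends uniquely to the cokernel B; hence triviality of
    idempotents is preserved, and isomorphisms can be pulled back. *)
Lemma reflection D P : left_dual D P ->
  exists refl : frep M P -> frep M D -> Prop,
  [/\ forall X, epi (frep_map X) -> exists Y, refl X Y,
      forall X Y, refl X Y -> idempotents_trivial X -> idempotents_trivial Y,
      forall X1 X2 Y1 Y2, refl X1 Y1 -> refl X2 Y2 ->
        isomorphic (Y1 : Rep M D) Y2 -> isomorphic (X1 : Rep M P) X2
    & forall X Y, refl X Y -> frep_b Y = frep_a X /\
        forall l, mult L l (act P (frep_a X)) =
                  (mult L l (frep_a Y) + mult L l (frep_b X))%N].
Proof.
move=> dDP.
have [adj [adj' [adjK _ nat1 nat2 linadj]]] := dual_adjunction M dDP.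
pose refl (X : frep M P) (Y : frep M D) := exists K (s : Hom (frep_b X) (act P (frep_a X)))
    (i : Hom K (act P (frep_a X))) (r : Hom (act P (frep_a X)) K),
  [/\ frep_map X \co s = idm (frep_b X),
      [/\ frep_map X \co i = 0, r \co i = idm K, r \co s = 0
        & i \co r + s \co frep_map X = idm (act P (frep_a X))]
    & Y = FRep (adj _ _ i)].
exists refl; split.
- move=> X /(epi_splits hM hL)[s fs].
  have [K [i [r sp]]] := kernel_retract hM fs.
  by exists (FRep (adj _ _ i)), K, s, i, r.
- move=> X _ [K [s [i [r [fs [fi ri rs sum1] ->]]]]] [X0 triv].
  split=> /= [[K0 A0]|eK eA eKK eAA].
    apply: X0; split=> //; apply/is_zeroP; move/is_zeroP: A0 => /(act_zero P) PA0.
    by apply/is_zeroP; rewrite -fs (zero_target s PA0) compm0.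
  rewrite -nat1 -nat2 => /(can_inj (adjK _ _)) ieK.
  pose eB := frep_map X \co actm (idm P) eA \co s.
  have eBf : eB \co frep_map X = frep_map X \co actm (idm P) eA.
    have sf : s \co frep_map X = idm _ - i \co r by rewrite -sum1 addrC addKr.
    rewrite /eB -compA sf compBr compm1 -!compA (compA (actm _ _)) -ieK.
    by rewrite !compA fi !comp0m subr0.
  have eBB : eB \co eB = eB.
    rewrite [in X in _ \co X]/eB !compA eBf -(compA (frep_map X)) -act_comp.
    by rewrite eAA.
  have [] := triv _ _ eAA eBB (esym eBf) => -[A_ _]; [left|right]; split=> //.
    by rewrite -[eK]comp1m -ri -compA ieK A_ act0 comp0m compm0.
  by rewrite -[eK]comp1m -ri -compA ieK A_ actm1 comp1m.
- move=> X1 X2 Y1 Y2 [K1 [s1 [i1 [r1 [fs1 [fi1 ri1 rs1 sum1] ->]]]]].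
  move=> [K2 [s2 [i2 [r2 [fs2 [fi2 ri2 rs2 sum2] ->]]]]].
  move=> /rep_isoP /= [fK [gK [fA [gA [invK invA h]]]]].
  have induced (X X' : frep M P) (K K' : M) (i : Hom K (act P (frep_a X))) r s
     (i' : Hom K' (act P (frep_a X'))) (f : Hom K K')
     (g : Hom (frep_a X) (frep_a X')) :
     frep_map X' \co i' = 0 -> i \co r + s \co frep_map X = idm _ ->
     adj _ _ i' \co actm (idm D) f = g \co adj _ _ i ->
     (frep_map X' \co actm (idm P) g \co s) \co frep_map X
        = frep_map X' \co actm (idm P) g.
    move=> fi' sum; rewrite -nat1 -nat2 => /(can_inj (adjK _ _)) com.
    have sf : s \co frep_map X = idm _ - i \co r by rewrite -sum addrC addKr.
    rewrite -compA sf compBr compm1 -!compA (compA (actm _ _)) -com.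
    by rewrite !compA fi' !comp0m subr0.
  have h' : adj _ _ i1 \co actm (idm D) gK = gA \co adj _ _ i2.
    have [gfK fgK] := invK; have [gfA fgA] := invA.
    rewrite -[LHS]comp1m -gfA -compA (compA fA) -h -compA -act_comp fgK actm1.
    by rewrite compm1.
  have F := induced _ _ _ _ _ r1 s1 _ _ _ fi2 sum1 h.
  have G := induced _ _ _ _ _ r2 s2 _ _ _ fi1 sum2 h'.
  have sep (X : frep M P) s Z (u v : Hom (frep_b X) Z) : frep_map X \co s = idm _ ->
      u \co frep_map X = v \co frep_map X -> u = v.
    by move=> fs e; rewrite -[u]compm1 -[v]compm1 -fs !compA e.
  have [gfA fgA] := invA.
  apply/rep_isoP; exists fA, gA, (frep_map X2 \co actm (idm P) fA \co s1),
    (frep_map X1 \co actm (idm P) gA \co s2); split=> //.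
  split.
    apply: (sep _ _ _ _ _ fs1); rewrite -compA F compA G -compA -act_comp gfA.
    by rewrite actm1 compm1 comp1m.
  apply: (sep _ _ _ _ _ fs2); rewrite -compA G compA F -compA -act_comp fgA.
  by rewrite actm1 compm1 comp1m.
- move=> X _ [K [s [i [r [fs [fi ri rs sum1] ->]]]]]; split=> // l.
  exact: mult_split sum1.
Qed.

End Reflection.

Section Weights.
Variables (R : realType) (k : closedFieldType) (C : monCat k) (M : modCat C).
Hypothesis hC : fusion C.
Hypothesis hM : finite_semisimple M.
Variables (n : nat) (L : 'I_n -> M).
Hypothesis hL : irr_reps L.
Variable lam : R.
Implicit Types (v va vb : 'I_n -> R) (P D : C) (A B : M).

Definition weight v A : R := \sum_l v l * (mult L l A)%:R.

Lemma weight_ge0 v A : (forall l, 0 <= v l) -> 0 <= weight v A.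
Proof. by move=> v0; apply: sumr_ge0 => l _; rewrite mulr_ge0 ?v0. Qed.

Lemma weight_le0_zero v A : (forall l, 0 < v l) -> weight v A <= 0 -> is_zero A.
Proof.
move=> v0 w0; apply: (mult0_zero hM hL) => l.
have v0' l' : 0 <= v l' := ltW (v0 l').
have : weight v A = 0 by apply/eqP; rewrite eq_le w0 weight_ge0.
move/eqP; rewrite psumr_eq0 => [/allP/(_ l)|l' _]; last by rewrite mulr_ge0.
by rewrite mem_index_enum mulf_eq0 gt_eqF // pnatr_eq0 => /(_ isT)/eqP.
Qed.

Lemma weight_zero v A : is_zero A -> weight v A = 0.
Proof.
by move=> A0; rewrite /weight big1 // => l _; rewrite (is_zero_mult _ _ A0) mulr0.
Qed.

Lemma weight_iso v A B : isomorphic A B -> weight v A = weight v B.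
Proof. by move=> AB; apply: eq_bigr => l _; rewrite (mult_iso _ _ AB). Qed.

Lemma weight_L v i : weight v (L i) = v i.
Proof.
rewrite /weight (bigD1 i) //= (mult_L hM hL) eqxx mulr1 big1 ?addr0 // => l li.
by rewrite (mult_L hM hL) (negPf li) mulr0.
Qed.

(** The pair ([va], [vb]) is an eigenvector of the adjacency matrix of the
    unfolded quiver of [P]. The two vectors are kept apart so that they can be
    exchanged by reflections and restricted to a connected component. *)
Definition bip_eigen P va vb : Prop :=
  (forall j, \sum_i vb i * (mult L i (act P (L j)))%:R = lam * va j) /\
  (forall i, \sum_j (mult L i (act P (L j)))%:R * va j = lam * vb i).

Lemma bip_eigen_dual D P va vb :
  left_dual D P -> bip_eigen P va vb <-> bip_eigen D vb va.
Proof.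
move=> dDP; have N i j := mult_dual hM hL i j dDP.
split=> -[Ea Eb]; split=> i.
- by rewrite -[RHS]Eb; apply: eq_bigr => j _; rewrite -N mulrC.
- by rewrite -[RHS]Ea; apply: eq_bigr => j _; rewrite -N mulrC.
- by rewrite -[RHS]Eb; apply: eq_bigr => j _; rewrite N mulrC.
- by rewrite -[RHS]Ea; apply: eq_bigr => j _; rewrite N mulrC.
Qed.

Lemma weight_act P va vb A :
  bip_eigen P va vb -> weight vb (act P A) = lam * weight va A.
Proof.
move=> [Ea _]; rewrite /weight mulr_sumr.
under eq_bigr do rewrite (mult_act hM hL) natr_sum mulr_sumr.
rewrite exchange_big; apply: eq_bigr => j _.
rewrite mulrA -Ea mulr_suml; apply: eq_bigr => i _.
by rewrite natrM mulrA.
Qed.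

(** If [x] and [y] are the weights of a representation at the source and at the
    target, then lam x - y and [x] are those of its reflection. For positive
    weights, an indecomposable with nonpositive source weight is simple and
    supported at the target. *)
Fixpoint dies (r : nat) (x y : R) : Prop :=
  x <= 0 \/ if r is r'.+1 then dies r' (lam * x - y) x else False.

Lemma weight_reflect P va vb A B K :
  bip_eigen P va vb ->
  (forall l, mult L l (act P A) = (mult L l K + mult L l B)%N) ->
  weight vb K = lam * weight va A - weight vb B.
Proof.
move=> Ev mE; apply/eqP; rewrite -(weight_act _ Ev) eq_sym subr_eq; apply/eqP.
rewrite /weight -big_split; apply: eq_bigr => l _ /=.
by rewrite mE natrD mulrDr.
Qed.

Definition target_only (Z : M) P (B : M) : frep M P := @FRep _ _ _ P Z B 0.

(** Induction on the number of reflections that an indecomposable survives: the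
    reflected representation determines it up to isomorphism, and those that do
    not survive the next reflection are the simple ones at the target. *)
Lemma finitely_many_dying r P va vb :
  (forall l, 0 < va l) -> (forall l, 0 < vb l) -> bip_eigen P va vb ->
  exists m (F : 'I_m -> frep M P), forall X, idempotents_trivial X ->
    dies r (weight va (frep_a X)) (weight vb (frep_b X)) ->
    exists i, isomorphic (X : Rep M P) (F i).
Proof.
have [Z Z0] := zero_object hM.
have base P' va' (X : frep M P') : (forall l, 0 < va' l) ->
    idempotents_trivial X -> weight va' (frep_a X) <= 0 ->
    exists i, isomorphic (X : Rep M P') (target_only Z P' (L i)).
  move=> va0 itX /(weight_le0_zero va0) a0.
  have [i isoi] := target_only_simple hM hL itX a0.
  by exists i; apply: target_only_iso.
elim: r P va vb => [|r IH] P va vb va0 vb0 Ev.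
  exists n, (fun i => target_only Z P (L i)) => X itX [le0|//].
  exact: (base _ va).
have [_ /(_ P)[[D dDP] _] _] := hC.
have [refl [reflE reflI reflIso reflM]] := reflection hM hL dDP.
have [m [F FP]] := IH D vb va vb0 va0 (proj1 (bip_eigen_dual _ _ dDP) Ev).
have /fin_all_exists[G GP] (i : 'I_m) : exists G : frep M P,
    (exists X Y, refl X Y /\ isomorphic (Y : Rep M D) (F i)) ->
    exists Y, refl G Y /\ isomorphic (Y : Rep M D) (F i).
  have [[X [Y H]]|H] := pselect (exists X Y, refl X Y /\ isomorphic (Y : Rep M D) (F i)).
    by exists X => _; exists Y.
  by exists (target_only Z P Z).
exists (n + m)%N, (fun i => match split i with inl j => target_only Z P (L j) | inr j => G j end).
move=> X itX dX; have [a0|a0] := leP (weight va (frep_a X)) 0.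
  have [i iso_i] := base _ va X va0 itX a0.
  exists (unsplit (inl i)); by rewrite unsplitK.
case: dX => [|dX]; first by rewrite leNgt a0.
have [epiX|Xa0] := epi_or_target_only hM hL itX; last first.
  by rewrite weight_zero // ltxx in a0.
have [Y XY] := reflE _ epiX; have [Yb Ya] := reflM _ _ XY.
have [|i Yi] := FP Y (reflI _ _ XY itX).
  by rewrite Yb (weight_reflect Ev Ya).
have [Y' [GY' Y'i]] : exists Y', refl (G i) Y' /\ isomorphic (Y' : Rep M D) (F i).
  by apply: GP; exists X, Y.
exists (unsplit (inr i)); rewrite unsplitK; apply: reflIso XY GY' _.
exact: isomorphic_trans Yi (isomorphic_sym Y'i).
Qed.

Lemma dies_mono r r' x y : (r <= r')%N -> dies r x y -> dies r' x y.
Proof.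
elim: r r' x y => [|r IH] r' x y rr' /=.
  by case=> // x0; case: r' rr' => *; left.
case: r' rr' => [//|r'] rr' [x0|H]; first by left.
by right; apply: IH H.
Qed.

Lemma dies_decreasing r x y e :
  lam < 2 -> 0 < e -> x - y <= - e -> x <= r%:R * e -> dies r x y.
Proof.
move=> lam2 e0; elim: r x y => [|r IH] x y xy xr /=.
  by left; rewrite mul0r in xr.
have [x0|x0] := leP x 0; [by left|right].
have lx : 0 < (2 - lam) * x by rewrite mulr_gt0 // subr_gt0.
apply: IH; first by lra.
by rewrite -natr1 mulrDl mul1r in xr; lra.
Qed.

(** The increments x - y of the recurrence decrease by (2 - lam) x at each step.
    So they become negative after about 1 / (2 - lam) steps, and from then on
    they stay away from zero. *)
Lemma dies_lt2 : lam < 2 -> exists r, forall x y, 0 <= y -> dies r x y.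
Proof.
move=> lam2; pose d := 2 - lam; have d0 : 0 < d by rewrite subr_gt0.
have [K Kd] : exists K : nat, 1 < K%:R * d.
  exists (Num.bound (d^-1)); rewrite -ltr_pdivrMr // mul1r.
  by apply: archi_boundP; rewrite ?invr_ge0 ?ltW.
have turn x y : x - y <= 0 -> dies K.+1 x y.
  move=> xy /=; have [x0|x0] := leP x 0; [by left|right].
  (* the increment drops below - d x, and K steps of that size exceed x *)
  apply: (@dies_decreasing _ _ _ (d * x)) => //; first by rewrite mulr_gt0.
    by rewrite /d; lra.
  have : x < K%:R * (d * x) by rewrite mulrA -[ltLHS]mul1r ltr_pM2r.
  have : 0 < d * x by rewrite mulr_gt0.
  by rewrite {1}/d; lra.
have rise j x y c : 0 < c -> c <= x -> x - y <= j%:R * (d * c) ->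
    dies (j + K.+1) x y.
  elim: j x y => [|j IH] x y c0 cx xy.
    by apply: turn; rewrite mul0r in xy.
  rewrite addSn /=; right.
  have dcx : d * c <= d * x by rewrite ler_pM2l.
  have xy' : lam * x - y - x <= j%:R * (d * c).
    rewrite -natr1 mulrDl mul1r in xy.
    have : d * x = 2 * x - lam * x by rewrite /d mulrBl.
    by lra.
  have [neg|pos] := leP (lam * x - y - x) 0.
    by apply: dies_mono (turn _ _ neg); rewrite leq_addl.
  by apply: IH => //; lra.
exists (K + K.+1)%N => x y y0; have [x0|x0] := leP x 0.
  by apply: (@dies_mono 0) => //; left.
apply: (rise K x y x) => //; have : x < K%:R * (d * x).
  by rewrite mulrA -[ltLHS]mul1r ltr_pM2r.
by lra.
Qed.

(** For [lam >= 2] the increments of the recurrence never decrease, so that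
    reflections of a simple object at the source keep growing and are never
    supported at the target only. The induction climbs the sequence of iterated
    right duals, since a reflection ends over the left dual; the parity of [r]
    tells at which vertex of the quiver the simple object has to start. *)
Lemma indecomposable_large r P va vb l (c : R) :
  2 <= lam -> (forall l, 0 <= va l) -> (forall l, 0 <= vb l) ->
  bip_eigen P va vb -> 0 < c -> c = (if odd r then vb l else va l) ->
  exists X : frep M P, [/\ idempotents_trivial X,
    weight vb (frep_b X) + c <= weight va (frep_a X)
    & r.+1%:R * c <= weight va (frep_a X)].
Proof.
move=> lam2; elim: r P va vb => [|r IH] P va vb va0 vb0 Ev c0 cE.
  have [Z Z0] := zero_object hM.
  exists (@FRep _ _ _ P (L l) Z 0); split=> /=.
  - split=> /= [[l0 _]|ea eb eaa ebb _].
      by case: (simpleL hL l) => nz _; apply: nz; apply/is_zeroP.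
    rewrite (zero_source eb Z0) (zero_source (idm Z) Z0).
    have [a ea_a] := simple_scalar hM ea (simpleL hL l); move: eaa.
    rewrite ea_a compZl compZr comp1m scalerA => /eqP.
    rewrite -subr_eq0 -scalerBl scaler_eq0 => /orP[|/eqP id0]; last first.
      by left; rewrite id0 scaler0.
    rewrite -{3}[a]mulr1 -mulrBr mulf_eq0 subr_eq0 => /orP[]/eqP ->.
      by left; rewrite scale0r.
    by right; rewrite scale1r.
  - by rewrite weight_zero // add0r weight_L cE.
  - by rewrite mul1r weight_L cE.
have [_ /(_ P)[_ [Q dPQ]] _] := hC.
have EvQ : bip_eigen Q vb va by apply/(bip_eigen_dual _ _ dPQ).
have [|X [itX gap big]] := IH Q vb va vb0 va0 EvQ c0.
  by rewrite cE /=; case: odd.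
have a0 : 0 < weight vb (frep_a X).
  by apply: lt_le_trans big; rewrite mulr_gt0.
have [epiX|Xa0] := epi_or_target_only hM hL itX; last first.
  by rewrite weight_zero // ltxx in a0.
have [refl [reflE reflI _ reflM]] := reflection hM hL dPQ.
have [Y XY] := reflE _ epiX; have [Yb Ya] := reflM _ _ XY.
have lx : 0 <= (lam - 2) * weight vb (frep_a X) by rewrite mulr_ge0 ?subr_ge0 // ltW.
exists Y; split; first exact: reflI XY itX.
  by rewrite Yb (weight_reflect EvQ Ya); lra.
rewrite (weight_reflect EvQ Ya) -natr1 mulrDl mul1r.
by lra.
Qed.

End Weights.

(** * Representations of the unfolded quiver *)

Lemma one_mx_eq0 (k : fieldType) m : (1%:M : 'M[k]_m) = 0 -> m = 0%N.
Proof. by move/(congr1 mxrank); rewrite mxrank1 mxrank0. Qed.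

Lemma qrep_iso_dim (k : fieldType) (Q : quiver) (V W : qrep k Q) :
  qrep_iso V W -> forall x, qdim V x = qdim W x.
Proof.
move=> [f [g [gf fg _]]] x; apply/eqP; rewrite eqn_leq.
by rewrite (mulmx1_min (gf x)) (mulmx1_min (fg x)).
Qed.

Section UnfoldedRep.
Variables (k : closedFieldType) (C : monCat k) (M : modCat C) (P : C).
Hypothesis hM : finite_semisimple M.
Variables (n : nat) (L : 'I_n -> M).
Hypothesis hL : irr_reps L.
Local Notation Q := (unfolded P L).
Variable v : Q.
Implicit Types (X : frep M P).

Definition rep_space X (x : Q) : vectType k :=
  Hom (L x.2) (if x.1 then frep_b X else frep_a X).

Definition arrow_map X (x y : Q) (e : nat) : rep_space X x -> rep_space X y :=
  match x, y return rep_space X x -> rep_space X y with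
  | (false, l), (true, l') => fun h : Hom (L l) (frep_a X) =>
      frep_map X \co actm (idm P) h \co (vbasis {:Hom (L l') (act P (L l))})`_e
  | _, _ => fun=> 0
  end.

Lemma arrow_map_linear X (x y : Q) e : linear (@arrow_map X x y e).
Proof.
case: x y => [[] l] [[] l'] c h h' /=; rewrite ?scaler0 ?addr0 //.
by rewrite actm_linearr comp_linearr comp_linearl.
Qed.

(** The arrow labelled [e] acts through the [e]-th vector of a basis of
    Hom(L', P (x) L). *)
Definition unfolded_rep X : qrep k (component v) :=
  @QRep k (component v) (fun x => \dim {:rep_space X (val x)})
    (fun x y e => lin_col_mx (@arrow_map X (val x) (val y) e)).

Local Notation conn := (connect (fun x y : Q => (0 < nedge x y)%N) v).

Lemma conn_arrow (x y : Q) : (0 < narr x y)%N -> conn x = conn y.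
Proof.
move=> xy; have sym : connect_sym (fun x y : Q => (0 < nedge x y)%N).
  by apply: sym_connect_sym => a b; rewrite /nedge addnC.
by apply: same_connect_r sym _ _ _ _; apply: connect1; rewrite addn_gt0 xy.
Qed.

Section Extension.
Variables (X : frep M P).
Variable E : forall x : component v, 'M[k]_(qdim (unfolded_rep X) x).
Hypothesis EE : forall x, E x *m E x = E x.
Hypothesis Ecomm : forall (x y : component v) (e : 'I_(narr x y)),
  E y *m qmap (unfolded_rep X) e = qmap (unfolded_rep X) e *m E x.

(* No arrow leaves a component, so extending by zero outside of it preserves the
   compatibility with the arrows. *)
Definition extend (y : Q) (h : rep_space X y) : rep_space X y :=
  match pselect (conn y) with
  | left p => colv (E (exist _ y p) *m vcol h)
  | right _ => 0
  end.

Lemma extend_linear (y : Q) : linear (@extend y).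
Proof.
move=> c h h'; rewrite /extend; case: pselect => [p|_]; last by rewrite scaler0 addr0.
by rewrite vcol_is_linear linearP colv_is_linear.
Qed.

Lemma extend_idem (y : Q) (h : rep_space X y) : extend (extend h) = extend h.
Proof.
rewrite /extend; case: pselect => [p|//].
by rewrite colvK mulmxA EE.
Qed.

Lemma extendE (x : component v) (h : rep_space X (val x)) :
  vcol (extend h) = E x *m vcol h.
Proof.
case: x h => y p h /=; rewrite /extend; case: pselect => [q|//].
by rewrite colvK (bool_irrelevance q p).
Qed.

Lemma extend_arrow (x y : Q) e (h : rep_space X x) : (e < narr x y)%N ->
  arrow_map y e (extend h) = extend (arrow_map y e h).
Proof.
move=> exy; have cxy : conn x = conn y by apply: conn_arrow; case: narr exy.
have a0 : arrow_map y e (0 : rep_space X x) = 0.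
  have := @arrow_map_linear X x y e (-1) 0 0.
  by rewrite scaler0 addr0 scaleN1r addNr.
rewrite [in LHS]/extend [in RHS]/extend; case: pselect => [p|np]; case: pselect => [q|nq].
- apply: vcol_inj; rewrite colvK.
  have := Ecomm (x := exist _ x p) (y := exist _ y q) (Ordinal exy).
  pose A : {linear rep_space X x -> rep_space X y} :=
    HB.pack (@arrow_map X x y e)
      (GRing.isLinear.Build _ _ _ _ (@arrow_map X x y e) (@arrow_map_linear X x y e)).
  move=> /(congr1 (fun B : 'M[k]_(\dim {:rep_space X y}, \dim {:rep_space X x}) =>
    B *m vcol h)); rewrite -!mulmxA /=.
  rewrite (mul_lin_col_mx A) => ->.
  by rewrite -(mul_lin_col_mx A); congr (_ *m _); apply: colvK.
- by case: nq; rewrite -cxy.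
- by case: np; rewrite cxy.
- exact: a0.
Qed.

(** The extension of [E] comes from an endomorphism of [X], because
    X |-> (Hom(L_i, X))_i is fully faithful. *)
Lemma extend_trivial : idempotents_trivial X ->
  (forall x, E x = 0) \/ (forall x, E x = 1%:M).
Proof.
move=> [_ triv].
have [ea eaP] := Hom_of_family hM hL (T := fun l => @extend (false, l))
                   (fun l => @extend_linear (false, l)).
have [eb ebP] := Hom_of_family hM hL (T := fun l => @extend (true, l))
                   (fun l => @extend_linear (true, l)).
have eaa : ea \co ea = ea.
  by apply: (Hom_ext hM hL) => l h; rewrite -compA !eaP extend_idem.
have ebb : eb \co eb = eb.
  by apply: (Hom_ext hM hL) => l h; rewrite -compA !ebP extend_idem.
have comm : frep_map X \co actm (idm P) ea = eb \co frep_map X.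
  apply: (Hom_ext hM hL) => l' g.
  have [m [j [inj [prj [_ _ ip]]]]] := decomp hM hL (frep_a X).
  have -> : g = \sum_t (actm (idm P) (inj t) \co (actm (idm P) (prj t) \co g)).
    under eq_bigr do rewrite compA -act_comp.
    by rewrite -comp_suml -act_sum ip actm1 comp1m.
  rewrite !comp_sumr; apply: eq_bigr => t _.
  rewrite [_ \co g](coord_vbasis (memvf _)) !comp_sumr; apply: eq_bigr => e _.
  rewrite !compZr; congr (_ *: _).
  have exy : (e < @narr Q (false, j t) (true, l'))%N by [].
  have := extend_arrow (x := (false, j t)) (inj t) exy; rewrite /= -eaP -ebP.
  by rewrite act_comp !compA => ->.
case: (triv _ _ eaa ebb comm) => -[Ea Eb]; [left|right] => x;
  apply: mx_ext_vcol => h; rewrite -extendE; case: x h => -[b l] p /= h.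
- suff -> : extend h = 0 by rewrite mul0mx; apply/colP => i; rewrite !mxE linear0.
  by case: b p h => p h; rewrite -?eaP -?ebP ?Ea ?Eb comp0m.
- by rewrite mul1mx; case: b p h => p h; rewrite -?eaP -?ebP ?Ea ?Eb comp1m.
Qed.

End Extension.

Lemma unfolded_rep_indecomposable X (x0 : component v) :
  idempotents_trivial X -> (0 < qdim (unfolded_rep X) x0)%N ->
  qrep_indecomposable (unfolded_rep X).
Proof.
move=> itX dx0; split=> [/(_ x0) d0|W W' [f [g [gf fg fcomm]]]].
  by rewrite d0 in dx0.
pose p x : 'M[k]_(qdim W x + qdim W' x) := block_mx 1%:M 0 0 0.
pose E x : 'M[k]_(qdim (unfolded_rep X) x) := g x *m p x *m f x.
have pp x : p x *m p x = p x.
  by rewrite /p mulmx_block !mulmx0 !mul0mx !addr0 mulmx1.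
have EE x : E x *m E x = E x.
  by rewrite /E -!mulmxA (mulmxA (f x)) fg mul1mx (mulmxA (p x)) pp.
have gcomm x y (e : 'I_(narr x y)) :
    g y *m qmap (qrep_sum W W') e = qmap (unfolded_rep X) e *m g x.
  by rewrite -[LHS]mulmx1 -(fg x) !mulmxA -(mulmxA (g y)) -fcomm !mulmxA gf mul1mx.
have Ecomm (x y : component v) (e : 'I_(narr x y)) :
    E y *m qmap (unfolded_rep X) e = qmap (unfolded_rep X) e *m E x.
  rewrite /E -!mulmxA fcomm (mulmxA (qmap _ e)) -gcomm -mulmxA.
  rewrite (mulmxA (p y)) (mulmxA (qmap _ e)); congr (_ *m (_ *m _)).
  have blk m m' q q' (A : 'M[k]_(m, q)) (B : 'M[k]_(m', q')) :
      block_mx 1%:M 0 0 0 *m block_mx A 0 0 B = block_mx A 0 0 B *m block_mx 1%:M 0 0 0.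
    by rewrite !mulmx_block !mulmx0 !mul0mx !addr0 mulmx1 mul1mx.
  exact: blk.
have pE x : p x = f x *m E x *m g x.
  by rewrite /E !mulmxA fg mul1mx -mulmxA fg mulmx1.
have [E0|E1] := extend_trivial EE Ecomm itX; [left|right] => x.
  have := pE x; rewrite E0 mulmx0 mul0mx => /(congr1 ulsubmx).
  rewrite block_mxKul => eq1; apply: (@one_mx_eq0 k); rewrite eq1.
  by apply/matrixP => i j; rewrite !mxE.
have := pE x; rewrite E1 mulmx1 fg => /(congr1 drsubmx).
by rewrite block_mxKdr (@scalar_mx_block _ (qdim W x) (qdim W' x) 1) block_mxKdr
  => /esym/one_mx_eq0.
Qed.

End UnfoldedRep.

(** * Finite and infinite representation type *)

Section FiniteInfinite.
Variables (R : realType) (k : closedFieldType) (C : monCat k) (M : modCat C).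
Hypothesis hC : fusion C.
Hypothesis hM : finite_semisimple M.
Variables (n : nat) (L : 'I_n -> M).
Hypothesis hL : irr_reps L.
Variables (lam : R) (P : C) (w : 'I_n -> R).
Hypothesis w0 : forall l, 0 < w l.
Hypothesis Ew : bip_eigen L lam P w w.

Lemma Rep_finite : lam < 2 -> finitely_many_indecomposables (Rep M P).
Proof.
move=> lam2; have [r rP] := dies_lt2 lam2.
have [m [F FP]] := finitely_many_dying hC hM hL r w0 w0 Ew.
exists m, F => X indX; apply: FP.
  exact: indecomposable_idempotents_trivial indX.
by apply: rP; apply: weight_ge0 => l; apply: ltW.
Qed.

Lemma large_index (b : bool) (c B : R) : 0 < c ->
  exists r : nat, odd r = b /\ B < r.+1%:R * c.
Proof.
move=> c0; have [N NB] : exists N : nat, B < N%:R * c.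
  exists (Num.bound (`|B| / c)); rewrite -ltr_pdivrMr //.
  apply: le_lt_trans (archi_boundP _); last by rewrite divr_ge0 ?normr_ge0 ?ltW.
  by rewrite ler_pM2r ?invr_gt0 // ler_norm.
exists (N.*2 + b)%N; rewrite oddD odd_double oddb; split=> //.
apply: lt_le_trans NB _; rewrite ler_pM2r // ler_nat.
by rewrite -addnn -addnS -addnA leq_addr.
Qed.

Lemma Rep_infinite : 2 <= lam -> (0 < n)%N ->
  ~ finitely_many_indecomposables (Rep M P).
Proof.
move=> lam2 n0 [m [F FP]]; have l0 := Ordinal n0.
have w0' l : 0 <= w l := ltW (w0 l).
have [r [oddr big]] := large_index false
  (\sum_i weight L w (frep_a (F i : frep M P))) (w0 l0).
have [|X [itX _ wX]] := indecomposable_large hC hM hL (r := r) (l := l0)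
  lam2 w0' w0' Ew (w0 l0); first by rewrite oddr.
have [i /rep_isoP [fa [ga [_ [_ [inv _ _]]]]]] :=
  FP _ (idempotents_trivial_indecomposable itX).
have := lt_le_trans big wX.
rewrite (weight_iso _ _ (ex_intro _ fa (ex_intro _ ga inv))).
rewrite (bigD1 i) //= ltNge => /negP[].
by rewrite lerDl sumr_ge0 // => j _; apply: weight_ge0.
Qed.

(** The eigenvector cut off outside of the component is still an eigenvector, as
    no arrow leaves the component. Measured with it, the indecomposables grown
    from a simple object at the vertex [v] have unbounded dimension vectors. *)
Lemma component_infinite_type (v : unfolded P L) :
  2 <= lam -> infinite_type k (component v).
Proof.
move=> lam2 [m [F FP]].
pose conn := connect (fun x y : unfolded P L => (0 < nedge x y)%N) v.
pose wc b l := if conn (b, l) then w l else 0.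
have wc0 b l : 0 <= wc b l by rewrite /wc; case: ifP => // _; apply: ltW.
have connE i j : (0 < mult L i (act P (L j)))%N -> conn (false, j) = conn (true, i).
  by move=> mij; apply: conn_arrow.
have Ewc : bip_eigen L lam P (wc false) (wc true).
  have [Ea Eb] := Ew; split=> [j|i].
    rewrite /wc; case: ifP => cj.
      rewrite -Ea; apply: eq_bigr => i _.
      have [->|] := posnP (mult L i (act P (L j))); first by rewrite !mulr0.
      by move/connE; rewrite cj => <-.
    rewrite mulr0 big1 // => i _.
    have [->|] := posnP (mult L i (act P (L j))); first by rewrite mulr0.
    by move/connE; rewrite cj => <-; rewrite mul0r.
  rewrite /wc; case: ifP => ci.
    rewrite -Eb; apply: eq_bigr => j _.
    have [->|] := posnP (mult L i (act P (L j))); first by rewrite !mul0r.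
    by move/connE; rewrite ci => ->.
  rewrite mulr0 big1 // => j _.
  have [->|] := posnP (mult L i (act P (L j))); first by rewrite mul0r.
  by move/connE; rewrite ci => ->; rewrite mulr0.
pose size (V : qrep k (component v)) : R :=
  \sum_l if pselect (conn (false, l)) is left p
         then w l * (qdim V (exist _ (false, l) p))%:R else 0.
have size0 V : 0 <= size V.
  by apply: sumr_ge0 => l _; case: pselect => // p; rewrite mulr_ge0 // ltW.
have sizeE X : size (unfolded_rep v X) = weight L (wc false) (frep_a X).
  apply: eq_bigr => l _; rewrite /wc; case: pselect => [p|np].
    by rewrite ifT.
  by rewrite ifF ?mul0r //; apply/negP.
have cv : wc v.1 v.2 = w v.2.
  by rewrite /wc -surjective_pairing /conn connect0.
have [r [oddr big]] := large_index v.1 (\sum_i size (F i)) (w0 v.2).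
have [|X [itX _ wX]] := indecomposable_large hC hM hL (r := r) (l := v.2)
  lam2 (wc0 false) (wc0 true) Ewc (w0 v.2).
  by rewrite -cv oddr; case: v.1.
rewrite -sizeE in wX.
have [x0 dx0] : exists x0, (0 < qdim (unfolded_rep v X) x0)%N.
  apply: contrapT => H; have := lt_le_trans big wX; rewrite ltNge => /negP[].
  have -> : size (unfolded_rep v X) = 0; last by rewrite sumr_ge0.
  apply: big1 => l _; case: pselect => // p.
  set d := qdim _ _; have [->|d0] := posnP d; first by rewrite mulr0.
  by case: H; eexists; apply: d0.
have [i isoi] := FP _ (unfolded_rep_indecomposable hM hL itX dx0).
have := lt_le_trans big wX; rewrite (_ : size _ = size (F i)).
  by rewrite (bigD1 i) //= ltNge lerDl sumr_ge0.
apply: eq_bigr => l _; case: pselect => // p.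
by rewrite (qrep_iso_dim isoi).
Qed.

End FiniteInfinite.

(** * The order of the Coxeter transformation *)

Section BoundedPowers.

(** Two of the powers agree, by the pigeonhole principle. *)
Lemma bounded_powers_finite_order n (c c' : 'M[int]_n) (b : nat) :
  c' *m c = 1%:M -> (forall r i j, (absz ((c ^+ r) i j) <= b)%N) -> finite_order c.
Proof.
move=> c'c bound.
pose T := {ffun 'I_n * 'I_n -> 'I_(b + b).+1}.
pose f (r : 'I_#|T|.+1) : T := [ffun ij => inord (absz ((c ^+ r) ij.1 ij.2 + b%:Z))].
have /injectivePn[r [s rs fE]] : ~~ injectiveb f.
  by apply/injectiveP => /leq_card; rewrite card_ord ltnn.
have eq_pow : c ^+ r = c ^+ s.
  apply/matrixP => i j; have := congr1 (fun g : T => val (g (i, j))) fE.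
  have := bound r i j; have := bound s i j; rewrite /= !ffunE /=.
  move: ((c ^+ s) i j) ((c ^+ r) i j) => x y bx bY.
  rewrite !inordK; lia.
have lregc r' : injective (fun x : 'M[int]_n => c ^+ r' * x).
  elim: r' => [|r' IH] x y; first by rewrite !expr0 !mul1r.
  rewrite /= !exprSr -!mulrA => /IH; rewrite -![_ * _]/(_ *m _).
  by move/(congr1 (mulmx c')); rewrite !mulmxA c'c !mul1mx.
have [m m0 cm] : exists2 m, (0 < m)%N & c ^+ m = 1.
  wlog lt_rs : r s rs fE eq_pow / (r < s)%N.
    move=> wl; have [|lt|eq] := ltngtP r s; first exact: wl.
      by apply: (wl s r) => //; rewrite eq_sym.
    by rewrite (val_inj eq) eqxx in rs.
  exists (s - r)%N; rewrite ?subn_gt0 //; apply: (lregc r).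
  by rewrite /= -exprD subnKC ?(ltnW lt_rs) // mulr1.
pose p m := (0 < m)%N && (c ^+ m == 1).
have exp : exists m, p m by exists m; rewrite /p m0 cm eqxx.
case: (ex_minnP exp) => q /andP[q0 /eqP cq] minq.
exists q; split=> // r' /andP[r0 rq] cr.
by have := minq r'; rewrite /p r0 cr eqxx leqNgt rq => /(_ isT).
Qed.

End BoundedPowers.

Section Coxeter.
Variables (R : realType) (k : closedFieldType) (C : monCat k) (M : modCat C).
Hypothesis hM : finite_semisimple M.
Variables (n : nat) (L : 'I_n -> M).
Hypothesis hL : irr_reps L.
Variables (P D : C).
Hypothesis dDP : left_dual D P.
Variables (lam : R) (v : 'I_n -> R).
Hypothesis v0 : forall i, 0 < v i.
Hypothesis Ev : bip_eigen L lam P v v.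

Local Notation G := (gr_mx L (act P)).
Local Notation sa := (sigma_a L (act D)).
Local Notation sb := (sigma_b L (act P)).
Local Notation c := (sa *m sb).

Let GE i j : G i j = (mult L i (act P (L j)))%:Z.
Proof. exact: gr_mxE. Qed.

Lemma gr_mx_dual : gr_mx L (act D) = G^T.
Proof.
apply/matrixP => i j; rewrite (gr_mxE hM hL) mxE GE.
by rewrite (mult_dual hM hL _ _ dDP).
Qed.

Lemma sigma_a_mul (p s : 'cV[int]_n) :
  sa *m col_mx p s = col_mx (G^T *m s - p) s.
Proof.
rewrite /sigma_a gr_mx_dual mul_block_col mulNmx !mul1mx mul0mx add0r.
by rewrite addrC.
Qed.

Lemma sigma_b_mul (p s : 'cV[int]_n) :
  sb *m col_mx p s = col_mx p (G *m p - s).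
Proof. by rewrite /sigma_b mul_block_col mulNmx !mul1mx mul0mx addr0. Qed.

Lemma cV_ext m m' (A B : 'M[int]_(m', m)) :
  (forall x : 'cV[int]_m, A *m x = B *m x) -> A = B.
Proof.
move=> AB; apply/matrixP => i j; have := AB (delta_mx j 0).
by rewrite -!colE => /colP/(_ i); rewrite !mxE.
Qed.

Lemma sigma_invol : (sb *m sa) *m c = 1%:M.
Proof.
apply: cV_ext => x; rewrite -(vsubmxK x) -!mulmxA sigma_b_mul sigma_a_mul.
by rewrite sigma_a_mul opprB addrC subrK sigma_b_mul opprB addrC subrK mul1mx.
Qed.

Let dot (x y : 'cV[int]_n) : int := (x^T *m y) 0 0.

Let dotE x y : dot x y = \sum_i x i 0 * y i 0.
Proof. by rewrite /dot mxE; apply: eq_bigr => i _; rewrite mxE. Qed.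
Let dotC x y : dot x y = dot y x.
Proof. by rewrite !dotE; apply: eq_bigr => i _; rewrite mulrC. Qed.
Let dotBr x y z : dot x (y - z) = dot x y - dot x z.
Proof. by rewrite /dot mulmxBr !mxE. Qed.
Let dotBl x y z : dot (x - y) z = dot x z - dot y z.
Proof. by rewrite !(dotC _ z) dotBr. Qed.
Let dotG x y : dot x (G *m y) = dot (G^T *m x) y.
Proof. by rewrite /dot mulmxA trmx_mul trmxK. Qed.

(* Half of the quadratic form of the Cartan matrix of the unfolded quiver; the two
   factors of the Coxeter transformation are isometries for it. *)
Let form (x : 'cV[int]_(n + n)) : int :=
  let p := usubmx x in let s := dsubmx x in dot p p + dot s s - dot s (G *m p).

Let form_col p s : form (col_mx p s) = dot p p + dot s s - dot s (G *m p).
Proof. by rewrite /form col_mxKu col_mxKd. Qed.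

Let form_c x : form (c *m x) = form x.
Proof.
have fa p s : form (sa *m col_mx p s) = form (col_mx p s).
  rewrite sigma_a_mul !form_col !dotG !dotBr !dotBl (dotC p (G^T *m s)).
  by ring.
have fb p s : form (sb *m col_mx p s) = form (col_mx p s).
  rewrite sigma_b_mul !form_col !dotBl !dotBr (dotC s (G *m p)).
  by ring.
rewrite -mulmxA -{1}(vsubmxK x) sigma_b_mul fa -sigma_b_mul fb.
by rewrite vsubmxK.
Qed.

Let norm2 (x : 'cV[int]_(n + n)) : int := \sum_i x i 0 ^+ 2.

Let form_bound x : (1 - lam / 2) * (norm2 x)%:~R <= (form x)%:~R :> R.
Proof.
rewrite -(vsubmxK x); move: (usubmx x) (dsubmx x) => p s.
have normE : norm2 (col_mx p s) = dot p p + dot s s.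
  rewrite /norm2 big_split_ord /= !dotE; congr (_ + _); apply: eq_bigr => i _.
    by rewrite col_mxEu expr2.
  by rewrite col_mxEd expr2.
rewrite form_col normE intrB mulrBl mul1r lerB //.
pose P' i : R := (p i 0)%:~R; pose S' i : R := (s i 0)%:~R.
have dotR (x' y : 'cV[int]_n) : (dot x' y)%:~R = \sum_i (x' i 0)%:~R * (y i 0)%:~R :> R.
  rewrite dotE rmorph_sum /=; apply: eq_bigr => i _; by rewrite intrM.
rewrite intrD !dotR.
have [E1 E2] := Ev; pose N i j : R := (mult L i (act P (L j)))%:R.
have N0 i j : 0 <= N i j by [].
have vneq i : v i != 0 by rewrite gt_eqF.
have -> : \sum_i (s i 0)%:~R * ((G *m p) i 0)%:~R = \sum_i \sum_j N i j * (S' i * P' j).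
  apply: eq_bigr => i _; rewrite mxE rmorph_sum mulr_sumr /=.
  by apply: eq_bigr => j _; rewrite intrM GE /N -pmulrn mulrCA.
(* The weights v_j / v_i and v_i / v_j are those that make both sums over the
   other index collapse by the eigenvector equations for v. *)
have amgm i j : S' i * P' j <= (S' i ^+ 2 * (v j / v i) + P' j ^+ 2 * (v i / v j)) / 2.
  rewrite -subr_ge0.
  have -> : (S' i ^+ 2 * (v j / v i) + P' j ^+ 2 * (v i / v j)) / 2 - S' i * P' j
     = (S' i * v j - P' j * v i) ^+ 2 / (2 * v i * v j).
    by field; rewrite !vneq.
  by rewrite divr_ge0 ?sqr_ge0 // !mulr_ge0 // ltW.
apply: (@le_trans _ _ (\sum_i \sum_j
   N i j * ((S' i ^+ 2 * (v j / v i) + P' j ^+ 2 * (v i / v j)) / 2))).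
  by apply: ler_sum => i _; apply: ler_sum => j _; rewrite ler_wpM2l.
rewrite le_eqVlt; apply/orP; left; apply/eqP.
transitivity ((\sum_i S' i ^+ 2 / v i * (\sum_j N i j * v j)
   + \sum_j P' j ^+ 2 / v j * (\sum_i v i * N i j)) / 2).
  rewrite mulrDl !mulr_suml.
  under [X in _ = _ + X]eq_bigr do rewrite mulr_sumr mulr_suml.
  rewrite [X in _ = _ + X]exchange_big /= -big_split; apply: eq_bigr => i _.
  rewrite mulr_sumr mulr_suml -big_split; apply: eq_bigr => j _ /=.
  by rewrite mulrCA; field; rewrite !vneq.
under eq_bigr do rewrite E2 mulrCA divfK //.
under [X in _ + X]eq_bigr do rewrite E1 mulrCA divfK //.
rewrite -!mulr_sumr -mulrDr addrC mulrAC; congr (_ * (_ + _)).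
Qed.

(** The positive eigenvector shows that the Cartan form dominates 1 - lam / 2
    times the norm. As the Coxeter transformation preserves this form, its powers
    are bounded. *)
Lemma sigma_finite_order : lam < 2 -> finite_order c.
Proof.
move=> lam2; have d0 : 0 < 1 - lam / 2 by lra.
have [b bd] : exists b : nat, (1 - lam / 2)^-1 < b%:R.
  by exists (Num.bound (1 - lam / 2)^-1); apply: archi_boundP; rewrite invr_ge0 ltW.
apply: (bounded_powers_finite_order (b := b) sigma_invol) => r i j.
pose x : 'cV[int]_(n + n) := (c ^+ r) *m delta_mx j 0.
have fx : form x = form (delta_mx j 0).
  rewrite /x; elim: r {x} => [|r IH]; first by rewrite expr0 mul1mx.
  by rewrite exprS -mulmxA form_c.
have dot0 y : dot 0 y = 0 by rewrite /dot trmx0 mul0mx mxE.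
have dd l : dot (delta_mx l 0) (delta_mx l 0) = 1.
  rewrite dotE (bigD1 l) //= !mxE !eqxx mulr1 big1 ?addr0 // => i' /negPf ne.
  by rewrite !mxE ne mul0r.
have fj : form (delta_mx j 0) = 1.
  rewrite -[delta_mx j 0]vsubmxK form_col.
  have [[j' ->]|[j' ->]] : (exists j', j = lshift n j') \/ (exists j', j = rshift n j').
    by case: (splitP j) => j' e; [left|right]; exists j'; apply: val_inj.
  - have -> : usubmx (delta_mx (lshift n j') 0) = delta_mx j' 0 :> 'cV[int]_n.
      by apply/colP => i'; rewrite !mxE eq_lshift.
    have -> : dsubmx (delta_mx (lshift n j') 0) = 0 :> 'cV[int]_n.
      by apply/colP => i'; rewrite !mxE eq_rlshift.
    by rewrite dd !dot0 addr0 subr0.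
  - have -> : usubmx (delta_mx (rshift n j') 0) = 0 :> 'cV[int]_n.
      by apply/colP => i'; rewrite !mxE eq_lrshift.
    have -> : dsubmx (delta_mx (rshift n j') 0) = delta_mx j' 0 :> 'cV[int]_n.
      by apply/colP => i'; rewrite !mxE eq_rshift.
    by rewrite mulmx0 (dotC _ 0) dd !dot0 add0r subr0.
have nx : (norm2 x)%:~R < b%:R :> R.
  apply: le_lt_trans bd; have := form_bound x; rewrite fx fj => fb.
  by rewrite -[leRHS]mul1r ler_pdivlMr // mulrC.
have xi : (c ^+ r) i j = x i 0 by rewrite /x -colE mxE.
have : x i 0 ^+ 2 <= norm2 x.
  by rewrite /norm2 (bigD1 i) //= lerDl sumr_ge0 // => l _; rewrite sqr_ge0.
rewrite pmulrn ltr_int in nx; rewrite xi; nia.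
Qed.

(** On the plane spanned by the eigenvector placed at the two vertices, the
    Coxeter transformation runs through the recurrence of reflections, which
    grows for [lam >= 2]. *)
Lemma sigma_infinite_order : 2 <= lam -> (0 < n)%N -> ~ finite_order c.
Proof.
move=> lam2 n0 [m [m0 cm _]].
pose F : 'M[int]_(n + n) -> 'M[R]_(n + n) := map_mx intr.
pose V : 'cV[R]_n := \col_i v i.
have [E1 E2] := Ev.
have GV : map_mx intr G *m V = lam *: V.
  apply/colP => i; rewrite mxE [RHS]mxE [V i 0]mxE -E2; apply: eq_bigr => j _.
  by rewrite [map_mx _ _ _ _]mxE GE [V j 0]mxE -pmulrn.
have GtV : map_mx intr G^T *m V = lam *: V.
  apply/colP => i; rewrite mxE [RHS]mxE [V i 0]mxE -E1; apply: eq_bigr => j _.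
  by rewrite [map_mx _ _ _ _]mxE [_^T _ _]mxE GE [V j 0]mxE -pmulrn mulrC.
pose W x y := col_mx (x *: V) (y *: V).
have FcW x y : F c *m W x y = W (lam * (lam * x - y) - x) (lam * x - y).
  rewrite /W /F map_mxM -mulmxA /sigma_b /sigma_a gr_mx_dual !map_block_mx.
  rewrite mul_block_col -!scalemxAr GV.
  rewrite !map_mx0 !map_mxN !map_mx1 !mul0mx !mulNmx !mul1mx scaler0 addr0.
  rewrite mul_block_col !mul0mx !mulNmx !mul1mx add0r mulmxDr -!scalemxAr mulmxN GtV.
  by congr col_mx; apply/colP => i; rewrite !mxE; ring.
have grow r : exists x y, [/\ F (c ^+ r) *m W 1 0 = W x y, 1 + 2 * r%:R <= x,
    0 <= y & 1 <= x - y].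
  elim: r => [|r [x [y [eW x1 y0 xy]]]].
    exists 1, 0; rewrite expr0 /F map_mx1 mul1mx; split=> //; lra.
  exists (lam * (lam * x - y) - x), (lam * x - y).
  have r0 : 0 <= r%:R :> R by [].
  have lx : 0 <= (lam - 2) * x by rewrite mulr_ge0 ?subr_ge0 //; lra.
  have ly : 0 <= (lam - 2) * (lam * x - y).
    by rewrite mulr_ge0 ?subr_ge0 //; lra.
  rewrite exprS /F map_mxM -mulmxA -/F eW FcW -natr1; split=> //; lra.
have [x [y [eW x1 _ _]]] := grow m.
have m1 : 1 <= m%:R :> R by rewrite ler1n.
move: eW; rewrite cm /F map_mx1 mul1mx => /eq_col_mx[/colP/(_ (Ordinal n0)) + _].
rewrite !mxE => /(mulIf (lt0r_neq0 (v0 _))); lra.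
Qed.

End Coxeter.

(** * Graphs with a positive eigenvector of eigenvalue less than 2 *)

Definition dyn_adj t i j := dynkin_edge t i j || dynkin_edge t j i.

(** Numbered as they are, the Dynkin diagrams grow by attaching one vertex at a
    time; in particular they are connected. *)
Lemma dynkin_parent t i : dynkin_wf t -> (0 < i < dynkin_rank t)%N ->
  exists2 j, (j < i)%N & dynkin_edge t j i.
Proof.
case: t => [n|n|||] wf; rewrite /dynkin_edge /= => /andP[i0 ir].
- by exists i.-1; lia.
- have [eq|ne] := eqVneq i n.-1; [exists (n - 3)%N|exists i.-1]; move: wf => /=; lia.
- have [eq|ne] := eqVneq i 5; [exists 2|exists i.-1]; lia.
- have [eq|ne] := eqVneq i 6; [exists 2|exists i.-1]; lia.
- have [eq|ne] := eqVneq i 7; [exists 2|exists i.-1]; lia.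
Qed.

Section Classification.
Variables (R : realType) (V : finType) (a : V -> V -> nat).
Hypothesis a_sym : forall x y, a x y = a y x.
Hypothesis a_irr : forall x, a x x = 0%N.
Variables (lam : R) (v : V -> R).
Hypothesis v0 : forall x, 0 < v x.
Hypothesis Ev : forall x, \sum_y (a x y)%:R * v y = lam * v x.
Hypothesis lam2 : lam < 2.

Local Open Scope nat_scope.

(** Pairing such a weight with the positive eigenvector gives lam >= 2. The
    imaginary roots of the affine diagrams are weights of this kind, so that no
    affine diagram occurs as a subgraph. *)
Lemma no_affine_weight (w : V -> nat) :
  (exists x, 0 < w x) -> (forall x, 0 < w x -> 2 * w x <= \sum_y a x y * w y) ->
  False.
Proof.
move=> [x0 wx0] w2.
pose S : R := (\sum_x v x * (w x)%:R)%R.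
have S0 : (0 < S)%R.
  rewrite /S (bigD1 x0) //= ltr_wpDr ?mulr_gt0 ?ltr0n //.
  by apply: sumr_ge0 => x _; rewrite mulr_ge0 // ltW.
have : (2 * S <= lam * S)%R.
  have -> : (lam * S = \sum_x v x * (\sum_y a x y * w y)%:R)%R.
    rewrite /S mulr_sumr.
    under eq_bigr do rewrite mulrA -Ev mulr_suml.
    rewrite exchange_big; apply: eq_bigr => x _ /=.
    rewrite natr_sum mulr_sumr; apply: eq_bigr => y _.
    by rewrite natrM a_sym mulrAC mulrC mulrA.
  rewrite /S mulr_sumr; apply: ler_sum => x _.
  rewrite mulrCA ler_pM2l // -natrM ler_nat.
  by have [->|/w2] := posnP (w x).
by rewrite ler_pM2r // leNgt lam2.
Qed.

Lemma sum_neighbours (w : V -> nat) x (l : seq V) : uniq l ->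
  (forall y, y \in l -> 0 < a x y) -> \sum_(y <- l) w y <= \sum_y a x y * w y.
Proof.
move=> ul al; rewrite big_uniq // big_mkcond; apply: leq_sum => y _.
by case: ifP => // /al ay; rewrite leq_pmull.
Qed.

Variable x0 : V.

(** The same criterion for weights carried by a list of distinct vertices. *)
Lemma no_affine_list (s : seq V) (f : nat -> nat) : uniq s ->
  (exists2 i, i < size s & 0 < f i) ->
  (forall i, i < size s -> 0 < f i -> exists l : seq nat,
     [/\ uniq l, forall j, j \in l -> j < size s /\ 0 < a (nth x0 s i) (nth x0 s j)
       & 2 * f i <= \sum_(j <- l) f j]) -> False.
Proof.
move=> us [i0 i0s fi0] H.
pose w x := if x \in s then f (index x s) else 0.
have wE i : i < size s -> w (nth x0 s i) = f i.
  by move=> si; rewrite /w mem_nth // index_uniq.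
apply: (@no_affine_weight w); first by exists (nth x0 s i0); rewrite wE.
move=> x; rewrite {1}/w; case: ifP => // xs fx.
have six : index x s < size s by rewrite index_mem.
have [l [ul lP l2]] := H _ six fx.
rewrite -{1 2}(nth_index x0 xs) (wE _ six); apply: leq_trans l2 _.
have <- : \sum_(y <- map (nth x0 s) l) w y = \sum_(j <- l) f j.
  rewrite big_map big_seq [RHS]big_seq; apply: eq_bigr => j /lP[js _].
  exact: wE.
apply: sum_neighbours => [|_ /mapP[j /lP[_ aj] ->] //].
rewrite map_inj_in_uniq // => j j' /lP[js _] /lP[j's _] /eqP.
by rewrite nth_uniq // => /eqP.
Qed.

Lemma no_multiple_edge x y : a x y <= 1.
Proof.
rewrite leqNgt; apply/negP => axy.
have xy : x != y by apply: contraTneq axy => ->; rewrite a_irr.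
apply: (@no_affine_weight (fun z => (z == x) + (z == y))).
  by exists x; rewrite eqxx.
move=> z; case: (eqVneq z x) => [->|zx] /=.
  by move=> _; rewrite (negPf xy) (bigD1 y) //= eqxx eq_sym (negPf xy); lia.
case: (eqVneq z y) => [->|//] _ /=.
by rewrite (bigD1 x) //= eqxx (negPf xy) a_sym; lia.
Qed.

Local Notation adj := (fun x y => 0 < a x y).

(** The constant weight on the cycle. *)
Lemma no_cycle (c : seq V) : uniq c -> 2 < size c -> cycle adj c -> False.
Proof.
move=> uc c2 cyc.
have step i : i < size c -> adj (nth x0 c i) (nth x0 c (i.+1 %% size c)).
  case: c uc c2 cyc => // x p uc c2 /= cyc ip.
  have := pathP x0 cyc i; rewrite size_rcons => /(_ ip).
  rewrite -rcons_cons nth_rcons /= ip nth_rcons.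
  case: (ltngtP i (size p)) => [lt| gt |eq].
  - by rewrite modn_small.
  - by rewrite ltnS in ip; lia.
  - by rewrite eq modnn.
set n := size c in c2 step *.
apply: (@no_affine_list c (fun=> 1)) => //; first by exists 0 => //; lia.
move=> i ic _; exists [:: i.+1 %% n; (i + n.-1) %% n]; split.
- rewrite /= andbT inE; apply/eqP.
  rewrite -/n in ic; have [lt|ge] := ltnP i.+1 n.
    rewrite modn_small //; have [i0|i0] := posnP i.
      by rewrite i0 add0n modn_small; lia.
    by rewrite (_ : i + n.-1 = i.-1 + n) ?modnDr ?modn_small; lia.
  have -> : i = n.-1 by lia.
  by rewrite prednK ?modnn; [rewrite (_ : n.-1 + n.-1 = n.-2 + n) ?modnDr ?modn_small|]; lia.
- move=> j; rewrite !inE => /orP[]/eqP ->.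
    by split; [rewrite ltn_mod; lia|exact: step].
  have lt : (i + n.-1) %% n < n by rewrite ltn_mod; lia.
  split=> //; rewrite a_sym; have := step _ lt.
  have -> : ((i + n.-1) %% n).+1 %% n = i; last by [].
  by rewrite -addn1 modnDml addn1 -addnS prednK ?modnDr ?modn_small //; lia.
- by rewrite !big_cons big_nil.
Qed.

Definition dynkin_list t s : Prop :=
  [/\ dynkin_wf t, uniq s, size s = dynkin_rank t &
    forall i j, i < dynkin_rank t -> j < dynkin_rank t ->
      a (nth x0 s i) (nth x0 s j) = dyn_adj t i j].

Definition in_adj (s : seq V) x y := [&& x \in s, y \in s & 0 < a x y].

Lemma dynkin_list_connected t s : dynkin_list t s ->
  {in s &, forall x y, connect (in_adj s) x y}.
Proof.
move=> [wf us ss aE] x y xs ys.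
have sym : connect_sym (in_adj s).
  by apply: sym_connect_sym => u w; rewrite /in_adj a_sym andbCA.
have root z : z \in s -> connect (in_adj s) (nth x0 s 0) z.
  move=> zs; rewrite -(nth_index x0 zs).
  have : index z s < size s by rewrite index_mem.
  elim/ltn_ind: (index z s) => i IH si; case: (posnP i) => [->|i0] //.
  have [|j ji eji] := @dynkin_parent t i wf; first by rewrite i0 -ss.
  have js := ltn_trans ji si.
  apply: connect_trans (IH _ ji js) _; apply: connect1.
  by rewrite /in_adj !mem_nth // aE -?ss // /dyn_adj eji.
by apply: connect_trans (root y ys); rewrite sym; apply: root.
Qed.

Section Extend.
Variables (t : dynkin) (s : seq V) (y : V) (p : nat).
Hypothesis dls : dynkin_list t s.
Hypothesis ys : y \notin s.
Hypothesis pt : p < dynkin_rank t.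
Hypothesis ay : 0 < a (nth x0 s p) y.

Local Notation n := (dynkin_rank t).
Let sy := rcons s y.

(** A second neighbour would close a cycle, the diagram being connected. *)
Lemma attached_once i : i < n -> a (nth x0 s i) y = (i == p).
Proof.
have [wf us ss aE] := dls.
move=> ni; apply/eqP; rewrite eqn_leq; apply/andP; split.
  have [_|ip] := eqVneq i p; first exact: no_multiple_edge.
  rewrite leqNgt; apply/negP => ai.
  have is_ : nth x0 s i \in s by rewrite mem_nth ?ss.
  have ps : nth x0 s p \in s by rewrite mem_nth ?ss.
  have /connectP[q0 path_q0] := dynkin_list_connected dls ps is_.
  case/shortenP: path_q0 => q path_q uq _ last_q.
  have qs : {subset q <= s}.
    elim: q (nth x0 s p) path_q {uq last_q ps} => //= z q IH u /andP[/and3P[_ zs _] zq] w.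
    by rewrite inE => /orP[/eqP ->//|]; apply: IH zq w.
  have [q_nil|q0'] := eqVneq q [::].
    move: last_q; rewrite q_nil /= => /eqP; rewrite nth_uniq ?ss // => /eqP eip.
    by rewrite eip eqxx in ip.
  apply: (@no_cycle [:: y, nth x0 s p & q]).
  - rewrite cons_uniq uq andbT inE negb_or; apply/andP; split.
      by apply: contraNneq ys => ->.
    by apply: contra ys => /qs.
  - by case: (q) q0'.
  - rewrite /= a_sym ay rcons_path -last_q ai andbT.
    by apply: sub_path path_q => u w /and3P[].
by case: eqP => [->|].
Qed.

(** The enlarged diagram: the new vertex, numbered [n], hangs on the vertex [p]. *)
Definition ext_adj i j :=
  [|| [&& i < n, j < n & dyn_adj t i j], (i == p) && (j == n) | (i == n) && (j == p)].

Lemma ext_adjE i j : i <= n -> j <= n -> a (nth x0 sy i) (nth x0 sy j) = ext_adj i j.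
Proof.
have [wf us ss aE] := dls; rewrite /ext_adj /sy !nth_rcons ss => ni nj.
have [lti|gti|->] := ltngtP i n; have [ltj|gtj|->] := ltngtP j n => //=; try lia.
- by rewrite aE // andbF !orbF.
- by rewrite attached_once // andbT orbF.
- by rewrite a_sym attached_once //; lia.
- by rewrite a_irr; lia.
Qed.

Let usy : uniq sy. Proof. by have [_ us _ _] := dls; rewrite rcons_uniq ys. Qed.
Let ssy : size sy = n.+1. Proof. by have [_ _ ss _] := dls; rewrite size_rcons ss. Qed.

(** The list [l] renumbers the enlarged diagram as the diagram [t']. *)
Lemma extend_list t' (l : seq nat) :
  perm_eq l (iota 0 n.+1) -> dynkin_wf t' -> dynkin_rank t' = n.+1 ->
  (forall i j, i <= n -> j <= n -> dyn_adj t' i j = ext_adj (nth 0 l i) (nth 0 l j)) ->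
  exists t' s', dynkin_list t' s' /\ perm_eq s' (y :: s).
Proof.
move=> perm_l wf' rk' adjE; exists t', (map (nth x0 sy) l).
have sl : size l = n.+1 by rewrite (perm_size perm_l) size_iota.
have ln i : i <= n -> nth 0 l i <= n.
  move=> ni; have : nth 0 l i \in l by rewrite mem_nth ?sl.
  by rewrite (perm_mem perm_l) mem_iota.
have perm_s : perm_eq (map (nth x0 sy) l) (y :: s).
  rewrite perm_sym -perm_rcons -/sy perm_sym -[X in perm_eq _ X](mkseq_nth x0) ssy.
  exact: perm_map.
split=> //; split=> //.
- by have [_ us _ _] := dls; rewrite (perm_uniq perm_s) /= ys.
- by rewrite size_map sl.
move=> i j; rewrite rk' !ltnS => ni nj.
by rewrite !(nth_map 0) ?sl ?ltnS // ext_adjE ?ln // adjE.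
Qed.

(** The weight [f] on the subgraph with vertices [q] and edges [E]; all its
    conditions are decidable by computation once [E] and [f] are explicit. *)
Lemma extend_affine (m : nat) (E : seq (nat * nat)) (f : seq nat) (q : seq nat) :
  uniq q -> all (fun i => i <= n) q -> size q = m ->
  all (fun e => ext_adj (nth 0 q e.1) (nth 0 q e.2)) E ->
  all (fun e => (e.1 < m) && (e.2 < m)) E ->
  has (fun i => 0 < nth 0 f i) (iota 0 m) ->
  all (fun i => let l := [seq e.2 | e <- E & e.1 == i] ++ [seq e.1 | e <- E & e.2 == i] in
         uniq l && (2 * nth 0 f i <= sumn (map (nth 0 f) l))) (iota 0 m) ->
  False.
Proof.
move=> uq /allP qn sq /allP EE /allP Em /hasP[i0] /[!mem_iota] /= i0m fi0 /allP H.
apply: (@no_affine_list (map (nth x0 sy) q) (nth 0 f)).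
- rewrite map_inj_in_uniq // => i j /qn iq /qn jq /eqP.
  by rewrite nth_uniq ?ssy // => /eqP.
- by exists i0; rewrite ?size_map ?sq.
rewrite size_map sq => i im _.
have [|ul le2] := andP (H i _); first by rewrite mem_iota.
exists ([seq e.2 | e <- E & e.1 == i] ++ [seq e.1 | e <- E & e.2 == i]); split=> //.
  move=> j; have qle i' : i' < m -> nth 0 q i' <= n by move=> ?; apply: qn; rewrite mem_nth ?sq.
  have symE : symmetric ext_adj.
    by move=> u w; rewrite /ext_adj /dyn_adj; case: (dynkin_edge t u w); case: (dynkin_edge t w u); lia.
  rewrite mem_cat => /orP[]/mapP[[e1 e2]]; rewrite mem_filter /= => /andP[/eqP ei eE] ->;
    have /andP[/= e1m e2m] := Em _ eE; split=> //;
    rewrite !(nth_map 0) ?sq // ext_adjE ?qle //.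
    by have := EE _ eE; rewrite /= ei => ->.
  by have := EE _ eE; rewrite /= ei symE => ->.
by rewrite -(big_map (nth 0 f) xpredT id) -sumnE.
Qed.


Definition ext_edges :=
  [seq e <- [seq (i, j) | i <- iota 0 n.+1, j <- iota 0 n.+1]
  | (e.1 < e.2) && ext_adj e.1 e.2].

Definition affine_weight (E : seq (nat * nat)) m (f : seq nat) :=
  has (fun i => 0 < nth 0 f i) (iota 0 m) &&
  all (fun i => let l := [seq e.2 | e <- E & e.1 == i] ++ [seq e.1 | e <- E & e.2 == i] in
         uniq l && (2 * nth 0 f i <= sumn (map (nth 0 f) l))) (iota 0 m).

Lemma extend_affine_all (f : seq nat) : affine_weight ext_edges n.+1 f -> False.
Proof.
move=> /andP[f0 H]; apply: (@extend_affine n.+1 ext_edges f (iota 0 n.+1)) => //.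
- exact: iota_uniq.
- by apply/allP => i; rewrite mem_iota.
- exact: size_iota.
- apply/allP => -[i j]; rewrite mem_filter => /andP[/andP[_ ij]].
  move=> /allpairsPdep[i' [j' [hi hj [ei ej]]]]; move: hi hj.
  by rewrite -ei -ej !mem_iota => /andP[_ i'n] /andP[_ j'n]; rewrite !nth_iota.
- apply/allP => -[i j]; rewrite mem_filter => /andP[_].
  move=> /allpairsPdep[i' [j' [hi hj [-> ->]]]]; move: hi hj.
  by rewrite !mem_iota => /andP[_ i'n] /andP[_ j'n]; apply/andP.
Qed.

Lemma extend_list_comp t' (l : seq nat) :
  [&& perm_eq l (iota 0 n.+1), dynkin_wf t', dynkin_rank t' == n.+1 &
   all (fun i => all (fun j =>
      dyn_adj t' i j == ext_adj (nth 0 l i) (nth 0 l j)) (iota 0 n.+1)) (iota 0 n.+1)] ->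
  exists t' s', dynkin_list t' s' /\ perm_eq s' (y :: s).
Proof.
move=> /and4P[perm_l wf' /eqP rk' /allP H]; apply: (extend_list perm_l wf' rk').
move=> i j ni nj; apply/eqP; have := H i; rewrite mem_iota => /(_ ni)/allP; apply.
by rewrite mem_iota.
Qed.

End Extend.

Ltac split_lia := repeat (apply/andP; split); try done; lia.

Section ExtendEach.
Variables (s : seq V) (y : V) (p : nat).
Hypothesis ys : y \notin s.
Local Notation extendible := (exists t' s', dynkin_list t' s' /\ perm_eq s' (y :: s)).

Lemma extend_E6 : dynkin_list TypeE6 s -> p < 6 -> 0 < a (nth x0 s p) y -> extendible.
Proof.
move=> dl p6 ay.
have ok := extend_list_comp dl ys p6 ay.
have bad := extend_affine_all dl ys p6 ay.
case: p p6 ay ok bad => [|[|[|[|[|[|//]]]]]] p6 ay ok bad.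
- by apply: (ok TypeE7 [:: 4; 3; 2; 1; 0; 6; 5]); vm_compute.
- by case: (bad [:: 1; 2; 2; 1; 0; 1; 1]); vm_compute.
- by case: (bad [:: 0; 1; 2; 1; 0; 1; 1]); vm_compute.
- by case: (bad [:: 0; 1; 2; 2; 1; 1; 1]); vm_compute.
- by apply: (ok TypeE7 [:: 0; 1; 2; 3; 4; 6; 5]); vm_compute.
- by case: (bad [:: 1; 2; 3; 2; 1; 2; 1]); vm_compute.
Qed.

Lemma extend_E7 : dynkin_list TypeE7 s -> p < 7 -> 0 < a (nth x0 s p) y -> extendible.
Proof.
move=> dl p7 ay.
have ok := extend_list_comp dl ys p7 ay.
have bad := extend_affine_all dl ys p7 ay.
case: p p7 ay ok bad => [|[|[|[|[|[|[|//]]]]]]] p7 ay ok bad.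
- by case: (bad [:: 2; 3; 4; 3; 2; 1; 2; 1]); vm_compute.
- by case: (bad [:: 1; 2; 2; 1; 0; 0; 1; 1]); vm_compute.
- by case: (bad [:: 0; 1; 2; 1; 0; 0; 1; 1]); vm_compute.
- by case: (bad [:: 0; 1; 2; 2; 1; 0; 1; 1]); vm_compute.
- by case: (bad [:: 0; 1; 2; 2; 2; 1; 1; 1]); vm_compute.
- by apply: (ok TypeE8 [:: 0; 1; 2; 3; 4; 5; 7; 6]); vm_compute.
- by case: (bad [:: 1; 2; 3; 2; 1; 0; 2; 1]); vm_compute.
Qed.

Lemma extend_E8 : dynkin_list TypeE8 s -> p < 8 -> 0 < a (nth x0 s p) y -> False.
Proof.
move=> dl p8 ay; have bad := extend_affine_all dl ys p8 ay.
case: p p8 ay bad => [|[|[|[|[|[|[|[|//]]]]]]]] p8 ay bad.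
- by case: (bad [:: 2; 3; 4; 3; 2; 1; 0; 2; 1]); vm_compute.
- by case: (bad [:: 1; 2; 2; 1; 0; 0; 0; 1; 1]); vm_compute.
- by case: (bad [:: 0; 1; 2; 1; 0; 0; 0; 1; 1]); vm_compute.
- by case: (bad [:: 0; 1; 2; 2; 1; 0; 0; 1; 1]); vm_compute.
- by case: (bad [:: 0; 1; 2; 2; 2; 1; 0; 1; 1]); vm_compute.
- by case: (bad [:: 0; 1; 2; 2; 2; 2; 1; 1; 1]); vm_compute.
- by case: (bad [:: 2; 4; 6; 5; 4; 3; 2; 3; 1]); vm_compute.
- by case: (bad [:: 1; 2; 3; 2; 1; 0; 0; 2; 1]); vm_compute.
Qed.

(* Numbered along the long chain, with the last vertex on the short arm. *)
Definition affine_E7 := [:: (0, 1); (1, 2); (2, 3); (3, 4); (4, 5); (5, 6); (3, 7)].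
Definition affine_E8 :=
  [:: (0, 1); (1, 2); (2, 3); (3, 4); (4, 5); (5, 6); (6, 7); (2, 8)].

End ExtendEach.

Lemma dynkin_A_rev n (s : seq V) : dynkin_list (TypeA n) s -> dynkin_list (TypeA n) (rev s).
Proof.
move=> [wf us ss aE]; split=> //; rewrite ?rev_uniq ?size_rev //= => i j ni nj.
rewrite !nth_rev ?ss //= aE /=; try lia.
by rewrite /dyn_adj /dynkin_edge /=; lia.
Qed.

(** The position of [p] from the nearer end decides: 0 gives A, 1 gives D, 2 gives
    E or contains affine E_8, and 3 or more contains affine E_7. *)
Lemma extend_A_half n (s : seq V) y p : y \notin s -> dynkin_list (TypeA n) s ->
  p < n -> n <= p + p.+1 -> 0 < a (nth x0 s p) y ->
  exists t' s', dynkin_list t' s' /\ perm_eq s' (y :: s).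
Proof.
move=> ys dl pn half ay.
have ok := extend_list dl ys pn ay.
have okc := extend_list_comp dl ys pn ay.
have bad := extend_affine dl ys pn ay.
have idl i : i <= n -> nth 0 (iota 0 n.+1) i = i by move=> ni; rewrite nth_iota.
have [d0|d0] := eqVneq p.+1 n.
  apply: (ok (TypeA n.+1) (iota 0 n.+1)) => //= i j ni nj.
  by rewrite !idl // /dyn_adj /ext_adj /dyn_adj /dynkin_edge /=; lia.
have [d1|d1] := eqVneq p.+2 n.
  apply: (ok (TypeD n.+1) (iota 0 n.+1)) => //=; first by lia.
  move=> i j ni nj; rewrite !idl // /dyn_adj /ext_adj /dyn_adj /dynkin_edge /=; lia.
have [d2|d2] := eqVneq p.+3 n.
  case: (ltnP n 8) => n8.
    have [n5|[n6|n7]] : n = 5 \/ n = 6 \/ n = 7 by lia.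
    - subst n; have ? : p = 2 by lia. subst p.
      by apply: (okc TypeE6 [:: 4; 3; 2; 1; 0; 5]); vm_compute.
    - subst n; have ? : p = 3 by lia. subst p.
      by apply: (okc TypeE7 [:: 5; 4; 3; 2; 1; 0; 6]); vm_compute.
    - subst n; have ? : p = 4 by lia. subst p.
      by apply: (okc TypeE8 [:: 6; 5; 4; 3; 2; 1; 0; 7]); vm_compute.
  have [m nE] : exists m, n = m + 8 by exists (n - 8); lia.
  have pE : p = m + 5 by lia.
  case: (bad 9 affine_E8 [:: 2; 4; 6; 5; 4; 3; 2; 1; 3]
    [:: m + 7; m + 6; m + 5; m + 4; m + 3; m + 2; m + 1; m; m + 8]) => //.
  - by rewrite /= !inE !negb_or; split_lia.
  - by rewrite /= nE; split_lia.
  - by rewrite /= /ext_adj /dyn_adj /dynkin_edge /= nE pE; split_lia.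
have [m pE] : exists m, p = m + 3 by exists (p - 3); lia.
have [r nE] : exists r, n = m + r + 7 by exists (n - (m + 7)); lia.
case: (bad 8 affine_E7 [:: 1; 2; 3; 4; 3; 2; 1; 2]
  [:: m; m + 1; m + 2; m + 3; m + 4; m + 5; m + 6; m + r + 7]) => //.
- by rewrite /= !inE !negb_or; split_lia.
- by rewrite /= nE; split_lia.
- by rewrite /= /ext_adj /dyn_adj /dynkin_edge /= nE pE; split_lia.
Qed.

Lemma extend_A n (s : seq V) y p : y \notin s -> dynkin_list (TypeA n) s ->
  p < n -> 0 < a (nth x0 s p) y ->
  exists t' s', dynkin_list t' s' /\ perm_eq s' (y :: s).
Proof.
move=> ys dl pn ay; have [half|half] := leqP n (p + p.+1).
  exact: extend_A_half ys dl pn half ay.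
have [_ _ ss _] := dl; rewrite /= in ss.
have [|||||t' [s' [dl' perm']]] := @extend_A_half n (rev s) y (n - p.+1).
- by rewrite mem_rev.
- exact: dynkin_A_rev.
- by lia.
- by lia.
- by rewrite nth_rev ?ss; [rewrite (_ : n - (n - p.+1).+1 = p) //; lia|lia].
exists t', s'; split=> //; apply: perm_trans perm' _.
by rewrite perm_cons perm_rev.
Qed.

(** A vertex attached to the end of the long arm gives D again; one attached in
    between creates a second branching or a vertex of degree 4, an affine D; one
    attached to a short leg lengthens it, which gives E or contains affine E_8. *)
Lemma extend_D n (s : seq V) y p : y \notin s -> dynkin_list (TypeD n) s ->
  p < n -> 0 < a (nth x0 s p) y ->
  exists t' s', dynkin_list t' s' /\ perm_eq s' (y :: s).
Proof.
move=> ys dl pn ay.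
have [/= n4 us ss _] := dl; rewrite /= in ss.
have ok := extend_list dl ys pn ay.
have okc := extend_list_comp dl ys pn ay.
have bad := extend_affine dl ys pn ay.
have [p0|p0] := eqVneq p 0.
  subst p; apply: (ok (TypeD n.+1) (n :: iota 0 n)) => [|/=|//|]; [|by lia|].
  - by rewrite -addn1 iotaD add0n cats1 perm_sym perm_rcons.
  - have nE i : i <= n -> nth 0 (n :: iota 0 n) i = if i is j.+1 then j else n.
      by case: i => //= i ni; rewrite nth_iota.
    move=> i j ni nj; rewrite !nE // /dyn_adj /ext_adj /dyn_adj /dynkin_edge /=.
    by case: i j ni nj => [|i] [|j] /= ni nj; lia.
have [pD|pD] := leqP p (n - 3).
  pose f i := if p <= i <= n - 3 then 2 else
     (i == p.-1) + (i == n - 2) + (i == n - 1) + (i == n).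
  pose leaf i := [|| i == p.-1, i == n - 2, i == n - 1 | i == n].
  have f_mid j : p <= j <= n - 3 -> f j = 2 by rewrite /f => ->.
  have f_leaf j : leaf j -> f j = 1 by rewrite /f /leaf; case: ifP; lia.
  have f_supp j : 0 < f j -> (p <= j <= n - 3) || leaf j.
    by rewrite /f /leaf; case: ifP => // _; lia.
  case: (@no_affine_list (rcons s y) f).
  - by rewrite rcons_uniq ys.
  - by exists p; [rewrite size_rcons ss; lia|rewrite f_mid // leqnn].
  rewrite size_rcons ss => i; rewrite ltnS => ni /f_supp fi.
  have adjP j : j <= n -> ext_adj (TypeD n) p i j ->
      j < n.+1 /\ 0 < a (nth x0 (rcons s y) i) (nth x0 (rcons s y) j).
    by move=> nj adj_ij; rewrite ltnS nj (ext_adjE dl ys pn ay) // adj_ij.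
  rewrite /ext_adj /dyn_adj /dynkin_edge /= in adjP.
  have [mid|nmid] := boolP (p <= i <= n - 3).
    have [ip|ip] := eqVneq i p; have [iq|iq] := eqVneq i (n - 3).
    - exists [:: p.-1; n; n - 2; n - 1]; split; first by rewrite /= !inE; lia.
        by move=> j; rewrite !inE => /or4P[]/eqP -> ; apply: adjP; lia.
      by rewrite !big_cons big_nil f_mid // !f_leaf ?/leaf; lia.
    - exists [:: p.-1; n; i.+1]; split; first by rewrite /= !inE; lia.
        by move=> j; rewrite !inE => /or3P[]/eqP -> ; apply: adjP; lia.
      by rewrite !big_cons big_nil f_mid // (f_mid i.+1) ?f_leaf ?/leaf; lia.
    - exists [:: i.-1; n - 2; n - 1]; split; first by rewrite /= !inE; lia.
        by move=> j; rewrite !inE => /or3P[]/eqP -> ; apply: adjP; lia.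
      by rewrite !big_cons big_nil f_mid // (f_mid i.-1) ?f_leaf ?/leaf; lia.
    exists [:: i.-1; i.+1]; split; first by rewrite /= !inE; lia.
      by move=> j; rewrite !inE => /orP[]/eqP -> ; apply: adjP; lia.
    by rewrite !big_cons big_nil !f_mid; lia.
  rewrite (negPf nmid) /= in fi.
  rewrite (f_leaf _ fi); exists [:: if (i == p.-1) || (i == n) then p else n - 3].
  split=> // [j|]; last by rewrite big_cons big_nil f_mid; [|case: ifP; lia].
  rewrite inE /leaf in fi * => /eqP ->; case: ifP => il; apply: adjP; lia.
have [n8|n8] := ltnP n 8.
  have pE : p = n - 2 \/ p = n - 1 by clear -pn pD; lia.
  have : n = 4 \/ n = 5 \/ n = 6 \/ n = 7 by clear -n4 n8; lia.
  case=> [|[|[|]]] nE; case: pE => pE; clear ss; subst n p.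
  - by apply: (okc (TypeD 5) [:: 4; 2; 1; 0; 3]); vm_compute.
  - by apply: (okc (TypeD 5) [:: 4; 3; 1; 0; 2]); vm_compute.
  - by apply: (okc TypeE6 [:: 5; 3; 2; 1; 0; 4]); vm_compute.
  - by apply: (okc TypeE6 [:: 5; 4; 2; 1; 0; 3]); vm_compute.
  - by apply: (okc TypeE7 [:: 6; 4; 3; 2; 1; 0; 5]); vm_compute.
  - by apply: (okc TypeE7 [:: 6; 5; 3; 2; 1; 0; 4]); vm_compute.
  - by apply: (okc TypeE8 [:: 7; 5; 4; 3; 2; 1; 0; 6]); vm_compute.
  - by apply: (okc TypeE8 [:: 7; 6; 4; 3; 2; 1; 0; 5]); vm_compute.
have [m nE] : exists m, n = m + 8 by exists (n - 8); lia.
have [q pq] : exists q, (p = m + 6 /\ q = m + 7) \/ (p = m + 7 /\ q = m + 6).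
  have [->|->] : p = m + 6 \/ p = m + 7 by lia.
    by exists (m + 7); left.
  by exists (m + 6); right.
case: (bad 9 affine_E8 [:: 2; 4; 6; 5; 4; 3; 2; 1; 3]
    [:: m + 8; p; m + 5; m + 4; m + 3; m + 2; m + 1; m; q]) => //.
- by rewrite /= !inE !negb_or; case: pq => -[-> ->]; split_lia.
- by rewrite /= nE; case: pq => -[-> ->]; split_lia.
- by rewrite /= /ext_adj /dyn_adj /dynkin_edge /= nE; case: pq => -[-> ->]; split_lia.
Qed.

End Classification.

(** * Perron eigenvectors of the Dynkin diagrams *)

Definition dynkin_coxeter t : nat :=
  match t with
  | TypeA n => n.+1 | TypeD n => (n.-1).*2
  | TypeE6 => 12 | TypeE7 => 18 | TypeE8 => 30
  end.

Section Eigenvectors.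
Variable R : realType.

Lemma sum_delta n (b : bool) c (u : nat -> R) : (b -> c < n)%N ->
  \sum_(j < n) (nat_of_bool (b && (val j == c)))%:R * u j = if b then u c else 0.
Proof.
case: b => [/(_ isT) cn|_] /=; last by rewrite big1 // => j _; rewrite mul0r.
rewrite (bigD1 (Ordinal cn)) //= eqxx mul1r big1 ?addr0 // => j jc.
by rewrite (_ : (val j == c) = false) ?mul0r //; apply: contraNF jc => /eqP e; apply/eqP/val_inj.
Qed.

Lemma sum_chain_A n i (u : nat -> R) : (i < n)%N ->
  \sum_(j < n) (dyn_adj (TypeA n) i j)%:R * u j =
  (if (i.+1 < n)%N then u i.+1 else 0) + (if (0 < i)%N then u i.-1 else 0).
Proof.
move=> ni; rewrite -(@sum_delta n (i.+1 < n)%N i.+1) // -(@sum_delta n (0 < i)%N i.-1); last by lia.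
rewrite -big_split; apply: eq_bigr => j _ /=; rewrite -mulrDl -natrD; congr (_%:R * _).
by have := ltn_ord j; rewrite /dyn_adj /dynkin_edge /=; lia.
Qed.

Lemma dyn_adj_D n i j : (4 <= n)%N -> (i < n)%N -> (j < n)%N ->
  nat_of_bool (dyn_adj (TypeD n) i j) =
  (((i.+1 < n.-1) && (j == i.+1)) + ((0 < i < n.-1) && (j == i.-1))
   + ((i == n - 3) && (j == n.-1)) + ((i == n.-1) && (j == n - 3)))%N.
Proof.
move=> n4 ni nj; rewrite /dyn_adj /dynkin_edge /=.
have -> : (j < n.-1)%N = (j != n.-1) by lia.
have -> : (i < n.-1)%N = (i != n.-1) by lia.
have [iE|iN] := eqVneq i n.-1; have [jE|jN] := eqVneq j n.-1;
  rewrite /= ?andbF ?andbT ?orbF ?addn0 ?add0n; lia.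
Qed.

Lemma sum_chain_D n i (u : nat -> R) : (4 <= n)%N -> (i < n)%N ->
  \sum_(j < n) (dyn_adj (TypeD n) i j)%:R * u j =
  (if (i.+1 < n.-1)%N then u i.+1 else 0) + (if (0 < i < n.-1)%N then u i.-1 else 0)
  + (if (i == n - 3)%N then u n.-1 else 0) + (if (i == n.-1)%N then u (n - 3)%N else 0).
Proof.
move=> n4 ni; rewrite -(@sum_delta n (i.+1 < n.-1)%N i.+1); last by lia.
rewrite -(@sum_delta n (0 < i < n.-1)%N i.-1); last by lia.
rewrite -(@sum_delta n (i == n - 3)%N n.-1); last by lia.
rewrite -(@sum_delta n (i == n.-1)%N (n - 3)); last by lia.
rewrite -!big_split; apply: eq_bigr => j _ /=; rewrite -!mulrDl -!natrD.
by rewrite dyn_adj_D.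
Qed.

Lemma sin_rec (th : R) k :
  sin (k%:R * th) + sin (k.+2%:R * th) = 2 * cos th * sin (k.+1%:R * th).
Proof.
have -> : k%:R * th = k.+1%:R * th - th by rewrite -[k.+1%:R]natr1; ring.
have -> : k.+2%:R * th = k.+1%:R * th + th by rewrite -[k.+2%:R]natr1; ring.
by rewrite sinB sinD; ring.
Qed.

Lemma cos_rec (th : R) k :
  cos (k.+2%:R * th) = 2 * cos th * cos (k.+1%:R * th) - cos (k%:R * th).
Proof.
have -> : k%:R * th = k.+1%:R * th - th by rewrite -[k.+1%:R]natr1; ring.
have -> : k.+2%:R * th = k.+1%:R * th + th by rewrite -[k.+2%:R]natr1; ring.
by rewrite cosB cosD; ring.
Qed.

Lemma sin_pos_frac k m : (0 < k < m)%N -> 0 < sin (k%:R * (pi / m%:R)) :> R.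
Proof.
move=> /andP[k0 km]; have m0 : 0 < m%:R :> R by rewrite ltr0n; lia.
have p0 := pi_gt0 R; apply: sin_gt0_pi; apply/andP; split.
  by apply: mulr_gt0; [rewrite ltr0n|apply: divr_gt0].
by rewrite mulrA ltr_pdivrMr // mulrC ltr_pM2l // ltr_nat.
Qed.

Lemma cos_pi3 : cos (pi / 3) = 1 / 2 :> R.
Proof.
have c0 : 0 < cos (pi / 3) :> R.
  by apply: cos_gt0_pihalf; have := pi_gt0 R; lra.
have : cos (pi / 3 *+ 2) = - cos (pi / 3) :> R.
  have -> : pi / 3 *+ 2 = - (pi / 3) + pi :> R by rewrite mulr2n; field.
  by rewrite (cosDpi (- (pi / 3))) cosN.
rewrite cos_mulr2n; move: c0; set c := cos _ => c0 e.
have : (c + 1) * (2 * c - 1) = 0 by rewrite -[c ^+ 2 *+ 2]mulr_natl in e; lra.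
by move/eqP; rewrite mulf_eq0 => /orP[]/eqP; lra.
Qed.

Lemma cos2_frac m : (2 <= m)%N -> (2 * cos (pi / m.*2%:R)) ^+ 2 = 2 + 2 * cos (pi / m%:R) :> R.
Proof.
move=> m2; have m0 : m%:R != 0 :> R by rewrite pnatr_eq0; lia.
have -> : pi / m%:R = (pi / m.*2%:R) *+ 2 :> R.
  by rewrite mulr2n -mul2n natrM; field.
by rewrite cos_mulr2n; ring.
Qed.

Lemma cos_frac_ge m : (3 <= m)%N -> 1 <= 2 * cos (pi / m%:R) :> R.
Proof.
move=> m3; have m0 : 0 < m%:R :> R by rewrite ltr0n; lia.
have p0 := pi_gt0 R; have m3' : 3 <= m%:R :> R by rewrite ler_nat.
suff : cos (pi / 3) <= cos (pi / m%:R) :> R by rewrite cos_pi3; lra.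
rewrite leNgt ltr_cos ?in_itv /=.
- by rewrite -leNgt ler_pM2l // lef_pV2 ?posrE.
- by apply/andP; split; [rewrite divr_ge0 // ltW|rewrite ler_pdivrMr //; nra].
- by apply/andP; split; [rewrite divr_ge0 // ltW|rewrite ler_pdivrMr //; nra].
Qed.

Lemma cos_frac_gt m : (3 < m)%N -> 1 < 2 * cos (pi / m%:R) :> R.
Proof.
move=> m3; have m0 : 0 < m%:R :> R by rewrite ltr0n; lia.
have p0 := pi_gt0 R; have m3' : 3 < m%:R :> R by rewrite ltr_nat.
suff : cos (pi / 3) < cos (pi / m%:R) :> R by rewrite cos_pi3; lra.
rewrite ltr_cos ?in_itv /=.
- by rewrite ltr_pM2l // ltf_pV2 ?posrE.
- by apply/andP; split; [rewrite divr_ge0 // ltW|rewrite ler_pdivrMr //; nra].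
- by apply/andP; split; [rewrite divr_ge0 // ltW|rewrite ler_pdivrMr //; nra].
Qed.

Lemma cos_frac_pos m : (3 <= m)%N -> 0 < 2 * cos (pi / m%:R) :> R.
Proof. by move=> /cos_frac_ge; lra. Qed.

(* The vertices of E_n are the chain 0, ..., n - 2 and the vertex n - 1
   attached to 2; the entries are Chebyshev polynomials in [l] along the long
   arm, scaled by l (l^2 - 1) to clear the denominators of the short ones. *)
Definition vectE6 (l : R) : seq R :=
  [:: l * (l ^+ 2 - 1); l ^+ 2 * (l ^+ 2 - 1); l * (l ^+ 2 - 1) * (l ^+ 2 - 1);
      l * (l ^+ 2 - 1) * l; l * (l ^+ 2 - 1); (l ^+ 2 - 1) * (l ^+ 2 - 1)].

Definition vectE7 (l : R) : seq R :=
  let U := l ^+ 3 - 2 * l in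
  [:: l * U; l ^+ 2 * U; l * (l ^+ 2 - 1) * U; l * (l ^+ 2 - 1) * (l ^+ 2 - 1);
      l * (l ^+ 2 - 1) * l; l * (l ^+ 2 - 1); (l ^+ 2 - 1) * U].

Definition vectE8 (l : R) : seq R :=
  let U := l ^+ 4 - 3 * l ^+ 2 + 1 in
  [:: l * U; l ^+ 2 * U; l * (l ^+ 2 - 1) * U; l * (l ^+ 2 - 1) * (l ^+ 3 - 2 * l);
      l * (l ^+ 2 - 1) * (l ^+ 2 - 1);
      l * (l ^+ 2 - 1) * l; l * (l ^+ 2 - 1); (l ^+ 2 - 1) * U].

Lemma eigen_by_relation (x y c p : R) : p = 0 -> x - y = c * p -> x = y.
Proof. by move=> -> /eqP; rewrite mulr0 subr_eq0 => /eqP. Qed.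

Lemma eigenvector_E6 (l : R) : l ^+ 4 - 4 * l ^+ 2 + 1 = 0 ->
  forall i, (i < 6)%N ->
  \sum_(j < 6) (dyn_adj TypeE6 i j)%:R * nth 0 (vectE6 l) j = l * nth 0 (vectE6 l) i.
Proof.
move=> P [|[|[|[|[|[|//]]]]]] _; rewrite !big_ord_recl big_ord0 /=.
- by ring.
- by ring.
- by apply: (eigen_by_relation (c := - (l ^+ 2 - 1)) P); ring.
- by ring.
- by ring.
- by ring.
Qed.

Lemma eigenvector_E7 (l : R) : l ^+ 6 - 6 * l ^+ 4 + 9 * l ^+ 2 - 3 = 0 ->
  forall i, (i < 7)%N ->
  \sum_(j < 7) (dyn_adj TypeE7 i j)%:R * nth 0 (vectE7 l) j = l * nth 0 (vectE7 l) i.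
Proof.
move=> P [|[|[|[|[|[|[|//]]]]]]] _; rewrite !big_ord_recl big_ord0 /=.
- by ring.
- by ring.
- by apply: (eigen_by_relation (c := - l) P); ring.
- by ring.
- by ring.
- by ring.
- by ring.
Qed.

Lemma eigenvector_E8 (l : R) :
  l ^+ 8 - 7 * l ^+ 6 + 14 * l ^+ 4 - 8 * l ^+ 2 + 1 = 0 ->
  forall i, (i < 8)%N ->
  \sum_(j < 8) (dyn_adj TypeE8 i j)%:R * nth 0 (vectE8 l) j = l * nth 0 (vectE8 l) i.
Proof.
move=> P [|[|[|[|[|[|[|[|//]]]]]]]] _; rewrite !big_ord_recl big_ord0 /=.
- by ring.
- by ring.
- by apply: (eigen_by_relation (c := -1) P); ring.
- by ring.
- by ring.
- by ring.
- by ring.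
- by ring.
Qed.

Lemma vectE_pos (l : R) : 0 < l -> 3 <= l ^+ 2 ->
  [/\ forall i, (i < 6)%N -> 0 < nth 0 (vectE6 l) i,
      forall i, (i < 7)%N -> 0 < nth 0 (vectE7 l) i
    & forall i, (i < 8)%N -> 0 < nth 0 (vectE8 l) i].
Proof.
move=> l0 l3; have p3 : 0 < l ^+ 2 - 1 by lra.
have p4 : 0 < l ^+ 3 - 2 * l.
  by rewrite (_ : _ - _ = l * (l ^+ 2 - 2)); [rewrite mulr_gt0 //; lra|ring].
have p5 : 0 < l ^+ 4 - 3 * l ^+ 2 + 1.
  rewrite (_ : _ + 1 = l ^+ 2 * (l ^+ 2 - 3) + 1); last by ring.
  by rewrite ltr_wpDl // mulr_ge0 ?sqr_ge0 // subr_ge0.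
split.
- by move=> [|[|[|[|[|[|//]]]]]] _ /=; rewrite ?mulr_gt0 ?exprn_gt0.
- by move=> [|[|[|[|[|[|[|//]]]]]]] _ /=; rewrite ?mulr_gt0 ?exprn_gt0.
- by move=> [|[|[|[|[|[|[|[|//]]]]]]]] _ /=; rewrite ?mulr_gt0 ?exprn_gt0.
Qed.

(** In types A and D the entries are sines of multiples of pi / h, and the
    equations are instances of the addition formula. In type E the polynomial
    relation for 2 cos (pi / h) reduces, by the formulas for multiple angles, to
    cos (pi / 3) = 1 / 2. *)
Lemma dynkin_eigenvector t : dynkin_wf t -> exists u : nat -> R,
  (forall i, (i < dynkin_rank t)%N -> 0 < u i) /\
  (forall i, (i < dynkin_rank t)%N ->
    \sum_(j < dynkin_rank t) (dyn_adj t i j)%:R * u j =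
    2 * cos (pi / (dynkin_coxeter t)%:R) * u i).
Proof.
case: t => [n|n|||] wf.
- pose th : R := pi / n.+1%:R; rewrite /= in wf *.
  pose u i : R := sin (i.+1%:R * th); exists u; split=> i ni.
    exact: sin_pos_frac.
  rewrite sum_chain_A // /u -/th -sin_rec addrC; congr (_ + _).
    by case: i {ni} => //=; rewrite mul0r sin0.
  case: ltnP => // ni'; have -> : i.+2 = n.+1 by lia.
  by rewrite /th mulrCA divff ?mulr1 ?sinpi // pnatr_eq0.
- rewrite /= in wf *; set th : R := pi / _.
  have n0 : n.-1%:R != 0 :> R by rewrite pnatr_eq0; lia.
  have sn1 : n.-1%:R * th = pi / 2.
    by rewrite /th -muln2 natrM; field; rewrite n0.
  have s1 : sin (n.-1%:R * th) = 1 by rewrite sn1 sin_pihalf.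
  have s2 : sin ((n - 2)%:R * th) = cos th.
    have -> : (n - 2)%:R * th = n.-1%:R * th - th.
      by rewrite (_ : n.-1 = (n - 2).+1)%N; [rewrite -natr1; ring|lia].
    by rewrite sinB sn1 sin_pihalf cos_pihalf; ring.
  pose u i : R := if (i < n - 2)%N then 2 * sin (i.+1%:R * th) else 1.
  exists u; split=> i ni.
    rewrite /u; case: ifP => // i2; rewrite mulr_gt0 // sin_pos_frac //; lia.
  rewrite sum_chain_D // -/th.
  have low j : (j < n - 2)%N -> u j = 2 * sin (j.+1%:R * th) by rewrite /u => ->.
  have high j : (n - 2 <= j)%N -> u j = 1 by rewrite /u leqNgt => /negPf ->.
  have [i3|i3] := ltnP i (n - 3).
    rewrite [in RHS]low; last by lia.
    rewrite mulrCA -sin_rec ifT; last by lia.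
    rewrite low; last by lia.
    rewrite (_ : (i == n - 3)%N = false); last by lia.
    rewrite (_ : (i == n.-1)%N = false); last by lia.
    rewrite !addr0 mulrDr addrC; congr (_ + _).
    case: i i3 ni => [|i] i3 ni /=; first by rewrite mul0r sin0 mulr0.
    rewrite ifT; last by lia.
    by rewrite low //; lia.
  have [->|in3] := eqVneq i (n - 3)%N.
    rewrite [in RHS]low; last by lia.
    rewrite mulrCA -sin_rec ifT; last by lia.
    rewrite high; last by lia.
    rewrite ifT; last by lia.
    rewrite low; last by lia.
    rewrite high; last by lia.
    rewrite ifF; last by lia.
    rewrite (_ : (n - 3).-1.+1 = n - 3)%N; last by lia.
    rewrite (_ : (n - 3).+2 = n.-1)%N; last by lia.
    by rewrite s1; ring.
  rewrite [in RHS]high; last by lia.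
  rewrite ifF; last by lia.
  have [->|in1] := eqVneq i n.-1.
    rewrite ifF; last by lia.
    rewrite low; last by lia.
    rewrite (_ : (n - 3).+1 = n - 2)%N; last by lia.
    by rewrite s2; ring.
  rewrite ifT; last by lia.
  rewrite low; last by lia.
  rewrite (_ : i.-1.+1 = n - 2)%N; last by lia.
  by rewrite s2; ring.
- set l := 2 * cos _; have l0 : 0 < l by apply: cos_frac_pos.
  have l2 : l ^+ 2 = 2 + 2 * cos (pi / 6%:R) by apply: (@cos2_frac 6).
  have n1 : 1 <= 2 * cos (pi / 6%:R) :> R by apply: cos_frac_ge.
  have l3 : 3 <= l ^+ 2 by rewrite l2; lra.
  have [pos _ _] := vectE_pos l0 l3.
  exists (nth 0 (vectE6 l)); split; first exact: pos.
  apply: eigenvector_E6.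
  have := cos_rec (pi / 6%:R) 0; rewrite mul0r mul1r cos0.
  have -> : 2 * (pi / 6%:R) = pi / 3 :> R by field.
  rewrite cos_pi3 (_ : l ^+ 4 = (l ^+ 2) ^+ 2); last by ring.
  by rewrite l2; set c := cos _; nra.
- set l := 2 * cos _; have l0 : 0 < l by apply: cos_frac_pos.
  have l2 : l ^+ 2 = 2 + 2 * cos (pi / 9%:R) by apply: (@cos2_frac 9).
  have n1 : 1 <= 2 * cos (pi / 9%:R) :> R by apply: cos_frac_ge.
  have l3 : 3 <= l ^+ 2 by rewrite l2; lra.
  have [_ pos _] := vectE_pos l0 l3.
  exists (nth 0 (vectE7 l)); split; first exact: pos.
  apply: eigenvector_E7.
  have c2 := cos_rec (pi / 9%:R) 0; rewrite mul0r mul1r cos0 in c2.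
  have := cos_rec (pi / 9%:R) 1; rewrite c2 mul1r.
  have -> : 3 * (pi / 9%:R) = pi / 3 :> R by field.
  rewrite cos_pi3 (_ : l ^+ 6 = (l ^+ 2) ^+ 3); last by ring.
  rewrite (_ : l ^+ 4 = (l ^+ 2) ^+ 2); last by ring.
  rewrite l2; set c := cos _ => e.
  by apply: (eigen_by_relation (c := 1) (p := 8 * c ^+ 3 - 6 * c - 1)); [lra|ring].
- set l := 2 * cos _; have l0 : 0 < l by apply: cos_frac_pos.
  have l2 : l ^+ 2 = 2 + 2 * cos (pi / 15%:R) by apply: (@cos2_frac 15).
  have n1 : 1 < 2 * cos (pi / 15%:R) :> R by apply: cos_frac_gt.
  have l3 : 3 <= l ^+ 2 by rewrite l2; lra.
  have [_ _ pos] := vectE_pos l0 l3.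
  exists (nth 0 (vectE8 l)); split; first exact: pos.
  apply: eigenvector_E8.
  have c2 := cos_rec (pi / 15%:R) 0; rewrite mul0r mul1r cos0 in c2.
  have c3 := cos_rec (pi / 15%:R) 1; rewrite c2 mul1r in c3.
  have c4 := cos_rec (pi / 15%:R) 2; rewrite c3 c2 in c4.
  have := cos_rec (pi / 15%:R) 3; rewrite c4 c3.
  have -> : 5 * (pi / 15%:R) = pi / 3 :> R by field.
  rewrite cos_pi3 (_ : l ^+ 8 = (l ^+ 2) ^+ 4); last by ring.
  rewrite (_ : l ^+ 6 = (l ^+ 2) ^+ 3); last by ring.
  rewrite (_ : l ^+ 4 = (l ^+ 2) ^+ 2); last by ring.
  rewrite l2; move: n1; set c := cos _ => n1 e.
  (* nu = 2 c is a root of nu^5 - 5 nu^3 + 5 nu - 1, divisible by nu - 1 *)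
  have c1 : 2 * c - 1 != 0 by lra.
  apply: (mulfI c1); rewrite mulr0.
  by apply: (eigen_by_relation (c := 1) (p := 32 * c ^+ 5 - 40 * c ^+ 3 + 10 * c - 1)); [lra|ring].
Qed.

End Eigenvectors.

(** * Coxeter numbers *)

Section CoxeterElement.

Section RowAction.
Variables (t : dynkin) (W : Type) (row : W -> 'rV[int]_(dynkin_rank t)).
Variable act : W -> nat -> W.
Hypothesis rowM : forall w (i : 'I_(dynkin_rank t)),
  row w *m simple_reflection i = row (act w i).

Definition coxeter_act w := foldl act w (iota 0 (dynkin_rank t)).

Lemma row_coxeter w : row w *m coxeter_element t = row (coxeter_act w).
Proof.
rewrite /coxeter_element /coxeter_act -val_enum_ord.
have -> : \prod_(i < dynkin_rank t) simple_reflection i =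
    \prod_(i <- enum 'I_(dynkin_rank t)) simple_reflection i
  by rewrite enumT [index_enum _]unlock.
elim: (enum _) w => [|i r IH] w /=; first by rewrite big_nil mulmx1.
by rewrite big_cons -[_ * _]/(_ *m _) mulmxA rowM IH.
Qed.

Lemma row_coxeterX m w : row w *m coxeter_element t ^+ m = row (iter m coxeter_act w).
Proof.
elim: m => [|m IH]; first by rewrite expr0 mulmx1.
by rewrite exprSr -[_ * _]/(_ *m _) mulmxA IH row_coxeter.
Qed.

End RowAction.

(** Acting on row vectors from the right, a product of reflections is applied
    from left to right, and only one coordinate enters each correction. *)
Lemma mul_row_reflection t (u : nat -> int) (i : 'I_(dynkin_rank t)) :
  (\row_q u q) *m simple_reflection i = \row_q (u q - cartan i q * u i).
Proof.
apply/rowP => q; rewrite !mxE (bigD1 q) //= !mxE eqxx.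
have [<-|iq] := eqVneq i q.
  rewrite big1 => [|p pi]; first by rewrite mulr1n addr0 mulrBr (mulrC _ (cartan i i)); congr (_ - _); apply: mulr1.
  by rewrite !mxE (negPf pi) mulr0n subr0; apply: mulr0.
rewrite (bigD1 i) //= big1 => [|p /andP[pq pi]].
  rewrite !mxE (negPf iq) eqxx mulr1n mulr0n addr0 sub0r subr0 mulrN mulrC.
  by congr (_ - _); [apply: mul1r|apply: mulrC].
by rewrite !mxE (negPf pq) (negPf pi) mulr0n subr0; apply: mulr0.
Qed.

Lemma mx1_by_rows n (A : 'M[int]_n) : (forall x : 'rV_n, x *m A = x) -> A = 1%:M.
Proof.
by move=> xA; apply/row_matrixP => i; rewrite !rowE xA mulmx1.
Qed.

Definition swap i j : nat := if j == i then i.+1 else if j == i.+1 then i else j.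

Lemma swap_diff (f : nat -> int) i q :
  f (swap i q) - f (swap i q.+1) = f q - f q.+1
   - (2 *+ (i == q) - ((i.+1 == q) || (q.+1 == i))%:Z) * (f i - f i.+1).
Proof.
rewrite /swap eqSS (eq_sym i.+1 q).
have [->|qi] := eqVneq q i.
  have E1 : (i.+1 == i) = false by lia.
  have E2 : (i == i.+1) = false by lia.
  rewrite ?E1 ?E2.
  rewrite [2 *+ _ - _](_ : _ = 2) //.
  by move: (f i) (f i.+1) => x y; ring.
have [->|qi1] := eqVneq q i.+1.
  have E1 : (i.+2 == i) = false by lia.
  have E2 : (i.+1 == i) = false by lia.
  rewrite ?E1 ?E2.
  rewrite [2 *+ _ - _](_ : _ = -1) //.
  by move: (f i) (f i.+1) (f i.+2) => x y z; ring.
have [eq1|ne1] := eqVneq q.+1 i.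
  rewrite [2 *+ _ - _](_ : _ = -1) // -eq1.
  by move: (f q) (f q.+1) (f q.+2) => x y z; ring.
by rewrite [2 *+ _ - _](_ : _ = 0) // mul0r subr0.
Qed.

Lemma foldl_swap k (f : nat -> int) :
  foldl (fun g i => g \o swap i) f (iota 0 k) =
  fun j => if (j < k)%N then f j.+1 else if j == k then f 0%N else f j.
Proof.
elim: k => [|k IH]; first by apply/funext => j /=; case: eqP => [->|].
rewrite -addn1 iotaD foldl_cat IH add0n /=; apply/funext => j; rewrite /= /swap addn1.
have E1 : (k.+1 < k)%N = false by lia.
have E2 : (k.+1 == k) = false by lia.
have [jk|jk|->] := ltngtP j k; last by rewrite E1 E2 ltnS leqnn.
  have -> : (j == k.+1) = false by lia.
  by rewrite jk ltnS (ltnW jk).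
have [->|jk1] := eqVneq j k.+1; first by rewrite !ltnn eqxx.
have F1 : (j < k)%N = false by lia.
have F2 : (j < k.+1)%N = false by lia.
have F3 : (j == k) = false by lia.
by rewrite F1 F2 F3.
Qed.

(** In type A_n the Coxeter element is a cyclic permutation of n + 1 coordinates. *)
Lemma coxeter_number_A n : (1 <= n)%N -> coxeter_number (TypeA n) n.+1.
Proof.
move=> n1; pose row (f : nat -> int) : 'rV[int]_(dynkin_rank (TypeA n)) :=
  \row_q (f q - f q.+1).
pose act (f : nat -> int) i := f \o swap i.
have rowM f i : row f *m simple_reflection i = row (act f i).
  rewrite /row (mul_row_reflection (fun q => f q - f q.+1)).
  by apply/rowP => q; rewrite !mxE /act /= swap_diff.
have pow m f j : (j <= n)%N ->
    iter m (coxeter_act (TypeA n) act) f j = f ((j + m) %% n.+1)%N.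
  elim: m j => [|m IH] j jn; first by rewrite addn0 modn_small.
  rewrite /= /coxeter_act /act foldl_swap /=; case: ltnP => jn'.
    by rewrite IH // addSnnS.
  have -> : j = n by lia.
  by rewrite eqxx IH // add0n addnC addSn -addnS modnDr.
split=> //.
  apply: mx1_by_rows => x.
  pose f (j : nat) := \sum_(q < n | (j <= q)%N) x 0 q.
  (* every row consists of differences of some coordinates *)
  have rf : row f = x.
    apply/rowP => q; rewrite mxE /f (bigD1 q) //= -addrA -[RHS]addr0; congr (_ + _).
    apply/eqP; rewrite subr_eq0; apply/eqP; apply: eq_bigl => p.
    by rewrite -(inj_eq val_inj) /=; lia.
  rewrite -rf (row_coxeterX rowM); apply/rowP => q; rewrite !mxE.
  by rewrite !pow ?modnDr ?modn_small //; have := ltn_ord q; rewrite /=; lia.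
move=> r /andP[r0 rn] cr.
pose f (j : nat) : int := (j == 0)%N%:Z.
have := row_coxeterX rowM r f; rewrite cr mulmx1.
have q_lt : (n - r < n)%N by lia.
move=> /rowP/(_ (Ordinal q_lt)); rewrite !mxE /= !pow; try lia.
rewrite (_ : n - r + r = n)%N; last by lia.
rewrite (_ : (n - r).+1 + r = n.+1)%N; last by lia.
by rewrite modnn modn_small // /f; lia.
Qed.

(** In type D_n the Coxeter element acts on the coordinates by a negative
    (n - 1)-cycle and a sign change of the last one. *)
Lemma coxeter_number_D n : (4 <= n)%N -> coxeter_number (TypeD n) (n.-1).*2.
Proof.
move=> n4; pose rw (f : nat -> int) (q : nat) :=
  if (q < n.-1)%N then f q - f q.+1 else f (n - 2)%N + f n.-1.
pose row f : 'rV[int]_(dynkin_rank (TypeD n)) := \row_q rw f q.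
pose neg (f : nat -> int) j :=
  if j == (n - 2)%N then - f n.-1 else if j == n.-1 then - f (n - 2)%N else f j.
pose act (f : nat -> int) i := if (i < n.-1)%N then f \o swap i else neg f.
have n21 : n.-1 = (n - 2).+1 by lia.
have n32 : (n - 2 = (n - 3).+1)%N by lia.
have rowM f i : row f *m simple_reflection i = row (act f i).
  rewrite /row (mul_row_reflection (rw f)); apply/rowP => q; rewrite !mxE.
  rewrite /cartan -(inj_eq val_inj) -[dynkin_adj i q]/(dyn_adj (TypeD n) i q).
  case: i q => i ni [q nq] /=; rewrite /= in ni nq.
  rewrite /rw /act; have [i1|i1] := ltnP i n.-1; have [q1|q1] := ltnP q n.-1.
  - rewrite /= swap_diff; congr (_ - (_ - _%:Z) * _).
    rewrite /dyn_adj /dynkin_edge /= q1 i1 !andbT.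
    have E1 : (q == n.-1) = false by lia.
    have E2 : (i == n.-1) = false by lia.
    by rewrite E1 E2 !andbF !orbF.
  - have -> : q = n.-1 by lia.
    have -> : dyn_adj (TypeD n) i n.-1 = (i == n - 3)%N.
      by rewrite /dyn_adj /dynkin_edge /=; lia.
    rewrite (_ : (i == n.-1) = false); last by lia.
    rewrite /= /swap; have [->|i3] := eqVneq i (n - 3)%N.
      rewrite (_ : (n - 2 == n - 3)%N = false); last by lia.
      rewrite (_ : (n.-1 == n - 3)%N = false); last by lia.
      rewrite (_ : (n.-1 == (n - 3).+1)%N = false); last by lia.
      by rewrite -n32 eqxx /=; ring.
    have [i2|i2] := eqVneq (n - 2)%N i.
      rewrite -i2 -n21 eqxx (_ : (n.-1 == n - 2)%N = false); last by lia.
      by rewrite /=; ring.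
    rewrite (_ : (n - 2 == i.+1)%N = false); last by lia.
    rewrite (_ : (n.-1 == i)%N = false); last by lia.
    rewrite (_ : (n.-1 == i.+1)%N = false); last by lia.
    by rewrite /=; ring.
  - have -> : i = n.-1 by lia.
    have -> : dyn_adj (TypeD n) n.-1 q = (q == n - 3)%N.
      by rewrite /dyn_adj /dynkin_edge /=; lia.
    rewrite (_ : (n.-1 == q) = false); last by lia.
    rewrite /neg; have [->|q3] := eqVneq q (n - 3)%N.
      rewrite -n32 eqxx (_ : (n - 3 == n - 2)%N = false); last by lia.
      rewrite (_ : (n - 3 == n.-1)%N = false); last by lia.
      by rewrite /=; ring.
    rewrite (_ : (q == n.-1) = false); last by lia.
    have [->|q2] := eqVneq q (n - 2)%N.
      rewrite -n21 eqxx (_ : (n.-1 == n - 2)%N = false); last by lia.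
      by rewrite /=; ring.
    rewrite (_ : (q.+1 == n - 2)%N = false); last by lia.
    rewrite (_ : (q.+1 == n.-1)%N = false); last by lia.
    by rewrite /=; ring.
  - have -> : i = n.-1 by lia.
    have -> : q = n.-1 by lia.
    rewrite (_ : dyn_adj (TypeD n) n.-1 n.-1 = false); last first.
      by rewrite /dyn_adj /dynkin_edge /=; lia.
    rewrite /neg !eqxx (_ : (n.-1 == n - 2)%N = false); last by lia.
    by rewrite /=; ring.
have cox1 f j : (j < n)%N -> coxeter_act (TypeD n) act f j =
    if (j < n - 2)%N then f j.+1 else if j == (n - 2)%N then - f 0%N else - f n.-1.
  move=> jn; rewrite /coxeter_act (_ : dynkin_rank _ = n.-1 + 1)%N; last by rewrite /=; lia.
  rewrite iotaD foldl_cat /= add0n {1}/act ltnn.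
  have -> : foldl act f (iota 0 n.-1) = foldl (fun g i => g \o swap i) f (iota 0 n.-1).
    have : all (fun i => i < n.-1)%N (iota 0 n.-1) by apply/allP => i; rewrite mem_iota.
    elim: (iota 0 n.-1) f => //= i r IH f /andP[ir rr].
    by rewrite IH // /act ir.
  rewrite foldl_swap /neg ltnn eqxx.
  have [->|j2] := eqVneq j (n - 2)%N; first by rewrite ltnn.
  have [->|j1] := eqVneq j n.-1.
    rewrite (_ : (n.-1 < n - 2)%N = false); last by lia.
    by rewrite ifT -?n21 //; lia.
  by rewrite !ifT //; lia.
have N0 : (0 < n.-1)%N by lia.
have pow m f : (forall j, (j < n.-1)%N ->
    iter m (coxeter_act (TypeD n) act) f j = (-1) ^+ ((j + m) %/ n.-1) * f ((j + m) %% n.-1)%N)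
    /\ iter m (coxeter_act (TypeD n) act) f n.-1 = (-1) ^+ m * f n.-1.
  elim: m => [|m [IH IHl]].
    split=> [j jn|]; last by rewrite mul1r.
    by rewrite addn0 modn_small // divn_small // mul1r.
  split=> [j jn|]; rewrite iterS cox1; try lia; last first.
    rewrite ifF; last by lia.
    rewrite ifF; last by lia.
    by rewrite IHl exprS; ring.
  have [j2|j2] := ltnP j (n - 2); first by rewrite IH ?addSnnS //; lia.
  rewrite ifT; last by lia.
  rewrite IH // add0n (_ : j + m.+1 = m + n.-1)%N; last by lia.
  by rewrite modnDr divnDr // divnn N0 exprD expr1; ring.
split; first by lia.
  apply: mx1_by_rows => x.
  pose y (q : nat) : int := if insub q is Some q' then x 0 (q' : 'I_n) else 0.
  have yE (q : 'I_n) : y q = x 0 q by rewrite /y valK.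
  pose f (j : nat) : int := if j == n.-1 then y n.-1 - y (n - 2)%N
    else y n.-1 + y (n - 2)%N + \sum_(q < n - 2 | (j <= q)%N) (2 * y q).
  (* the coordinates attached to a row are half-integers *)
  have rf : row f = x *+ 2.
    apply/rowP => q; rewrite mxE mulmxnE -yE; have nq : (q < n)%N := ltn_ord q.
    rewrite /rw /f; case: ltnP => q1; last first.
      have -> : (q : nat) = n.-1 by lia.
      rewrite eqxx ifF; last by lia.
      rewrite big_pred0; last by move=> i; have := ltn_ord i; lia.
      by rewrite mulr2n; ring.
    have E1 : (nat_of_ord q == n.-1) = false by lia.
    rewrite E1.
    have [q2|q2] := ltnP q (n - 2); last first.
      have -> : (q : nat) = (n - 2)%N by lia.
      rewrite -n21 eqxx big_pred0; last by move=> i; have := ltn_ord i; lia.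
      by rewrite mulr2n; ring.
    rewrite ifF; last by lia.
    rewrite (bigD1 (Ordinal q2)) //=.
    rewrite (eq_bigl (fun i : 'I_(n - 2) => (q.+1 <= i)%N)); first by rewrite mulr2n; ring.
    by move=> i; rewrite -(inj_eq val_inj) /=; lia.
  have := row_coxeterX rowM (n.-1).*2 f; rewrite [RHS](_ : _ = row f).
    rewrite rf mulr2n mulmxDl => /rowP e; apply/rowP => q.
    have eq := e q; rewrite [LHS]mxE [RHS]mxE in eq.
    have half (b d : int) : b + b = d + d -> b = d by lia.
    exact: half eq.
  have [p1 p2] := pow (n.-1).*2 f.
  have pE j : (j < n)%N -> iter (n.-1).*2 (coxeter_act (TypeD n) act) f j = f j.
    move=> jn; have [->|j1] := eqVneq j n.-1.
      by rewrite p2 -mul2n exprM sqrrN !expr1n mul1r.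
    rewrite p1; last by lia.
    rewrite -addnn addnA !modnDr modn_small; last by lia.
    rewrite !divnDr ?dvdnn // divnn N0 divn_small ?add0n; last by lia.
    by rewrite addn1 sqrrN expr1n mul1r.
  apply/rowP => q; rewrite !mxE; have nq : (q < n)%N := ltn_ord q.
  by rewrite /rw; case: ltnP => q1; rewrite !pE //; lia.
move=> r /andP[r0 rn] cr.
pose f (j : nat) : int := (j == 0)%N%:Z.
have := row_coxeterX rowM r f; rewrite cr mulmx1.
set g := iter _ _ _ => rfg.
have [p1 p2] := pow r f.
have rfE q : (q < n)%N -> rw f q = rw g q.
  by move=> nq; have /rowP/(_ (Ordinal nq)) := rfg; rewrite !mxE.
have h0 j : (j <= n.-1)%N -> f j - g j = f 0%N - g 0%N.
  elim: j => // j IH jn; rewrite -IH; last by lia.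
  have jn' : (j < n)%N by lia.
  by have := rfE j jn'; rewrite /rw jn; lia.
have fg0 : f 0%N = g 0%N.
  have e1 := h0 n.-1 (leqnn _).
  have e2 : f (n - 2)%N - g (n - 2)%N = f 0%N - g 0%N by apply: h0; lia.
  have e3 : f (n - 2)%N + f n.-1 = g (n - 2)%N + g n.-1.
    by have := rfE n.-1; rewrite /rw ltnn; apply; lia.
  lia.
move: fg0; rewrite /g p1 // add0n /f eqxx.
case: eqP => [r_mod|_]; last by rewrite mulr0.
have rN : r = n.-1.
  have := divn_eq r n.-1; rewrite r_mod addn0.
  by case: (r %/ n.-1)%N => [|[|q]]; nia.
by rewrite rN divnn N0.
Qed.

(* The exceptional types are finite, so their orders can be computed; lists are
   used because matrices do not reduce. *)
Definition seq_reflection t (u : seq int) (i : nat) : seq int :=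
  mkseq (fun q => nth 0 u q - (2 *+ (i == q) - (dyn_adj t i q)%:Z) * nth 0 u i)
    (dynkin_rank t).

Definition order_check t h : bool :=
  let n := dynkin_rank t in
  let e i : seq int := mkseq (fun q => (q == i)%:Z) n in
  let c := coxeter_act t (seq_reflection t) in
  (0 < h)%N && all (fun i => iter h c (e i) == e i) (iota 0 n) &&
  all (fun r => has (fun i => iter r c (e i) != e i) (iota 0 n)) (iota 1 h.-1).

Lemma order_checkP t h : order_check t h -> coxeter_number t h.
Proof.
move=> /andP[/andP[h0 /allP ch] /allP cr].
pose row (u : seq int) : 'rV[int]_(dynkin_rank t) := \row_q nth 0 u q.
have rowM u i : row u *m simple_reflection i = row (seq_reflection t u i).
  rewrite /row (mul_row_reflection (nth 0 u)); apply/rowP => q; rewrite !mxE.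
  by rewrite nth_mkseq.
pose e i : seq int := mkseq (fun q => (q == i)%:Z) (dynkin_rank t).
have rowe (i : 'I_(dynkin_rank t)) : row (e i) = delta_mx 0 i.
  apply/rowP => q; rewrite !mxE nth_mkseq // eqxx /= -(inj_eq val_inj) /=.
  by case: (_ == _).
split=> // [|r /andP[r0 rh] cr1].
  apply/row_matrixP => i; rewrite !rowE -rowe (row_coxeterX rowM) mulmx1.
  have := ch i; rewrite mem_iota => /(_ _)/eqP -> //; exact: ltn_ord.
have /hasP[i] : has (fun i => iter r (coxeter_act t (seq_reflection t)) (e i) != e i)
    (iota 0 (dynkin_rank t)) by apply: cr; rewrite mem_iota; lia.
rewrite mem_iota => /= i_n /negP[]; apply/eqP.
have := row_coxeterX rowM r (e i); rewrite cr1 mulmx1 => /rowP re.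
have sz w : size w = dynkin_rank t -> size (coxeter_act t (seq_reflection t) w) = dynkin_rank t.
  rewrite /coxeter_act; elim: (iota _ _) w => //= j l IH w sw.
  by apply: IH; rewrite size_mkseq.
have szr : size (iter r (coxeter_act t (seq_reflection t)) (e i)) = dynkin_rank t.
  by elim: (r) => [|r' IH] /=; [rewrite size_mkseq|apply: sz].
apply: (@eq_from_nth _ 0) => [|q]; rewrite szr ?size_mkseq // => nq.
by have := re (Ordinal nq); rewrite !mxE.
Qed.

Lemma coxeter_number_dynkin t : dynkin_wf t -> coxeter_number t (dynkin_coxeter t).
Proof.
case: t => [n|n|||] wf.
- exact: coxeter_number_A.
- exact: coxeter_number_D.
- by apply: order_checkP; vm_compute.
- by apply: order_checkP; vm_compute.
- by apply: order_checkP; vm_compute.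
Qed.

End CoxeterElement.

(** * Perron vectors of symmetric positive matrices *)

Section Perron.
Import numFieldNormedType.Exports.
Variables (R : realType) (n : nat) (S : 'I_n -> 'I_n -> R).
Hypothesis n0 : (0 < n)%N.
Hypothesis Spos : forall i j, 0 < S i j.
Hypothesis Ssym : forall i j, S i j = S j i.
Implicit Types x y u : 'I_n -> R.

Let app x i := \sum_j S i j * x j.
Let dot x y := \sum_i x i * y i.

Lemma continuous_sum (T : topologicalType) (I : finType) (F : I -> T -> R) :
  (forall i, continuous (F i)) -> continuous (fun t => \sum_i F i t).
Proof.
move=> cF; apply: continuous_big; last by move=> i _; apply: cF.
exact: add_continuous.
Qed.

Lemma rayleigh_max : exists2 u, dot u u = 1 &
  forall y, dot y y = 1 -> dot y (app y) <= dot u (app u).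
Proof.
pose A := [set u : 'rV[R]_n | dot (u 0) (u 0) = 1]%classic.
pose f (u : 'rV[R]_n) := dot (u 0) (app (u 0)).
have cc i : continuous (fun u : 'rV[R]_n => u 0 i) by apply: coord_continuous.
have cM (g h : 'rV[R]_n -> R) : continuous g -> continuous h ->
  continuous (fun v : 'rV[R]_n => g v * h v).
  by move=> cg ch v; exact: (cvgM (cg v) (ch v)).
have cdot : continuous (fun u : 'rV[R]_n => dot (u 0) (u 0)).
  by apply: continuous_sum => i; apply: (cM).
have cf : continuous f.
  apply: continuous_sum => i; apply: (cM) => //.
  apply: continuous_sum => j; apply: (cM) => //; exact: cst_continuous.
have A0 : (A !=set0)%classic.
  exists (delta_mx 0 (Ordinal n0)); rewrite /A /= /dot (bigD1 (Ordinal n0)) //=.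
  rewrite big1 ?addr0 => [|j /negPf j0]; first by rewrite mxE !eqxx mulr1.
  by rewrite mxE j0 mulr0.
have cA : compact A.
  have Mnco : compact
      [set v : 'rV[R]_n | forall i, `[-1, 1]%classic (v ord0 i)]%classic.
    apply: (@rV_compact R n (fun=> `[-1, 1]%classic)).
    by move=> _; apply: segment_compact.
  apply: subclosed_compact Mnco _.
    have := @preimage_closed _ _ (fun u : 'rV[R]_n => dot (u 0) (u 0)) [set x : R | x = 1]%classic.
    by apply => //; apply: closed_eq.
  move=> u /= u1 i; rewrite in_itv /= -ler_norml -[leRHS]sqrtr1 -sqrtr_sqr ler_wsqrtr //.
  rewrite -u1 /dot (bigD1 i) //= -expr2 lerDl sumr_ge0 // => j _.
  by rewrite -expr2 sqr_ge0.
have [u uA umax] := EVT_max_rV A0 cA (continuous_subspaceT cf).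
move: uA; rewrite inE => uA; exists (u 0) => // y y1.
have yE : (\row_i y i) 0 = y by apply/funext => i; rewrite mxE.
by have := umax (\row_i y i); rewrite /f yE; apply; rewrite inE /A /= yE.
Qed.

(** A maximizer of the quadratic form on the sphere is an eigenvector, and so is
    its entrywise absolute value, which is again a maximizer. It is positive
    because [S] is, and it spans its eigenspace: subtracting a suitable multiple
    of it from another eigenvector leaves a nonnegative eigenvector with a zero
    entry. *)
Lemma perron_vector : exists (w : 'I_n -> R) (mu : R),
  [/\ forall i, 0 < w i, forall i, app w i = mu * w i
    & forall y, (forall i, app y i = mu * y i) -> exists c, forall i, y i = c * w i].
Proof.
have [u u1 umax] := rayleigh_max.
pose mu := dot u (app u).
pose g y := mu * dot y y - dot y (app y).
have dotZ c x y : dot x (fun i => c * y i) = c * dot x y.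
  by rewrite /dot mulr_sumr; apply: eq_bigr => i _; rewrite mulrCA.
have dotC x y : dot x y = dot y x by apply: eq_bigr => i _; rewrite mulrC.
have dotD x y z : dot x (fun i => y i + z i) = dot x y + dot x z.
  by rewrite /dot -big_split; apply: eq_bigr => i _; rewrite mulrDr.
have appZ c x : app (fun i => c * x i) = fun i => c * app x i.
  by apply/funext => i; rewrite /app mulr_sumr; apply: eq_bigr => j _; rewrite mulrCA.
have appD x y : app (fun i => x i + y i) = fun i => app x i + app y i.
  by apply/funext => i; rewrite /app -big_split; apply: eq_bigr => j _; rewrite mulrDr.
have app_sym x y : dot x (app y) = dot y (app x).
  rewrite /dot /app; under eq_bigr do rewrite mulr_sumr.
  under [RHS]eq_bigr do rewrite mulr_sumr.
  rewrite exchange_big; apply: eq_bigr => i _; apply: eq_bigr => j _.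
  by rewrite Ssym; ring.
have dot_ge0 x : 0 <= dot x x by apply: sumr_ge0 => i _; rewrite -expr2 sqr_ge0.
have g0 y : 0 <= g y.
  have [y0|yn0] := eqVneq (dot y y) 0.
    have yi i : y i = 0.
      move/eqP: y0; rewrite psumr_eq0 => [/allP/(_ i)|j _]; last by rewrite -expr2 sqr_ge0.
      by rewrite mem_index_enum mulf_eq0 orbb => /(_ isT)/eqP.
    rewrite /g y0 mulr0 sub0r oppr_ge0 /dot big1 // => i _; by rewrite yi mul0r.
  have yp : 0 < dot y y by rewrite lt_def yn0 dot_ge0.
  pose c := (Num.sqrt (dot y y))^-1.
  have c2 : c * c * dot y y = 1.
    by rewrite -expr2 /c exprVn sqr_sqrtr ?mulVf // ltW.
  have := umax (fun i => c * y i).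
  rewrite appZ !dotZ [X in c * X = 1]dotC [X in c * X <= _]dotC !dotZ !mulrA => /(_ c2) H.
  have : dot y y * (c * c * dot (app y) y) <= dot y y * mu by rewrite ler_pM2l.
  rewrite mulrA [dot y y * _]mulrC c2 mul1r => H'.
  by rewrite /g subr_ge0 mulrC [leLHS]dotC.
have gu : g u = 0 by rewrite /g u1 mulr1 subrr.
(* vectors on which the nonnegative form [g] vanishes lie in its kernel *)
have ker x : g x = 0 -> forall i, app x i = mu * x i.
  move=> gx i; pose e j : R := (j == i)%:R.
  have dote y : dot e y = y i.
    rewrite /dot (bigD1 i) //= big1 ?addr0 => [|j ji]; first by rewrite /e eqxx mul1r.
    by rewrite /e (negPf ji) mul0r.
  pose b := mu * x i - app x i.
  have gt t : g (fun j => x j + t * e j) = g x + 2 * t * b + t * t * g e.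
    rewrite /g appD appZ !dotD !dotZ ![dot (fun j => _ + _) _]dotC !dotD !dotZ.
    rewrite [dot x e]dotC [dot (app x) e]dotC !dote [dot (app e) x]dotC (app_sym x e) !dote.
    rewrite [dot (app x) x]dotC [dot (app e) e]dotC !dote /b; ring.
  have ge1 : 0 < g e + 1 by rewrite ltr_wpDl.
  have [b0|bn0] := eqVneq b 0; first by apply/eqP; rewrite -subr_eq0 -oppr_eq0 opprB -/b b0.
  have := g0 (fun j => x j + (- b / (g e + 1)) * e j).
  rewrite gt gx add0r.
  have -> : 2 * (- b / (g e + 1)) * b + - b / (g e + 1) * (- b / (g e + 1)) * g e
     = - (b ^+ 2 * (g e + 2)) / (g e + 1) ^+ 2.
    by field; rewrite gt_eqF.
  rewrite mulNr oppr_ge0 leNgt divr_gt0 ?exprn_gt0 // mulr_gt0 //.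
    by rewrite exprn_even_gt0.
  by rewrite ltr_wpDl.
pose w i := `|u i|.
have gw : g w = 0.
  apply/eqP; rewrite eq_le g0 andbT -gu /g lerB //.
    by rewrite (_ : dot w w = dot u u) //; apply: eq_bigr => i _; rewrite -normrM ger0_norm // -expr2 sqr_ge0.
  apply: ler_sum => i _; rewrite /app !mulr_sumr; apply: ler_sum => j _.
  apply: le_trans (ler_norm _) _; rewrite !normrM /w.
  by rewrite (ger0_norm (ltW (Spos i j))).
have w0 i : 0 <= w i by apply: normr_ge0.
have app_pos x : (forall i, 0 <= x i) -> (exists i, x i != 0) -> forall i, 0 < app x i.
  move=> x0 [j xj] i; rewrite /app (bigD1 j) //= ltr_wpDr //.
    by apply: sumr_ge0 => l _; rewrite mulr_ge0 // ltW.
  by rewrite mulr_gt0 // lt_def xj x0.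
have wnz : exists i, w i != 0.
  apply: contrapT => H; have : dot u u = 0.
    rewrite /dot big1 // => i _; suff -> : u i = 0 by rewrite mulr0.
    by apply: contrapT => /eqP ui; apply: H; exists i; rewrite normr_eq0.
  by rewrite u1 => /eqP; rewrite oner_eq0.
have wE := ker _ gw.
have wpos i : 0 < w i.
  have := app_pos w w0 wnz i; rewrite wE lt_def mulf_eq0 negb_or => /andP[/andP[_ wi] _].
  by rewrite lt_def wi w0.
exists w, mu; split=> // y yE.
(* subtract the largest multiple of [w] below [y]: a coordinate vanishes *)
pose i0 := [arg min_(i < Ordinal n0) (y i / w i)]%O.
have i0min i : y i0 / w i0 <= y i / w i.
  by rewrite /i0; case: arg_minP => //= j _; apply.
exists (y i0 / w i0) => i; apply: contrapT => /eqP neq.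
pose z j := y j + (- (y i0 / w i0)) * w j.
have z0 j : 0 <= z j by rewrite /z mulNr subr_ge0 -ler_pdivlMr.
have zi0 : z i0 = 0 by rewrite /z mulNr divfK ?subrr // gt_eqF.
have := app_pos z z0 (ex_intro _ i _) i0.
rewrite /z mulNr subr_eq0 => /(_ neq).
rewrite appD (appZ _ w) yE wE mulNr.
by rewrite mulrCA divfK ?subrr ?ltxx // gt_eqF.
Qed.

End Perron.

(** * Frobenius-Perron eigenvectors of fusion and module categories *)

Section FrobeniusPerron.
Variables (R : realType) (k : closedFieldType) (C : monCat k).
Hypothesis hC : fusion C.
Variables (nC : nat) (LC : 'I_nC -> C).
Hypothesis hLC : irr_reps LC.
Variables (P D : C).
Hypothesis dDP : left_dual D P.

Let fsC : finite_semisimple C. Proof. by case: hC. Qed.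

(** Right multiplication by the sum [X0] of all simple objects is given by a
    matrix [K] with positive entries, which commutes with left multiplications.
    So does K K^T, because duality transposes left multiplications, and the
    eigenvector of this symmetric positive matrix is unique up to scaling, hence
    an eigenvector for left multiplication by [P] and by [D]. *)
Lemma fusion_eigenvector : exists (lam : R) (w : 'I_nC -> R),
  (forall i, 0 < w i) /\ bip_eigen (M := regular C) LC lam P w w.
Proof.
have nC0 : (0 < nC)%N.
  have [_ _ simI] := hC; have [_ _ repL] := hLC.
  by have [i _] := repL _ simI; case: (nC) i => [|//] [].
have [X0 dsX0] := biproduct_exists fsC LC.
pose N (X : C) : 'M[R]_nC := \matrix_(i, j) (mult LC i (tens X (LC j)))%:R.
pose K : 'M[R]_nC := \matrix_(l, i) (mult LC l (tens (LC i) X0))%:R.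
have K0 l i : 0 < K l i.
  rewrite mxE ltr0n; have := act_direct_sum (M := regular C) (LC i) dsX0.
  move=> /(mult_direct_sum LC l) /= ->.
  have [j mj] := mult_tens_transitive hC hLC i l.
  by rewrite (bigD1 j) //= ltn_addr.
have NK X : N X *m K = K *m N X.
  apply/matrixP => l i; rewrite !mxE.
  have := mult_act_assoc (M := regular C) fsC hLC fsC hLC X X0 i l.
  move/(congr1 (fun m => m%:R : R)); rewrite !natr_sum /= => E.
  under eq_bigr do rewrite !mxE -natrM.
  under [RHS]eq_bigr do rewrite !mxE -natrM.
  exact: E.
have Ntr : (N P)^T = N D.
  apply/matrixP => i j; rewrite !mxE.
  by rewrite (mult_dual (M := regular C) fsC hLC _ _ dDP).
pose S := K *m K^T.
have Ssym i j : S i j = S j i by rewrite !mxE; apply: eq_bigr => l _; rewrite !mxE mulrC.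
have Spos i j : 0 < S i j.
  rewrite mxE (bigD1 (Ordinal nC0)) //= ltr_wpDr //; last by rewrite mulr_gt0 // mxE.
  by apply: sumr_ge0 => l _; rewrite mulr_ge0 // ?[_^T _ _]mxE ltW.
have NSP : N P *m S = S *m N P.
  rewrite /S mulmxA NK -!mulmxA; congr (_ *m _).
  by apply: trmx_inj; rewrite !trmx_mul trmxK Ntr NK.
have NSD : N D *m S = S *m N D.
  rewrite /S mulmxA NK -!mulmxA; congr (_ *m _).
  by apply: trmx_inj; rewrite !trmx_mul trmxK -Ntr trmxK NK.
have [w [mu [w0 wE uniq_w]]] := perron_vector nC0 Spos Ssym.
pose W : 'cV[R]_nC := \col_i w i.
have SW : S *m W = mu *: W.
  apply/colP => i; rewrite !mxE -wE; apply: eq_bigr => j _; by rewrite !mxE.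
have eig X : N X *m S = S *m N X -> exists lam, forall i, (N X *m W) i 0 = lam * w i.
  move=> NS; apply: uniq_w => i.
  have := congr1 (fun A : 'cV_nC => A i 0) (mulmxA S (N X) W).
  rewrite -NS -mulmxA SW -scalemxAr [RHS]mxE => <-.
  by rewrite mxE.
have [lam lamE] := eig P NSP; have [lam' lamE'] := eig D NSD.
have ww : 0 < \sum_i w i * w i.
  rewrite (bigD1 (Ordinal nC0)) //= ltr_wpDr ?mulr_gt0 //.
  by apply: sumr_ge0 => i _; rewrite mulr_ge0 // ltW.
have eq_lam : lam' = lam.
  apply: (mulIf (lt0r_neq0 ww)); rewrite !mulr_sumr.
  transitivity ((W^T *m (N D *m W)) 0 0).
    by rewrite mxE; apply: eq_bigr => i _; rewrite lamE' !mxE mulrCA.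
  transitivity ((W^T *m (N P *m W)) 0 0).
    rewrite -Ntr mulmxA -trmx_mul -[LHS]/((_^T *m _) 0 0).
    rewrite -[in RHS](trmxK (N P *m W)) -trmx_mul [RHS]mxE.
    by [].
  by rewrite mxE; apply: eq_bigr => i _; rewrite lamE !mxE mulrCA.
exists lam, w; split=> //; split=> i.
  rewrite -eq_lam -lamE' mxE; apply: eq_bigr => j _; rewrite -Ntr !mxE.
  by rewrite mulrC.
by rewrite -lamE mxE; apply: eq_bigr => j _; rewrite !mxE.
Qed.

Section Eigenvalue.
Variables (lam : R) (w : 'I_nC -> R).
Hypothesis w0 : forall i, 0 < w i.
Hypothesis Ew : bip_eigen (M := regular C) LC lam P w w.

(** Pair the absolute value of any other eigenvector with the positive one. *)
Lemma FPdimE : FPdim R LC P = lam.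
Proof.
have nC0 : (0 < nC)%N.
  have [_ _ simI] := hC; have [_ _ repL] := hLC.
  by have [i _] := repL _ simI; case: (nC) i => [|//] [].
pose i0 := Ordinal nC0.
pose N : 'M[R]_nC := map_mx intr (gr_mx LC (tens P)).
have NE i j : N i j = (mult LC i (tens P (LC j)))%:R.
  by rewrite mxE (gr_mxE fsC hLC).
have N0 i j : 0 <= N i j by rewrite NE.
have [E1 E2] := Ew.
have lam0 : 0 <= lam.
  rewrite -(pmulr_lge0 _ (w0 i0)) -E2; apply: sumr_ge0 => j _.
  by rewrite mulr_ge0 // ltW.
have lamA : eigenvalue N lam.
  apply/eigenvalueP; exists (\row_i w i).
    apply/rowP => j; rewrite !mxE -E1; apply: eq_bigr => i _.
    by rewrite mxE NE.
  apply/eqP => /rowP/(_ i0); rewrite !mxE => w00.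
  by have := w0 i0; rewrite w00 ltxx.
have ubA x : 0 <= x /\ eigenvalue N x -> x <= lam.
  move=> [x0 /eigenvalueP[u uN un0]].
  pose s := \sum_i `|u 0 i| * w i.
  have s0 : 0 < s.
    have [i ui] : exists i, u 0 i != 0.
      apply: contrapT => H; case/eqP: un0; apply/rowP => i; rewrite mxE.
      by apply: contrapT => /eqP ui; apply: H; exists i.
    rewrite /s (bigD1 i) //= ltr_wpDr ?mulr_gt0 ?normr_gt0 //.
    by apply: sumr_ge0 => j _; rewrite mulr_ge0 // ltW.
  rewrite -(ler_pM2r s0) /s mulr_sumr mulr_sumr.
  have -> : \sum_i lam * (`|u 0 i| * w i) = \sum_j (\sum_i `|u 0 i| * N i j) * w j.
    under [RHS]eq_bigr do rewrite mulr_suml.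
    rewrite exchange_big; apply: eq_bigr => i _.
    rewrite mulrCA -E2 mulr_sumr; apply: eq_bigr => j _.
    by rewrite NE mulrA.
  apply: ler_sum => j _; rewrite mulrA ler_pM2r //.
  rewrite -{1}(ger0_norm x0) -normrM.
  have -> : x * u 0 j = \sum_i u 0 i * N i j.
    by have /rowP/(_ j) := uN; rewrite !mxE => <-.
  apply: le_trans (ler_norm_sum _ _ _) _; apply: ler_sum => i _.
  by rewrite normrM (ger0_norm (N0 i j)).
rewrite /FPdim; apply/eqP; rewrite eq_le; apply/andP; split.
  apply: ge_sup; first by exists lam.
  by move=> x /= /ubA.
apply: ub_le_sup => //; exists lam => x /= /ubA //.
Qed.

Variables (M : modCat C).
Hypothesis hM : finite_semisimple M.
Variables (nM : nat) (LM : 'I_nM -> M).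
Hypothesis hLM : irr_reps LM.

(** The vector sum_i w_i [L_i (x) A], with [A] the sum of all simple objects
    of [M], transports the eigenvector [w] to the module category. *)
Lemma module_eigenvector : exists v : 'I_nM -> R,
  (forall i, 0 < v i) /\ bip_eigen LM lam P v v.
Proof.
have [A dsA] := biproduct_exists hM LM.
have [_ _ simI] := hC.
pose K l i : R := (mult LM l (act (LC i) A))%:R.
pose v l := \sum_i K l i * w i.
have transport X : (forall i, \sum_j (mult LC i (tens X (LC j)))%:R * w j = lam * w i) ->
    forall i, \sum_j (mult LM i (act X (LM j)))%:R * v j = lam * v i.
  move=> EX l; rewrite /v mulr_sumr.
  under eq_bigr do rewrite mulr_sumr.
  rewrite exchange_big /=.
  transitivity (\sum_i (\sum_j K l j * (mult LC j (tens X (LC i)))%:R) * w i).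
    apply: eq_bigr => i _; under eq_bigr do rewrite mulrA.
    rewrite -mulr_suml; congr (_ * _).
    have := mult_act_assoc hM hLM fsC hLC X A i l.
    move/(congr1 (fun m => m%:R : R)); rewrite !natr_sum => E.
    rewrite /K; under eq_bigr do rewrite -natrM.
    by under [RHS]eq_bigr do rewrite -natrM.
  under [LHS]eq_bigr do rewrite mulr_suml.
  rewrite exchange_big; apply: eq_bigr => j _.
  under eq_bigr do rewrite -mulrA.
  by rewrite -mulr_sumr EX mulrCA.
exists v; split=> [l|].
  have [i0 i0E] := mult_act_unit LM hLC A simI.
  rewrite /v (bigD1 i0) //= ltr_wpDr //.
    by apply: sumr_ge0 => i _; rewrite mulr_ge0 // ltW.
  rewrite mulr_gt0 // /K i0E ltr0n (mult_direct_sum LM l dsA) (bigD1 l) //=.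
  by rewrite (mult_L hM hLM) eqxx.
have [EP _] := Ew; have [_ EP2] := Ew.
have EwD := proj1 (bip_eigen_dual fsC hLC lam w w (M := regular C) dDP) Ew.
have vP := transport _ EP2.
have vD := transport _ (proj2 EwD).
split=> // j; rewrite -vD; apply: eq_bigr => i _.
by rewrite (mult_dual hM hLM _ _ dDP) mulrC.
Qed.

End Eigenvalue.
End FrobeniusPerron.

(** * Components of the unfolded quiver and the theorem *)

Section ClassificationResult.
Variables (R : realType) (V : finType) (a : V -> V -> nat).
Hypothesis a_sym : forall x y, a x y = a y x.
Hypothesis a_irr : forall x, a x x = 0%N.
Variables (lam : R) (v : V -> R).
Hypothesis v0 : forall x, 0 < v x.
Hypothesis Ev : forall x, \sum_y (a x y)%:R * v y = lam * v x.
Hypothesis lam2 : lam < 2.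

Lemma dynkin_extend x0 t s y z : dynkin_list a x0 t s -> y \notin s ->
  z \in s -> (0 < a z y)%N ->
  exists t' s', dynkin_list a x0 t' s' /\ perm_eq s' (y :: s).
Proof.
move=> dl ys zs azy; have [_ us ss _] := dl.
have pt : (index z s < dynkin_rank t)%N by rewrite -ss index_mem.
have ay : (0 < a (nth x0 s (index z s)) y)%N by rewrite nth_index.
case: t dl pt {ss} => [n|n|||] dl pt.
- exact: (extend_A a_sym a_irr v0 Ev lam2 ys dl pt ay).
- exact: (extend_D a_sym a_irr v0 Ev lam2 ys dl pt ay).
- exact: (extend_E6 a_sym a_irr v0 Ev lam2 ys dl pt ay).
- exact: (extend_E7 a_sym a_irr v0 Ev lam2 ys dl pt ay).
- by case: (extend_E8 a_sym a_irr v0 Ev lam2 ys dl pt ay).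
Qed.

(** A Dynkin subdiagram through [x0] of maximal size is closed under adjacency,
    since any adjacent vertex could be added to it. *)
Lemma dynkin_component x0 : exists t s,
  [/\ dynkin_list a x0 t s, x0 \in s
    & forall x y, x \in s -> (0 < a x y)%N -> y \in s].
Proof.
have start : exists t s, [/\ dynkin_list a x0 t s, x0 \in s & (#|V| - size s <= #|V|)%N].
  exists (TypeA 1), [:: x0]; split; rewrite ?inE ?leq_subr //.
  by split=> // -[|//] [|//] _ _; rewrite /= a_irr.
have [N] : exists N, exists t s, [/\ dynkin_list a x0 t s, x0 \in s & (#|V| - size s <= N)%N].
  by exists #|V|.
elim: N => [|N IH] [t [s [dl x0s sN]]].
  exists t, s; split=> // x y xs axy; have [_ us _ _] := dl.
  apply: contraTT sN => ys; rewrite -ltnNge subn_gt0.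
  have := max_card (mem (y :: s)).
  have /card_uniqP -> : uniq (y :: s) by rewrite /= ys.
  by [].
have [closed|nclosed] := pselect (forall x y, x \in s -> (0 < a x y)%N -> y \in s).
  by exists t, s.
have [x [y [xs axy ys]]] : exists x y, [/\ x \in s, (0 < a x y)%N & y \notin s].
  apply: contrapT => H; apply: nclosed => x y xs axy; apply: contrapT => /negP ys.
  by apply: H; exists x, y.
have [t' [s' [dl' perm_s']]] := dynkin_extend dl ys xs axy.
apply: IH; exists t', s'; split=> //.
  by rewrite (perm_mem perm_s') inE x0s orbT.
by rewrite (perm_size perm_s') /= subnS -subn1 leq_subLR add1n.
Qed.

(** Pairing the positive eigenvector with the one of the Dynkin diagram
    identifies the two eigenvalues. *)
Lemma dynkin_eigenvalue x0 t s : dynkin_list a x0 t s ->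
  (forall x y, x \in s -> (0 < a x y)%N -> y \in s) ->
  lam = 2 * cos (pi / (dynkin_coxeter t)%:R).
Proof.
move=> [wf us ss aE] closed; have [u [u0 uE]] := dynkin_eigenvector R wf.
set mu := 2 * _ in uE *; pose n := dynkin_rank t; pose x j := nth x0 s j.
have n0 : (0 < n)%N by rewrite /n; case: (t) wf => [?|?|||] //= /ltnW/ltnW/ltnW.
have rowE (i : 'I_n) : \sum_(j < n) (dyn_adj t i j)%:R * v (x j) = lam * v (x i).
  rewrite -Ev (bigID (mem s)) /= [X in _ = _ + X]big1 => [|y ys]; last first.
    rewrite (_ : a _ _ = 0%N) ?mul0r //; apply/eqP; rewrite -leqn0 leqNgt.
    by apply: contra ys => /closed; apply; rewrite mem_nth ?ss.
  rewrite addr0 -(big_uniq _ us) (big_nth x0) ss big_mkord.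
  by apply: eq_bigr => j _; rewrite aE.
pose S := \sum_(i < n) u i * v (x i).
have S0 : 0 < S.
  rewrite /S (bigD1 (Ordinal n0)) //= ltr_wpDr ?mulr_gt0 ?u0 //.
  by apply: sumr_ge0 => i _; rewrite mulr_ge0 ?ltW ?u0.
apply: (mulIf (lt0r_neq0 S0)); rewrite /S !mulr_sumr.
under eq_bigr do rewrite mulrCA -rowE mulr_sumr.
rewrite exchange_big; apply: eq_bigr => j _ /=.
rewrite mulrA -uE // mulr_suml; apply: eq_bigr => i _.
by rewrite mulrCA mulrA /dyn_adj orbC.
Qed.

End ClassificationResult.

Section ComponentType.
Variables (R : realType) (Q : quiver).
Variables (lam : R) (w : Q -> R).
Hypothesis w0 : forall x, 0 < w x.
Hypothesis Ew : forall x, \sum_y (nedge x y)%:R * w y = lam * w x.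
Hypothesis lam2 : lam < 2.
Hypothesis noloop : forall x : Q, nedge x x = 0%N.

Lemma component_ADE (v : Q) : exists t,
  [/\ has_dynkin_type (component v) t, coxeter_number t (dynkin_coxeter t),
      (2 <= dynkin_coxeter t)%N & lam = 2 * cos (pi / (dynkin_coxeter t)%:R)].
Proof.
have nedgeC (x y : Q) : nedge x y = nedge y x by rewrite /nedge addnC.
have [t [s [dl vs closed]]] := dynkin_component nedgeC noloop w0 Ew lam2 v.
have [wf us ss aE] := dl.
have csym : connect_sym (fun x y : Q => (0 < nedge x y)%N).
  by apply: sym_connect_sym => x y; rewrite nedgeC.
have compE (x : Q) : connect (fun x y : Q => (0 < nedge x y)%N) v x = (x \in s).
  apply/idP/idP => [/connectP[p]|xs].
    elim: p (v) vs => [|y p IH] z zs /= => [_ ->//|/andP[zy yp] e].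
    exact: IH _ (closed _ _ zs zy) yp e.
  have := dynkin_list_connected nedgeC dl vs xs; apply: connect_sub => y z.
  by move=> /and3P[_ _ yz]; apply: connect1.
exists t; split.
- split=> //.
  have hP (x : component v) : (index (val x) s < dynkin_rank t)%N.
    by rewrite -ss index_mem -compE; apply: valP.
  have gP (i : 'I_(dynkin_rank t)) :
      connect (fun x y : Q => (0 < nedge x y)%N) v (nth v s i).
    by rewrite compE mem_nth // ss.
  exists (fun x => Ordinal (hP x)); split.
    exists (fun i : 'I_(dynkin_rank t) => exist _ (nth v s i) (gP i) : component v)
      => [x|i]; apply: val_inj => /=.
      by rewrite nth_index // -compE; apply: valP.
    by rewrite index_uniq // ss.
  move=> x y; have xs : val x \in s by rewrite -compE; apply: valP.
  have ys : val y \in s by rewrite -compE; apply: valP.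
  have := aE _ _ (hP x) (hP y); rewrite !nth_index //.
- exact: coxeter_number_dynkin.
- by case: (t) wf => [n|n|||] //=; lia.
- exact: (dynkin_eigenvalue w0 Ew dl closed).
Qed.

End ComponentType.

Section Unfolded.
Variables (R : realType) (k : closedFieldType) (C : monCat k) (M : modCat C).
Variables (n : nat) (L : 'I_n -> M) (P : C) (lam : R) (v : 'I_n -> R).
Hypothesis v0 : forall l, 0 < v l.
Hypothesis Ev : bip_eigen L lam P v v.

Lemma unfolded_eigenvector (x : unfolded P L) :
  \sum_y (nedge x y)%:R * v y.2 = lam * v x.2.
Proof.
have [E1 E2] := Ev.
rewrite -(pair_bigA _ (fun b i => (nedge x (b, i))%:R * v i)) /= big_bool /=.
case: x => -[] j; rewrite /nedge /=.
  rewrite big1 ?add0r => [|i _]; last by rewrite mul0r.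
  by rewrite -E2; apply: eq_bigr => i _; rewrite add0n.
rewrite addrC big1 ?add0r => [|i _]; last by rewrite mul0r.
by rewrite -E1; apply: eq_bigr => i _; rewrite addn0 mulrC.
Qed.

Lemma unfolded_bipartite (x : unfolded P L) : bipartite (component x).
Proof.
exists (fun y => ~~ (val y).1) => y z /=.
by case: ifP => // /andP[-> ->].
Qed.

Lemma unfolded_component (x : unfolded P L) : lam < 2 -> exists m,
  [/\ ADE_with_coxeter_number (component x) m, (2 <= m)%N
    & lam = 2 * cos (pi / m%:R)].
Proof.
move=> lam2; have noloop (y : unfolded P L) : nedge y y = 0%N.
  by rewrite /nedge /=; case: y => -[].
have [t [? ? ? ?]] := component_ADE (w := fun y : unfolded P L => v y.2)
  (fun y => v0 y.2) unfolded_eigenvector lam2 noloop x.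
by exists (dynkin_coxeter t); split=> //; exists t.
Qed.

End Unfolded.

Lemma cos_frac_inj (R : realType) m m' : (2 <= m)%N -> (2 <= m')%N ->
  2 * cos (pi / m%:R) = 2 * cos (pi / m'%:R) :> R -> m = m'.
Proof.
have p0 := pi_gt0 R.
have frac j : (2 <= j)%N -> (pi / j%:R : R) \in `[0, pi]%R.
  move=> j2; have j0 : 1 <= j%:R :> R by rewrite ler1n; lia.
  rewrite in_itv /=; apply/andP; split; first by rewrite divr_ge0 // ltW.
  by rewrite ler_pdivrMr ?ler_peMr //; lra.
have two0 : 2 != 0 :> R by rewrite pnatr_eq0.
move=> m2 m'2 /(mulfI two0) e.
have /(mulfI (lt0r_neq0 p0))/invr_inj/eqP := cos_inj (frac _ m2) (frac _ m'2) e.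
by rewrite eqr_nat => /eqP.
Qed.

Theorem theorem5p27 (R : realType) (k : closedFieldType)
    (C : monCat k) (hC : fusion C)
    (nC : nat) (LC : 'I_nC -> C) (hLC : irr_reps LC)
    (Pi Pi' : C) (hPi' : left_dual Pi' Pi)
    (M : modCat C) (hM : finite_semisimple M) (hM0 : exists X : M, ~ is_zero X)
    (nM : nat) (LM : 'I_nM -> M) (hLM : irr_reps LM) :
  let Qu := unfolded Pi LM in
  let cond1 := finitely_many_indecomposables (Rep M Pi) in
  let cond2 := finite_order (sigma_a LM (act Pi') *m sigma_b LM (act Pi)) in
  let cond3 := finite_order (sigma_a LC (tens Pi') *m sigma_b LC (tens Pi)) in
  let cond4 := exists m : nat, (2 <= m)%N /\
    FPdim R LC Pi = 2 * cos (pi / m%:R) /\ 2 * cos (pi / m%:R) < 2 :> R in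
  [/\ [<-> cond1; cond2; cond3; cond4],
      [\/ cond1, cond2, cond3 | cond4] ->
        exists m : nat,
          [/\ (2 <= m)%N, FPdim R LC Pi = 2 * cos (pi / m%:R)
            & forall v : Qu, bipartite (component v) /\
                ADE_with_coxeter_number (component v) m]
    & ~ [\/ cond1, cond2, cond3 | cond4] ->
        forall v : Qu, infinite_type k (component v)].
Proof.
move=> Qu cond1 cond2 cond3 cond4.
have [fsC _ simI] := hC.
have [lam [w [w0 Ew]]] := fusion_eigenvector R hC hLC hPi'.
have [v [v0 Ev]] := module_eigenvector hC hLC hPi' w0 Ew hM hLM.
have FP := FPdimE hC hLC w0 Ew.
have nM0 : (0 < nM)%N.
  have [X X0] := hM0; have [i _] := nonzero_has_simple hM hLM X0.
  by case: (nM) i => [[]|].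
have nC0 : (0 < nC)%N.
  have [_ _ repL] := hLC; have [i _] := repL _ simI.
  by case: (nC) i => [[]|].
have uc (x : Qu) : lam < 2 -> _ := unfolded_component v0 Ev x.
have lt_or_ge (c : Prop) : (2 <= lam -> ~ c) -> c -> lam < 2.
  by move=> H hc; rewrite ltNge; apply/negP => /H.
have c1 : cond1 <-> lam < 2.
  split; last exact: (Rep_finite hC hM hLM v0 Ev).
  by apply: lt_or_ge => lam2; apply: (Rep_infinite hC hM hLM v0 Ev lam2 nM0).
have c2 : cond2 <-> lam < 2.
  split; last exact: (sigma_finite_order hM hLM hPi' v0 Ev).
  by apply: lt_or_ge => lam2; apply: (sigma_infinite_order hM hLM hPi' v0 Ev lam2 nM0).
have c3 : cond3 <-> lam < 2.
  split; last exact: (sigma_finite_order (M := regular C) fsC hLC hPi' w0 Ew).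
  apply: lt_or_ge => lam2.
  exact: (sigma_infinite_order (M := regular C) fsC hLC hPi' w0 Ew lam2 nC0).
have c4 : cond4 <-> lam < 2.
  split=> [[m [_ [<- ]]]|lam2]; first by rewrite FP.
  have [m [_ m2 lamE]] := uc (false, Ordinal nM0) lam2.
  by exists m; rewrite FP -lamE.
have any : [\/ cond1, cond2, cond3 | cond4] <-> lam < 2.
  by split=> [[/c1|/c2|/c3|/c4]|/c1] //; constructor.
split.
- by split; [|split; [|split]]; move=> *; try apply/c1; try apply/c2; tauto.
- move=> /any lam2; have [m [_ m2 lamE]] := uc (false, Ordinal nM0) lam2.
  exists m; split=> //; first by rewrite FP.
  move=> x; split; first exact: unfolded_bipartite.
  have [m' [ade m'2 lamE']] := uc x lam2.
  by rewrite (cos_frac_inj m2 m'2 (etrans (esym lamE) lamE')).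
move=> nany x; apply: (component_infinite_type hC hM hLM v0 Ev).
by rewrite leNgt; apply/negP => /any.
Qed.
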